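(* Let $n\in\mathbb{N}$, $n>1$, and let $\lambda,\mu>0$, $\mathcal{K},\mathcal{S}>0$. Put \[ r_{\mathrm{min}}:=\left(\frac{2\lambda}{3\lambda+2\mu}\right)^{1/2}\mathcal{S}. \] (Necessity) Let $\mathfrak{B}_1+\dots+\mathfrak{B}_n$ be an $n$-body static, spherically symmetric, self-gravitating matter distribution such that $\mathfrak{B}_n$ is a shell of Seth elastic matter with Lamé coefficients $\lambda,\mu$ and reference parameters $\mathcal{K},\mathcal{S}$. Then the inner radius $r_{2n-2}$ of $\mathfrak{B}_n$ satisfies \[ r_{\mathrm{min}}\leq r_{2n-2}<\mathcal{S}. \] In particular $\mathcal{S}>r_{2n-3}$ must hold, where $r_{2n-3}$ is the outer radius of $\mathfrak{B}_{n-1}$. (Sufficiency) Conversely, let $\mathfrak{B}_1+\dots+\mathfrak{B}_{n-1}$ be an $(n-1)$-body static, spherically symmetric, self-gravitating matter distribution, and let $r_{2n-3}$ be the outer radius of $\mathfrak{B}_{n-1}$. If $r_{\mathrm{min}}>r_{2n-3}$, then there exists $r_{\mathrm{max}}\in(r_{\mathrm{min}},\mathcal{S})$ such that for every given $r_{2n-2}\in[r_{\mathrm{min}},r_{\mathrm{max}})$ there exist a unique $r_{2n-1}>r_{2n-2}$ and a unique single shell $\mathfrak{B}_n=(\rho,p_{\mathrm{rad}},p_{\mathrm{tan}})$ of Seth elastic matter with Lamé coefficients $\lambda,\mu$ and reference parameters $\mathcal{K},\mathcal{S}$, supported in the interval $[r_{2n-2},r_{2n-1}]$, such that $\mathfrak{B}_1+\dots+\mathfrak{B}_n$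 is a static, spherically symmetric, self-gravitating $n$-body matter distribution. Moreover $\rho(r_{2n-2})=0$ if and only if $r_{2n-2}=r_{\mathrm{min}}$, while the outer radius $r_{2n-1}$ of the elastic shell $\mathfrak{B}_n$ satisfies $\rho(r_{2n-1})>0$ and \[ \sqrt{\frac{2\lambda}{3\lambda+2\mu}}\left(\mathcal{S}^3+\frac{3M_n}{4\pi\mathcal{K}}\right)^{1/3}<r_{2n-1}<\left(\mathcal{S}^3+\frac{3M_n}{4\pi\mathcal{K}}\right)^{1/3}, \] where $M_n$ is the mass of $\mathfrak{B}_n$.
   Context: A spherically symmetric, static, self-gravitating $n$-body matter distribution ($n\ge1$) is a triple $(\rho,p_{\mathrm{rad}},p_{\mathrm{tan}})$ of real functions of $r\ge0$, $\rho\ge0$, for which there exist $0\le r_0<r_1<\dots<r_{2n-1}$ such that, with $I_j=(r_{2j-2},r_{2j-1})$: - $\Omega:=\mathrm{Int}\{r>0:\rho(r)>0\}=\bigcup_{j=1}^n I_j$; - $(\rho,p_{\mathrm{rad}},p_{\mathrm{tan}})\in C^1(\Omega)\cap C^0(\overline\Omega)$ (continuity on $\overline\Omega$ of the restrictions to $\overline\Omega$) and in $\Omega$ \[ p_{\mathrm{rad}}'(r)+\frac{2}{r}\big(p_{\mathrm{rad}}(r)-p_{\mathrm{tan}}(r)\big)+\rho(r)\frac{m(r)}{r^2}=0,\qquad m(r)=4\pi\int_0^r\rho(s)s^2\,ds; \] - $p_{\mathrm{rad}},p_{\mathrm{tan}}>0$ in $\Omega$; - $p_{\mathrm{rad}}(r_j)=0$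 for $j=1,\dots,2n-1$; - $p_{\mathrm{rad}}(0)=p_{\mathrm{tan}}(0)$; - $\rho=p_{\mathrm{rad}}=p_{\mathrm{tan}}=0$ on $[0,\infty)\setminus\overline\Omega$; - either $r_0=0$ and $p_{\mathrm{rad}}(r_0)>0$ (non-vacuum core), or $r_0>0$ and $p_{\mathrm{rad}}(r_0)=0$ (vacuum core). The restriction of $(\rho,p_{\mathrm{rad}},p_{\mathrm{tan}})$ to $\overline{I_j}$ is called the $j$-th body and denoted $\mathfrak{B}_j$; one writes $(\rho,p_{\mathrm{rad}},p_{\mathrm{tan}})=\mathfrak{B}_1+\dots+\mathfrak{B}_n$. Its inner and outer radii are $r_{2j-2}$ and $r_{2j-1}$; its local mass is $m_j(r)=4\pi\int_{r_{2j-2}}^r\rho(s)s^2\,ds$, $r\in\overline{I_j}$, and its total mass is $M_j=m_j(r_{2j-1})$. Different bodies may be made of different materials (no constitutive assumption is made on bodies unless stated). A body $\mathfrak{B}_j$ with $r_{2j-2}>0$ (a shell) is made of Seth elastic matter with Lamé coefficients $\lambda,\mu>0$ and reference parameters $\mathcal{K}>0$ (reference density), $\mathcal{S}>0$ (reference inner radius) if for $r\in I_j$ \[ p_{\mathrm{rad}}(r)=\widehat p_{\mathrm{rad}}(\delta(r),\eta(r)),\quad p_{\mathrm{tan}}(r)=\widehat p_{\mathrm{tan}}(\delta(r),\eta(r)),\quad \delta(r)=\frac{\rho(r)}{\mathcal{K}},\quad \eta(r)=\left(\frac{\mathcal{S}}{r}\right)^3+\frac{m_j(r)}{\frac{4\pi}{3}\mathcal{K}r^3},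 \] where \[ \widehat p_{\mathrm{rad}}(\delta,\eta)=\lambda\eta^{2/3}+\frac{\lambda+2\mu}{2}\eta^{-4/3}\delta^2-p_0,\quad \widehat p_{\mathrm{tan}}(\delta,\eta)=(\lambda+\mu)\eta^{2/3}+\frac{\lambda}{2}\eta^{-4/3}\delta^2-p_0,\quad p_0=\frac{3\lambda+2\mu}{2}. \] (Note that the equilibrium equation involves the total enclosed mass $m(r)$, while $\eta$ involves only the local mass $m_j(r)$ of the shell.) *)

(* Defs.v *)
From Stdlib Require Import Reals Arith.
From Coquelicot Require Import Coquelicot.

Open Scope R_scope.

(* The fields are functions of the radius s >= 0; their values at negative
   arguments are irrelevant to every definition below. *)
Record matter : Type := Matter {
  rho : R -> R;
  prad : R -> R;
  ptan : R -> R
}.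

Definition matter_add (T B : matter) : matter :=
  Matter (fun s => rho T s + rho B s)
         (fun s => prad T s + prad B s)
         (fun s => ptan T s + ptan B s).

Definition matter_eq (T B : matter) : Prop :=
  forall s, 0 <= s ->
    rho T s = rho B s /\ prad T s = prad B s /\ ptan T s = ptan B s.

Definition shell_mass (a : R) (T : matter) (s : R) : R :=
  4 * PI * RInt (fun t => rho T t * t ^ 2) a s.

Definition Omega (T : matter) : R -> Prop :=
  interior (fun s => 0 < s /\ 0 < rho T s).

Definition C1_on (D : R -> Prop) (f : R -> R) : Prop :=
  forall s, D s -> ex_derive f s /\ continuous (Derive f) s.

(* The radii are r 0 < r 1 < ... < r (2n-1); other values of r are not used.
   Bodies are numbered from 1, so j >= 1 and the truncated subtraction
   2 * j - 2 is exact. *)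
Record is_nbody (n : nat) (r : nat -> R) (T : matter) : Prop := {
  nb_pos : (1 <= n)%nat;
  nb_r0 : 0 <= r 0%nat;
  nb_incr : forall i, (i + 1 < 2 * n)%nat -> r i < r (i + 1)%nat;
  nb_rho_ge0 : forall s, 0 <= s -> 0 <= rho T s;
  nb_Omega : forall s,
    Omega T s <->
    exists j, (1 <= j <= n)%nat /\
      r (2 * j - 2)%nat < s < r (2 * j - 1)%nat;
  nb_C1 : C1_on (Omega T) (rho T) /\ C1_on (Omega T) (prad T) /\
          C1_on (Omega T) (ptan T);
  (* continuity of the restrictions to the closure *)
  nb_C0 : continuous_on (adherence (Omega T)) (rho T) /\
          continuous_on (adherence (Omega T)) (prad T) /\
          continuous_on (adherence (Omega T)) (ptan T);
  nb_equilibrium : forall s, Omega T s ->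
    Derive (prad T) s + 2 / s * (prad T s - ptan T s)
      + rho T s * (shell_mass 0 T s / s ^ 2) = 0;
  nb_p_gt0 : forall s, Omega T s -> 0 < prad T s /\ 0 < ptan T s;
  nb_boundary : forall i, (1 <= i <= 2 * n - 1)%nat -> prad T (r i) = 0;
  nb_center : prad T 0 = ptan T 0;
  nb_vacuum : forall s, 0 <= s -> ~ adherence (Omega T) s ->
    rho T s = 0 /\ prad T s = 0 /\ ptan T s = 0;
  nb_core : (r 0%nat = 0 /\ 0 < prad T (r 0%nat)) \/
            (0 < r 0%nat /\ prad T (r 0%nat) = 0)
}.

Definition seth_p0 (lambda mu : R) : R := (3 * lambda + 2 * mu) / 2.

Definition seth_prad (lambda mu delta eta : R) : R :=
  lambda * Rpower eta (2 / 3)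
  + (lambda + 2 * mu) / 2 * Rpower eta (- (4 / 3)) * delta ^ 2
  - seth_p0 lambda mu.

Definition seth_ptan (lambda mu delta eta : R) : R :=
  (lambda + mu) * Rpower eta (2 / 3)
  + lambda / 2 * Rpower eta (- (4 / 3)) * delta ^ 2
  - seth_p0 lambda mu.

(* The part of T lying in [a, b] is a shell of Seth matter with reference
   density Kref and reference inner radius Sref; eta involves only the mass
   between a and s, not the total enclosed mass. *)
Definition is_seth_shell (lambda mu Kref Sref a b : R) (T : matter) : Prop :=
  0 < a /\
  forall s, a < s < b ->
    let delta := rho T s / Kref in
    let eta := (Sref / s) ^ 3
               + shell_mass a T s / (4 * PI / 3 * Kref * s ^ 3) in
    prad T s = seth_prad lambda mu delta eta /\
    ptan T s = seth_ptan lambda mu delta eta.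

Definition supported_in (a b : R) (T : matter) : Prop :=
  forall s, 0 <= s -> ~ (a <= s <= b) ->
    rho T s = 0 /\ prad T s = 0 /\ ptan T s = 0.

Definition append_radii (n : nat) (r : nat -> R) (a b : R) : nat -> R :=
  fun i => if Nat.eqb i (2 * n - 2) then a
           else if Nat.eqb i (2 * n - 1) then b
           else r i.

(* A single body is identified with its extension by zero, so that adding it
   to a distribution is pointwise addition. *)
Definition is_outer_seth_shell (n : nat) (lambda mu Kref Sref : R)
    (r : nat -> R) (T : matter) (a b : R) (B : matter) : Prop :=
  a < b /\
  supported_in a b B /\
  is_seth_shell lambda mu Kref Sref a b B /\
  is_nbody n (append_radii n r a b) (matter_add T B).

Definition r_min (lambda mu Sref : R) : R :=
  sqrt (2 * lambda / (3 * lambda + 2 * mu)) * Sref.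

(* Main.v *)
(** For a shell put [y^3 = S^3 + 3 m / (4 pi K)], with [m] the local mass,
    [x = y / s] and [v = y'].  Then [rho = K y^2 v / s^2], and Seth's law becomes
    [prad = lambda x^2 + (lambda + 2 mu) v^2 / 2 - p0], while [ptan] is a positive
    multiple of [prad] plus a positive multiple of [x^2 - 1].  Equilibrium is a
    second order equation for [y], singular where [v = 0].

    Necessity: [prad = 0] at the inner radius [a] gives [lambda (S/a)^2 <= p0],
    that is [r_min <= a], and [ptan >= 0] gives [a <= S]; if [a = S] the elastic
    forces vanish there and the attraction of the inner bodies makes [prad]
    negative.

    Existence: in the time [t] with [ds/dt = v / s] the equation for [(s, x, v)]
    is regular, even from [v = 0] (the case [a = r_min]).  Along its solution [v]
    stays positive and, because of gravity, below [x]; hence [x] decreases, and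
    [prad >= 0] forces [x > 1], so [ptan > 0].  The pressure increases initially
    when [a] is close to [r_min], and it vanishes at a finite radius because
    otherwise gravity would dominate at large [s].

    Uniqueness: for two solutions, [(y1 - y2)^2 + (v1^2 - v2^2)^2] satisfies a
    Gronwall inequality whose singular coefficient [1 / v1] is at most a multiple
    of [v1'] plus a constant, hence integrable. *)

Require Import Defs.
From Stdlib Require Import Reals Ranalysis5 Arith Lra Lia ClassicalEpsilon.
From Coquelicot Require Import Coquelicot.

Open Scope R_scope.

(** * Picard-Lindelof for globally Lipschitz fields *)

(** Geometrically [y] is the radius, in the reference state of density [K] and inner radius [S], of
    the material sphere that sits at radius [s]; hence [eta = x^3] and [delta = x^2 v]. Equilibrium
    reads [(lambda + 2 mu) v v' = s * force], so solving for [v'] brings in [1 / v], which destroys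
    the Lipschitz property exactly at the start [v = 0]. The factor [v] in [ds/dt] cancels it; the
    price is that [s(t)] may start with zero derivative, so that its inverse is only continuous
    there. The fixed point argument needs a globally Lipschitz field, so the field is clamped and a
    priori bounds remove the clamps. These bounds hold while [x >= 1], which suffices: the pressure
    is already negative when [x] reaches 1. The bound [rmax] encodes one inequality, that the
    pressure increases at [a]. In it gravity carries a factor [v], so it holds strictly at [v = 0]
    and persists by continuity. In the uniqueness proof [v1^2 - v2^2] replaces [v1 - v2] because
    [(v^2)'] is regular at [v = 0], and because the damping terms of [force] then have a favourable
    sign. *)

Lemma continuous_of_Rabs (f : R -> R) (x : R) :
  (forall eps, 0 < eps -> exists d, 0 < d /\
     forall y, Rabs (y - x) < d -> Rabs (f y - f x) < eps) ->
  continuous f x.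
Proof.
  intros H. apply filterlim_locally. intros eps.
  destruct (H eps (cond_pos eps)) as [d [Hd Hf]].
  exists (mkposreal d Hd). intros y Hy. apply Hf, Hy.
Qed.

Lemma continuous_Rabs_spec (f : R -> R) (x : R) :
  continuous f x -> forall eps, 0 < eps -> exists d, 0 < d /\
     forall y, Rabs (y - x) < d -> Rabs (f y - f x) < eps.
Proof.
  intros H eps He.
  destruct (proj1 (filterlim_locally f (f x)) H (mkposreal eps He)) as [d Hd].
  exists d. split; [apply cond_pos|]. intros y Hy. apply (Hd y Hy).
Qed.

Lemma continuous_Lipschitz {V W : NormedModule R_AbsRing} (f : V -> W) (L : R) :
  (forall u w, norm (minus (f u) (f w)) <= L * norm (minus u w)) ->
  forall u, continuous f u.
Proof.
  intros Hf u.
  apply (@filterlim_locally_ball_norm R_AbsRing V W _ _). intros eps.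
  pose (L' := Rmax L 1).
  assert (HL' : 0 < L') by (unfold L'; generalize (Rmax_r L 1); lra).
  assert (He : 0 < eps / L') by (apply Rdiv_lt_0_compat; [apply cond_pos|lra]).
  apply (locally_le_locally_norm u).
  exists (mkposreal _ He). intros w Hw. unfold ball_norm in *. simpl in Hw.
  apply Rle_lt_trans with (1 := Hf w u).
  apply Rle_lt_trans with (L' * norm (minus w u)).
  - apply Rmult_le_compat_r; [apply norm_ge_0|apply Rmax_l].
  - replace (pos eps) with (L' * (eps / L')) by (field; lra).
    now apply Rmult_lt_compat_l.
Qed.

Lemma continuous_Rmax_0 (x : R) : continuous (Rmax 0) x.
Proof.
  apply continuous_of_Rabs. intros eps He. exists eps. split; [easy|].
  intros y Hy. unfold Rmax. unfold Rabs in *.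
  repeat destruct Rle_dec; repeat destruct Rcase_abs; lra.
Qed.

Lemma minus_plus_l {G : AbelianGroup} (z u w : G) :
  minus (plus z u) (plus z w) = minus u w.
Proof.
  unfold minus. rewrite opp_plus, (plus_comm z u), <- plus_assoc.
  now rewrite (plus_assoc z (opp z)), plus_opp_r, plus_zero_l.
Qed.

Lemma minus_plus_cancel {G : AbelianGroup} (z u : G) : minus (plus z u) z = u.
Proof.
  transitivity (plus u (plus z (opp z))).
  - unfold minus. now rewrite (plus_comm z u), <- plus_assoc.
  - transitivity (plus u zero); [apply f_equal, plus_opp_r|apply plus_zero_r].
Qed.

Lemma minus_eq_zero_eq {G : AbelianGroup} (u w : G) : minus u w = zero -> u = w.
Proof.
  intros H. transitivity (plus u (plus (opp w) w)).
  - symmetry. transitivity (plus u zero); [apply f_equal, plus_opp_l|apply plus_zero_r].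
  - rewrite plus_assoc. transitivity (plus zero w); [|apply plus_zero_l].
    exact (f_equal (fun z => plus z w) H).
Qed.

Section Picard.

Context {V : CompleteNormedModule R_AbsRing}.
Variables (f : V -> V) (L : R) (y0 : V).
Hypothesis HL : 0 < L.
Hypothesis Hf : forall u w, norm (minus (f u) (f w)) <= L * norm (minus u w).

Let dist (u w : V) := norm (minus u w).

Let dist_triangle (u w z : V) : dist u z <= dist u w + dist w z.
Proof. unfold dist. rewrite (minus_trans w u z). exact (norm_triangle (minus u w) (minus w z)). Qed.

Let dist_sym (u w : V) : dist u w = dist w u.
Proof.
  unfold dist. rewrite <- norm_opp. f_equal. apply opp_minus.
Qed.

Let dist_refl (u : V) : dist u u = 0.
Proof. unfold dist. rewrite minus_eq_zero. exact (@norm_zero R_AbsRing V). Qed.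

Let f_continuous (u : V) : continuous f u.
Proof. exact (@continuous_Lipschitz V V f L Hf u). Qed.

(* The argument of the integrand is clamped so that only times [s >= 0]
   matter, while all functions stay continuous on the whole line. *)
Fixpoint picard (k : nat) : R -> V :=
  match k with
  | O => fun _ => y0
  | S k => fun t => plus y0 (RInt (fun s => f (picard k (Rmax 0 s))) 0 t)
  end.

Let is_derive_picard_step (h : R -> V) :
  (forall s, continuous h s) ->
  forall t, is_derive (fun t => plus y0 (RInt h 0 t)) t (h t).
Proof.
  intros Hh t.
  rewrite <- (plus_zero_l (h t)).
  apply @is_derive_plus; [apply @is_derive_const|].
  apply is_derive_RInt with 0; [|apply Hh].
  apply filter_forall. intros s.
  apply @RInt_correct, @ex_RInt_continuous. intros; apply Hh.
Qed.

Lemma picard_continuous (k : nat) (t : R) : continuous (picard k) t.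
Proof.
  revert t. induction k as [|k IH]; intros t; simpl.
  - apply continuous_const.
  - apply (@ex_derive_continuous R_AbsRing V).
    eexists. apply is_derive_picard_step. intros s.
    apply (continuous_comp (fun s => picard k (Rmax 0 s)) f); [|apply f_continuous].
    apply (continuous_comp (Rmax 0) (picard k)); [apply continuous_Rmax_0|apply IH].
Qed.

Let integrand_continuous (k : nat) (s : R) :
  continuous (fun s => f (picard k (Rmax 0 s))) s.
Proof.
  apply (continuous_comp (fun s => picard k (Rmax 0 s)) f); [|apply f_continuous].
  apply (continuous_comp (Rmax 0) (picard k));
    [apply continuous_Rmax_0|apply picard_continuous].
Qed.

(** The first iterate moves by at most [t * norm (f y0)], and [u <= exp u] at [u = 2 L t] bounds
    this by [C exp (2 L t)]. *)
Let C : R := norm (f y0) / (2 * L).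

Let C_ge0 : 0 <= C.
Proof.
  unfold C. apply Rmult_le_pos; [apply norm_ge_0|].
  apply Rlt_le, Rinv_0_lt_compat. lra.
Qed.

(* Comparison with [c exp (2 L t)]: each integration gains a factor 1/2. *)
Let integral_contraction (h1 h2 : R -> V) (c t : R) :
  (forall s, continuous h1 s) -> (forall s, continuous h2 s) ->
  0 <= t -> 0 <= c ->
  (forall s, 0 <= s -> norm (minus (h1 s) (h2 s)) <= L * (c * exp (2 * L * s))) ->
  dist (plus y0 (RInt h1 0 t)) (plus y0 (RInt h2 0 t)) <= c / 2 * exp (2 * L * t).
Proof.
  intros H1 H2 Ht Hc Hh. unfold dist.
  assert (E1 : ex_RInt h1 0 t) by (apply @ex_RInt_continuous; intros; apply H1).
  assert (E2 : ex_RInt h2 0 t) by (apply @ex_RInt_continuous; intros; apply H2).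
  replace (minus (plus y0 (RInt h1 0 t)) (plus y0 (RInt h2 0 t)))
    with (minus (RInt h1 0 t) (RInt h2 0 t)).
  2:{ symmetry. exact (minus_plus_l y0 (RInt h1 0 t) (RInt h2 0 t)). }
  apply Rle_trans with (c / 2 * exp (2 * L * t) - c / 2 * exp (2 * L * 0)).
  - apply (norm_RInt_le (fun s => minus (h1 s) (h2 s))
             (fun s => L * (c * exp (2 * L * s))) 0 t); [easy| | |].
    + intros s Hs. apply Hh. lra.
    + apply @is_RInt_minus; now apply RInt_correct.
    + apply (is_RInt_derive (fun s => c / 2 * exp (2 * L * s))).
      * intros s _. auto_derive; [easy|field].
      * intros s _. apply (@ex_derive_continuous R_AbsRing R_NormedModule).
        auto_derive. easy.
  - generalize (exp_pos (2 * L * 0)). nra.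
Qed.

Let picard_step (k : nat) (t : R) : 0 <= t ->
  dist (picard (S k) t) (picard k t) <= C * (1 / 2) ^ k * exp (2 * L * t).
Proof.
  revert t. induction k as [|k IH]; intros t Ht.
  - simpl. unfold dist.
    replace (minus (plus y0 (RInt (fun _ => f y0) 0 t)) y0) with (RInt (fun _ => f y0) 0 t)
      by (symmetry; exact (minus_plus_cancel y0 (RInt (fun _ => f y0) 0 t))).
    apply Rle_trans with (norm (f y0) * t - norm (f y0) * 0).
    + apply (norm_RInt_le (fun _ => f y0) (fun _ => norm (f y0)) 0 t); [easy| | |].
      * intros; apply Rle_refl.
      * apply @RInt_correct, @ex_RInt_continuous. intros. apply continuous_const.
      * apply (is_RInt_derive (fun s => norm (f y0) * s)).
        -- intros s _. auto_derive; [easy|ring].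
        -- intros s _. apply continuous_const.
    + rewrite Rmult_1_r, Rmult_0_r, Rminus_0_r. unfold C.
      assert (H : 2 * L * t <= exp (2 * L * t)).
      { generalize (exp_ineq1_le (2 * L * t)). lra. }
      replace (norm (f y0) * t) with (norm (f y0) / (2 * L) * (2 * L * t)) by (field; lra).
      apply Rmult_le_compat_l; [apply C_ge0|easy].
  - change (picard (S (S k)) t) with
      (plus y0 (RInt (fun s => f (picard (S k) (Rmax 0 s))) 0 t)).
    change (picard (S k) t) with
      (plus y0 (RInt (fun s => f (picard k (Rmax 0 s))) 0 t)) at 1.
    replace (C * (1 / 2) ^ S k) with (C * (1 / 2) ^ k / 2) by (simpl; field).
    apply integral_contraction; try easy; try (apply integrand_continuous).
    + apply Rmult_le_pos; [apply C_ge0|apply pow_le; lra].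
    + intros s Hs. rewrite (Rmax_right 0 s Hs).
      eapply Rle_trans; [apply Hf|].
      apply Rmult_le_compat_l; [lra|]. apply IH, Hs.
Qed.

Let picard_steps (k j : nat) (t : R) : 0 <= t ->
  dist (picard (j + k) t) (picard k t) <= 2 * C * (1 / 2) ^ k * exp (2 * L * t).
Proof.
  intros Ht.
  (* The factor [1 - (1 / 2)^j] is the partial geometric sum, which makes the induction on [j]
     close. *)
  assert (H : dist (picard (j + k) t) (picard k t)
     <= (1 - (1 / 2) ^ j) * (2 * C * (1 / 2) ^ k * exp (2 * L * t))).
  { induction j as [|j IH].
    - simpl. rewrite dist_refl. lra.
    - eapply Rle_trans; [apply (dist_triangle _ (picard (j + k) t))|].
      generalize (picard_step (j + k) t Ht). simpl (S j + k)%nat.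
      rewrite pow_add. simpl pow. intros Hs. nra. }
  eapply Rle_trans; [apply H|].
  assert (0 <= (1/2) ^ j) by (apply pow_le; lra).
  assert (0 <= 2 * C * (1 / 2) ^ k * exp (2 * L * t)).
  { apply Rmult_le_pos; [|apply Rlt_le, exp_pos].
    apply Rmult_le_pos; [generalize C_ge0; lra|apply pow_le; lra]. }
  nra.
Qed.

Let half_pow_small (c eps : R) : 0 <= c -> 0 < eps ->
  exists k, c * (1 / 2) ^ k < eps.
Proof.
  intros Hc He.
  destruct (pow_lt_1_zero (1 / 2)) with (y := eps / (c + 1)) as [k Hk].
  - rewrite Rabs_pos_eq; lra.
  - apply Rdiv_lt_0_compat; lra.
  - exists k. specialize (Hk k (le_n k)).
    assert (0 <= (1 / 2) ^ k) by (apply pow_le; lra).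
    rewrite Rabs_pos_eq in Hk by easy.
    apply Rmult_lt_compat_l with (r := c + 1) in Hk; [|lra].
    replace ((c + 1) * (eps / (c + 1))) with eps in Hk by (field; lra). nra.
Qed.

Let picard_limit (t : R) : 0 <= t ->
  exists z, forall k, dist z (picard k t) <= 2 * C * (1 / 2) ^ k * exp (2 * L * t).
Proof.
  intros Ht.
  set (E := exp (2 * L * t)).
  assert (HE : 0 < E) by apply exp_pos.
  destruct (proj1 (filterlim_locally_cauchy (U := V) (F := eventually) (fun k => picard k t)))
    as [z Hz].
  - intros eps.
    destruct (half_pow_small (4 * C * E) eps) as [k Hk].
    { generalize C_ge0. nra. } { apply cond_pos. }
    exists (fun i => (k <= i)%nat). split; [now exists k|].
    intros u w Hu Hw. apply (@norm_compat1 R_AbsRing V).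
    change (dist (picard w t) (picard u t) < eps).
    eapply Rle_lt_trans; [apply (dist_triangle _ (picard k t))|].
    rewrite (dist_sym (picard k t)).
    generalize (picard_steps k (w - k) t Ht) (picard_steps k (u - k) t Ht).
    replace (w - k + k)%nat with w by lia. replace (u - k + k)%nat with u by lia.
    fold E. lra.
  - exists z. intros k. apply le_epsilon. intros eps He.
    destruct (proj1 (@filterlim_locally_ball_norm R_AbsRing nat V eventually _
      (fun k => picard k t) z) Hz (mkposreal eps He)) as [N HN].
    specialize (HN (N + k)%nat ltac:(lia)). unfold ball_norm in HN. simpl in HN.
    eapply Rle_trans; [apply (dist_triangle _ (picard (N + k) t))|].
    change (dist (picard (N + k) t) z < eps) in HN.
    rewrite dist_sym. generalize (picard_steps k N t Ht). fold E. lra.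
Qed.

(** The clamped time gives a two-sided derivative even at [t = 0]: for negative times the solution
    continues with the constant velocity [f y0]. *)
Theorem picard_lindelof :
  exists Y : R -> V, Y 0 = y0 /\ forall t, is_derive Y t (f (Y (Rmax 0 t))).
Proof.
  assert (Hz : exists Z : R -> V, forall t, 0 <= t ->
    forall k, dist (Z t) (picard k t) <= 2 * C * (1 / 2) ^ k * exp (2 * L * t)).
  { exists (fun t => match Rle_dec 0 t with
      | left H => proj1_sig (constructive_indefinite_description _ (picard_limit t H))
      | right _ => y0 end).
    intros t Ht. destruct (Rle_dec 0 t) as [H|H]; [|lra].
    apply (proj2_sig (constructive_indefinite_description _ (picard_limit t H))). }
  destruct Hz as [Z HZ].
  (* The iterates converge uniformly on bounded time intervals, here up to [Rmax 0 t + 1], so the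
     limit inherits their continuity. *)
  assert (CZ : forall t, continuous (fun s => Z (Rmax 0 s)) t).
  { intros t. apply (@filterlim_locally_ball_norm R_AbsRing R V _ _). intros eps.
    assert (HE := exp_pos (2 * L * (Rmax 0 t + 1))).
    destruct (half_pow_small (4 * C * exp (2 * L * (Rmax 0 t + 1))) (eps / 2)) as [k Hk].
    { generalize C_ge0. nra. } { apply is_pos_div_2. }
    assert (Hc : continuous (fun s => picard k (Rmax 0 s)) t).
    { apply (continuous_comp (Rmax 0) (picard k));
        [apply continuous_Rmax_0|apply picard_continuous]. }
    apply (@filterlim_locally_ball_norm R_AbsRing R V _ _) with (eps := pos_div_2 eps) in Hc.
    assert (H1 : locally t (fun s => Rabs (s - t) < 1)).
    { exists (mkposreal 1 Rlt_0_1). intros s Hs. apply Hs. }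
    generalize (filter_and _ _ Hc H1). apply filter_imp. intros s [Hs Hst].
    change (dist (picard k (Rmax 0 s)) (picard k (Rmax 0 t)) < eps / 2) in Hs.
    assert (Hm : Rmax 0 s <= Rmax 0 t + 1).
    { unfold Rmax, Rabs in *. repeat destruct Rle_dec; destruct Rcase_abs; lra. }
    assert (Hb : forall u, 0 <= u -> u <= Rmax 0 t + 1 -> dist (Z u) (picard k u) < eps / 4).
    { intros u Hu0 Hu. eapply Rle_lt_trans; [apply (HZ u Hu0 k)|].
      apply Rle_lt_trans with (2 * C * (1 / 2) ^ k * exp (2 * L * (Rmax 0 t + 1))).
      - apply Rmult_le_compat_l.
        + apply Rmult_le_pos; [generalize C_ge0; lra|apply pow_le; lra].
        + destruct (Req_dec u (Rmax 0 t + 1)) as [->|Hn]; [apply Rle_refl|].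
          apply Rlt_le, exp_increasing. nra.
      - lra. }
    change (dist (Z (Rmax 0 s)) (Z (Rmax 0 t)) < eps).
    eapply Rle_lt_trans; [apply (dist_triangle _ (picard k (Rmax 0 s)))|].
    eapply Rle_lt_trans; [apply Rplus_le_compat_l, (dist_triangle _ (picard k (Rmax 0 t)))|].
    rewrite (dist_sym (picard k (Rmax 0 t)) (Z _)).
    generalize (Hb (Rmax 0 s) (Rmax_l _ _) Hm) (Hb (Rmax 0 t) (Rmax_l _ _) ltac:(lra)).
    lra. }
  assert (CfZ : forall t, continuous (fun s => f (Z (Rmax 0 s))) t).
  { intros t. apply (continuous_comp (fun s => Z (Rmax 0 s)) f); [apply CZ|apply f_continuous]. }
  exists (fun t => plus y0 (RInt (fun s => f (Z (Rmax 0 s))) 0 t)).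
  split; [now rewrite RInt_point, plus_zero_r|].
  intros t.
  (* The limit solves the integral equation: both sides are close to iterate [S k], the left one by
     contraction, for every [k]. *)
  assert (HY : forall t, 0 <= t -> plus y0 (RInt (fun s => f (Z (Rmax 0 s))) 0 t) = Z t).
  { clear t. intros t Ht. set (y := plus y0 _).
    assert (H0 : dist y (Z t) = 0).
    { apply Rle_antisym; [|apply norm_ge_0].
      apply le_epsilon. intros eps He.
      destruct (half_pow_small (2 * C * exp (2 * L * t)) eps) as [k Hk]; [|easy|].
      { generalize C_ge0 (exp_pos (2 * L * t)). nra. }
      eapply Rle_trans; [apply (dist_triangle _ (picard (S k) t))|].
      rewrite (dist_sym _ (Z t)).
      assert (H1 := HZ t Ht (S k)).
      assert (H2 : dist y (picard (S k) t) <= 2 * C * (1 / 2) ^ k / 2 * exp (2 * L * t)).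
      { unfold y. simpl picard. apply integral_contraction; try easy.
        - apply Rmult_le_pos; [generalize C_ge0; lra|apply pow_le; lra].
        - intros s Hs. eapply Rle_trans; [apply Hf|].
          apply Rmult_le_compat_l; [lra|]. rewrite Rmax_right by easy. apply (HZ s Hs k). }
      simpl pow in H1. lra. }
    apply norm_eq_zero in H0.
    now apply (minus_eq_zero_eq y (Z t)). }
  rewrite (HY (Rmax 0 t) (Rmax_l _ _)).
  apply (is_derive_picard_step (fun s => f (Z (Rmax 0 s)))). exact CfZ.
Qed.

End Picard.

(** * Sign arguments for real functions: mean value, barriers, first zeros *)

Lemma is_derive_sign (h : R -> R) (t l : R) :
  is_derive h t l -> 0 < l ->
  exists d, 0 < d /\ forall s, s <> t -> Rabs (s - t) < d -> 0 < (h s - h t) * (s - t).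
Proof.
  intros Hd Hl. apply is_derive_Reals in Hd.
  destruct (Hd (l / 2) ltac:(lra)) as [d Hh].
  exists d. split; [apply cond_pos|]. intros s Hn Hs.
  specialize (Hh (s - t) ltac:(lra) Hs).
  replace (t + (s - t)) with s in Hh by ring.
  apply Rabs_def2 in Hh.
  assert (Hq : 0 < (h s - h t) / (s - t)) by lra.
  replace ((h s - h t) * (s - t)) with ((h s - h t) / (s - t) * (s - t) ^ 2) by (field; lra).
  apply Rmult_lt_0_compat; [easy|]. apply pow2_gt_0. lra.
Qed.

Lemma is_derive_continuity_pt (h : R -> R) (t l : R) : is_derive h t l -> continuity_pt h t.
Proof.
  intros H. apply continuity_pt_filterlim.
  apply (@ex_derive_continuous R_AbsRing R_NormedModule). now exists l.
Qed.

Lemma MVT_open (f df : R -> R) (a b : R) : a < b ->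
  (forall x, a < x < b -> is_derive f x (df x)) ->
  (forall x, a <= x <= b -> continuity_pt f x) ->
  exists c, a < c < b /\ f b - f a = df c * (b - a).
Proof.
  intros Hab Hd Hc.
  (* Outside the open interval [g] takes a value violating the mean value equation, which forces the
     point found to be interior. *)
  pose (g := fun x => if Rlt_dec a x then if Rlt_dec x b then df x
                      else (f b - f a) / (b - a) + 1 else (f b - f a) / (b - a) + 1).
  destruct (MVT_gen f a b g) as [c [Hc1 Hc2]];
    rewrite ?Rmin_left, ?Rmax_right in * by lra.
  - intros x Hx. unfold g. destruct Rlt_dec; [|lra]. destruct Rlt_dec; [|lra].
    now apply Hd.
  - easy.
  - exists c. unfold g in Hc2.
    assert (~ f b - f a = ((f b - f a) / (b - a) + 1) * (b - a)).
    { replace (((f b - f a) / (b - a) + 1) * (b - a)) with (f b - f a + (b - a))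
        by (field; lra). lra. }
    destruct (Rlt_dec a c); [|easy]. destruct (Rlt_dec c b); [|easy]. easy.
Qed.

(** At a minimum with value [<= 0] and positive time the derivative would be positive, so [h] would
    be smaller just before. A minimum at time 0 makes [t1] a minimum as well, since
    [h t1 <= 0 <= h 0]. The initial inequality is weak so that [v] may start at 0. *)
Lemma barrier (h dh : R -> R) (T : R) :
  (forall t, 0 <= t <= T -> is_derive h t (dh t)) -> 0 <= h 0 ->
  (forall t, 0 <= t <= T -> h t <= 0 -> 0 < dh t) ->
  forall t, 0 < t <= T -> 0 < h t.
Proof.
  intros Hd H0 Hdh t1 Ht1.
  destruct (Rlt_le_dec 0 (h t1)) as [|Hle]; [easy|exfalso].
  assert (Hmin : forall tm, 0 < tm <= t1 -> ~ (forall c, 0 <= c <= t1 -> h tm <= h c)).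
  { intros tm Htm Hm.
    assert (Hneg : h tm <= 0) by (generalize (Hm t1); lra).
    destruct (is_derive_sign h tm (dh tm)) as [d [Hd1 Hd2]].
    { apply Hd. lra. } { apply Hdh; lra. }
    pose (s := tm - Rmin (d / 2) tm).
    assert (Hs : 0 < Rmin (d / 2) tm) by (apply Rmin_glb_lt; lra).
    generalize (Rmin_l (d / 2) tm) (Rmin_r (d / 2) tm). intros Hs1 Hs2.
    assert (Hd3 : 0 < (h s - h tm) * (s - tm)).
    { apply Hd2; unfold s; [lra|]. rewrite Rabs_left; lra. }
    specialize (Hm s ltac:(unfold s; lra)). unfold s in *. nra. }
  destruct (continuity_ab_min h 0 t1) as [tm [Hm Htm]]; [lra| |].
  { intros c Hc. apply is_derive_continuity_pt with (dh c). apply Hd. lra. }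
  destruct (Req_dec tm 0) as [->|Hn].
  - apply (Hmin t1); [lra|]. intros c Hc. generalize (Hm c Hc) (Hm t1). lra.
  - apply (Hmin tm); [lra|easy].
Qed.

Lemma continuity_pt_Rabs (f : R -> R) (x : R) :
  continuity_pt f x -> forall eps, 0 < eps -> exists d, 0 < d /\
     forall y, Rabs (y - x) < d -> Rabs (f y - f x) < eps.
Proof. intros H. apply continuous_Rabs_spec. now apply continuity_pt_filterlim. Qed.

Lemma first_zero (f : R -> R) (p T : R) :
  p < T -> (forall t, p <= t <= T -> continuity_pt f t) -> 0 < f p -> f T <= 0 ->
  exists b, p < b <= T /\ f b = 0 /\ forall t, p <= t < b -> 0 < f t.
Proof.
  intros HpT Hc Hp HT.
  pose (E := fun t => p <= t <= T /\ forall s, p <= s <= t -> 0 < f s).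
  destruct (completeness E) as [b [Hb1 Hb2]].
  { exists T. intros t [Ht _]. lra. }
  { exists p. split; [lra|]. intros s Hs. replace s with p by lra. easy. }
  assert (Hpb : p <= b).
  { apply Hb1. split; [lra|]. intros s Hs. replace s with p by lra. easy. }
  assert (HbT : b <= T) by (apply Hb2; intros t [Ht _]; lra).
  assert (Hpos : forall t, p <= t < b -> 0 < f t).
  { intros t Ht. destruct (Rlt_le_dec 0 (f t)) as [|Hle]; [easy|exfalso].
    apply (Rlt_not_le b t); [lra|]. apply Hb2. intros u [Hu1 Hu2].
    destruct (Rle_dec u t) as [|Hn]; [easy|]. generalize (Hu2 t). lra. }
  destruct (Rtotal_order (f b) 0) as [Hneg|[Hz|Hpos']].
  - exfalso.
    destruct (continuity_pt_Rabs f b (Hc b ltac:(lra)) (- f b) ltac:(lra)) as [d [Hd Hfd]].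
    destruct (Req_dec b p) as [->|Hn]; [lra|].
    pose (s := b - Rmin (d / 2) (b - p)).
    assert (Hs : 0 < Rmin (d / 2) (b - p)) by (apply Rmin_glb_lt; lra).
    generalize (Rmin_l (d / 2) (b - p)) (Rmin_r (d / 2) (b - p)). intros Hs1 Hs2.
    specialize (Hfd s ltac:(unfold s; rewrite Rabs_left; lra)).
    specialize (Hpos s ltac:(unfold s; lra)). apply Rabs_def2 in Hfd. lra.
  - exists b. split; [|easy]. split; [|easy].
    destruct Hpb as [|<-]; [easy|lra].
  - exfalso.
    destruct (continuity_pt_Rabs f b (Hc b ltac:(lra)) (f b) ltac:(lra)) as [d [Hd Hfd]].
    destruct (Req_dec b T) as [->|Hn]; [lra|].
    pose (s := b + Rmin (d / 2) (T - b)).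
    assert (Hs : 0 < Rmin (d / 2) (T - b)) by (apply Rmin_glb_lt; lra).
    generalize (Rmin_l (d / 2) (T - b)) (Rmin_r (d / 2) (T - b)). intros Hs1 Hs2.
    apply (Rlt_not_le s b); [unfold s; lra|]. apply Hb1.
    split; [unfold s; lra|]. intros u Hu.
    destruct (Rlt_le_dec u b) as [Hub|Hub]; [apply Hpos; lra|].
    specialize (Hfd u ltac:(unfold s in *; rewrite Rabs_pos_eq; lra)).
    apply Rabs_def2 in Hfd. lra.
Qed.

(** * Bounded Lipschitz functions and the state space of triples *)

(** Boundedness is carried along because it makes products of Lipschitz functions Lipschitz again;
    the field of the flow is built from sums and products. *)
Definition bounded_Lipschitz {V : NormedModule R_AbsRing} (h : V -> R) : Prop :=
  exists B L, 0 <= L /\ (forall u, Rabs (h u) <= B) /\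
    forall u w, Rabs (h u - h w) <= L * norm (minus u w).

Section BoundedLipschitz.

Context {V : NormedModule R_AbsRing}.
Implicit Types h g : V -> R.

Lemma bounded_Lipschitz_const (c : R) : bounded_Lipschitz (fun _ : V => c).
Proof.
  exists (Rabs c), 0. split; [lra|]. split; [intros; apply Rle_refl|].
  intros u w. rewrite Rminus_diag, Rabs_R0. lra.
Qed.

Lemma bounded_Lipschitz_plus h g :
  bounded_Lipschitz h -> bounded_Lipschitz g -> bounded_Lipschitz (fun u => h u + g u).
Proof.
  intros [B [L [HL [H1 H2]]]] [B' [L' [HL' [H1' H2']]]].
  exists (B + B'), (L + L'). split; [lra|]. split.
  - intros u. eapply Rle_trans; [apply Rabs_triang|]. apply Rplus_le_compat; easy.
  - intros u w. replace (h u + g u - (h w + g w)) with (h u - h w + (g u - g w)) by ring.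
    eapply Rle_trans; [apply Rabs_triang|]. generalize (H2 u w) (H2' u w). lra.
Qed.

Lemma bounded_Lipschitz_mult h g :
  bounded_Lipschitz h -> bounded_Lipschitz g -> bounded_Lipschitz (fun u => h u * g u).
Proof.
  intros [B [L [HL [H1 H2]]]] [B' [L' [HL' [H1' H2']]]].
  assert (HB : 0 <= B) by (eapply Rle_trans; [apply Rabs_pos|apply (H1 zero)]).
  assert (HB' : 0 <= B') by (eapply Rle_trans; [apply Rabs_pos|apply (H1' zero)]).
  exists (B * B'), (B * L' + B' * L). split; [nra|]. split.
  - intros u. rewrite Rabs_mult. apply Rmult_le_compat; try apply Rabs_pos; easy.
  - intros u w.
    replace (h u * g u - h w * g w) with (h u * (g u - g w) + g w * (h u - h w)) by ring.
    eapply Rle_trans; [apply Rabs_triang|]. rewrite !Rabs_mult, Rmult_plus_distr_r.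
    rewrite !Rmult_assoc.
    apply Rplus_le_compat; apply Rmult_le_compat; try apply Rabs_pos; easy.
Qed.

Lemma bounded_Lipschitz_minus h g :
  bounded_Lipschitz h -> bounded_Lipschitz g -> bounded_Lipschitz (fun u => h u - g u).
Proof.
  intros [B [L [HL [H1 H2]]]] [B' [L' [HL' [H1' H2']]]].
  exists (B + B'), (L + L'). split; [lra|]. split.
  - intros u. eapply Rle_trans; [apply Rabs_triang|]. rewrite Rabs_Ropp.
    apply Rplus_le_compat; easy.
  - intros u w. replace (h u - g u - (h w - g w)) with (h u - h w + - (g u - g w)) by ring.
    eapply Rle_trans; [apply Rabs_triang|]. rewrite Rabs_Ropp.
    generalize (H2 u w) (H2' u w). lra.
Qed.

Lemma bounded_Lipschitz_pow h (n : nat) :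
  bounded_Lipschitz h -> bounded_Lipschitz (fun u => h u ^ n).
Proof.
  intros H. induction n as [|n IH]; simpl.
  - apply bounded_Lipschitz_const.
  - now apply bounded_Lipschitz_mult.
Qed.

Lemma bounded_Lipschitz_Rmax0 h :
  bounded_Lipschitz h -> bounded_Lipschitz (fun u => Rmax 0 (h u)).
Proof.
  intros [B [L [HL [H1 H2]]]]. exists B, L. split; [easy|]. split.
  - intros u. generalize (H1 u) (Rabs_pos (h u)). unfold Rmax.
    destruct Rle_dec; [easy|]. rewrite Rabs_R0. lra.
  - intros u w. eapply Rle_trans; [|apply (H2 u w)].
    unfold Rmax, Rabs. repeat destruct Rle_dec; repeat destruct Rcase_abs; lra.
Qed.

Lemma bounded_Lipschitz_clamp h (lo hi : R) : lo <= hi ->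
  (forall u w, Rabs (h u - h w) <= norm (minus u w)) ->
  bounded_Lipschitz (fun u => Rmax lo (Rmin hi (h u))).
Proof.
  intros Hlh Hh. exists (Rabs lo + Rabs hi), 1. split; [lra|]. split.
  - intros u. unfold Rmax, Rmin, Rabs.
    repeat destruct Rle_dec; repeat destruct Rcase_abs; lra.
  - intros u w. rewrite Rmult_1_l. eapply Rle_trans; [|apply (Hh u w)].
    unfold Rmax, Rmin, Rabs. repeat destruct Rle_dec; repeat destruct Rcase_abs; lra.
Qed.

Lemma bounded_Lipschitz_inv_Rmax h (a : R) : 0 < a ->
  (forall u w, Rabs (h u - h w) <= norm (minus u w)) ->
  bounded_Lipschitz (fun u => / Rmax a (h u)).
Proof.
  intros Ha Hh.
  assert (Hb : forall x, 0 < / Rmax a x <= / a).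
  { intros x. generalize (Rmax_l a x). intros Hx. split.
    - apply Rinv_0_lt_compat. lra.
    - apply Rinv_le_contravar; lra. }
  exists (/ a), (/ a * / a).
  assert (Hi : 0 < / a) by now apply Rinv_0_lt_compat.
  split; [nra|]. split.
  - intros u. generalize (Hb (h u)). intros Hu. rewrite Rabs_pos_eq; lra.
  - intros u w.
    generalize (Rmax_l a (h u)) (Rmax_l a (h w)). intros Hu Hw.
    replace (/ Rmax a (h u) - / Rmax a (h w))
      with (/ Rmax a (h u) * / Rmax a (h w) * (Rmax a (h w) - Rmax a (h u))) by (field; lra).
    rewrite Rabs_mult.
    apply Rmult_le_compat; try apply Rabs_pos.
    + generalize (Hb (h u)) (Hb (h w)). intros. rewrite Rabs_pos_eq by nra.
      apply Rmult_le_compat; lra.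
    + eapply Rle_trans; [|apply (Hh u w)]. unfold Rmax, Rabs.
      repeat destruct Rle_dec; repeat destruct Rcase_abs; lra.
Qed.

End BoundedLipschitz.

Section ProdComplete.

Variables (K : AbsRing) (U W : CompleteNormedModule K).

Let prod_lim (F : (U * W -> Prop) -> Prop) : U * W :=
  (lim (filtermap fst F), lim (filtermap snd F)).

Lemma prod_complete (F : (prod_UniformSpace U W -> Prop) -> Prop) :
  ProperFilter F -> cauchy F -> forall eps : posreal, F (ball (prod_lim F) eps).
Proof.
  intros FF HF eps.
  assert (H1 : F (fun u => ball (lim (filtermap fst F)) eps (fst u))).
  { apply (complete_cauchy (filtermap (@fst U W) F)); [now apply filtermap_proper_filter|].
    intros e. destruct (HF e) as [x Hx]. exists (fst x).
    unfold filtermap. refine (@filter_imp _ F _ _ _ _ Hx). intros u Hu. apply Hu. }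
  assert (H2 : F (fun u => ball (lim (filtermap snd F)) eps (snd u))).
  { apply (complete_cauchy (filtermap (@snd U W) F)); [now apply filtermap_proper_filter|].
    intros e. destruct (HF e) as [x Hx]. exists (snd x).
    unfold filtermap. refine (@filter_imp _ F _ _ _ _ Hx). intros u Hu. apply Hu. }
  generalize (filter_and _ _ H1 H2). apply filter_imp. intros u Hu. exact Hu.
Qed.

Lemma prod_close_lim (F G : (prod_UniformSpace U W -> Prop) -> Prop) :
  filter_le F G -> filter_le G F -> close (prod_lim F) (prod_lim G).
Proof.
  intros H1 H2 eps. split.
  - apply (close_lim (filtermap fst F) (filtermap fst G)); intros P; [apply H1|apply H2].
  - apply (close_lim (filtermap snd F) (filtermap snd G)); intros P; [apply H1|apply H2].
Qed.

(** Limits are taken componentwise. This lets [picard_lindelof] treat the system for [(s, x, v)] as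
    a single equation. *)
Definition prod_CompleteNormedModule : CompleteNormedModule K :=
  CompleteNormedModule.Pack K (U * W)
    (CompleteNormedModule.Class K (U * W)
      (NormedModule.class K (prod_NormedModule K U W))
      (CompleteSpace.Mixin (prod_UniformSpace U W) prod_lim prod_complete prod_close_lim))
    (U * W).

End ProdComplete.

Definition R3 : CompleteNormedModule R_AbsRing :=
  prod_CompleteNormedModule R_AbsRing
    (prod_CompleteNormedModule R_AbsRing R_CompleteNormedModule R_CompleteNormedModule)
    R_CompleteNormedModule.

(** Each of the two nested products costs a factor [sqrt 2], estimated by 2. *)
Lemma norm_R3_le (u : R3) :
  norm u <= 2 * (Rabs (fst (fst u)) + Rabs (snd (fst u)) + Rabs (snd u)) * 2.
Proof.
  destruct u as [[x y] z]. simpl.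
  assert (Hs : sqrt 2 <= 2).
  { rewrite <- (sqrt_pow2 2) at 2 by lra. apply sqrt_le_1_alt. lra. }
  assert (Hs0 : 0 <= sqrt 2) by apply sqrt_pos.
  assert (H1 := proj2 (@norm_prod R_AbsRing _ R_NormedModule
     ((x, y) : prod_NormedModule R_AbsRing R_NormedModule R_NormedModule) z)).
  assert (H2 := proj2 (@norm_prod R_AbsRing R_NormedModule R_NormedModule x y)).
  assert (P1 := Rabs_pos x). assert (P2 := Rabs_pos y). assert (P3 := Rabs_pos z).
  assert (H3 : @norm R_AbsRing (prod_NormedModule R_AbsRing R_NormedModule R_NormedModule) (x, y)
    <= 2 * (Rabs x + Rabs y)).
  { eapply Rle_trans; [apply H2|].
    apply Rmult_le_compat; [easy| |easy|].
    - eapply Rle_trans; [apply P1|apply Rmax_l].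
    - apply Rmax_lub; [change (Rabs x <= Rabs x + Rabs y)|change (Rabs y <= Rabs x + Rabs y)]; lra. }
  eapply Rle_trans; [apply H1|].
  eapply Rle_trans.
  - apply Rmult_le_compat_r; [|apply Hs].
    eapply Rle_trans; [apply P3|apply Rmax_r].
  - rewrite Rmult_assoc, (Rmult_comm _ 2). apply Rmult_le_compat_l; [lra|].
    apply Rmax_lub; [lra|]. change (Rabs z <= 2 * (Rabs x + Rabs y + Rabs z)). lra.
Qed.

Lemma R3_proj_Lipschitz (u w : R3) :
  Rabs (fst (fst u) - fst (fst w)) <= norm (minus u w) /\
  Rabs (snd (fst u) - snd (fst w)) <= norm (minus u w) /\
  Rabs (snd u - snd w) <= norm (minus u w).
Proof.
  destruct u as [[x y] z], w as [[x' y'] z'].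
  assert (H1 := proj1 (@norm_prod R_AbsRing _ R_NormedModule
     ((minus x x', minus y y') : prod_NormedModule R_AbsRing R_NormedModule R_NormedModule)
     (minus z z'))).
  assert (H2 := proj1 (@norm_prod R_AbsRing R_NormedModule R_NormedModule
     (minus x x') (minus y y'))).
  change (norm (minus ((x, y, z) : R3) (x', y', z'))) with
    (@norm R_AbsRing R3 (minus x x', minus y y', minus z z')). simpl fst. simpl snd.
  assert (H3 := Rle_trans _ _ _ (Rmax_l _ _) H1).
  assert (H4 := Rle_trans _ _ _ (Rmax_r _ _) H1).
  assert (H5 := Rle_trans _ _ _ (Rmax_l _ _) H2).
  assert (H6 := Rle_trans _ _ _ (Rmax_r _ _) H2).
  split; [|split].
  - exact (Rle_trans _ _ _ H5 H3).
  - exact (Rle_trans _ _ _ H6 H3).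
  - exact H4.
Qed.

Lemma bounded_Lipschitz_flow (F1 F2 F3 : R3 -> R) (s0 x0 v0 : R) :
  bounded_Lipschitz F1 -> bounded_Lipschitz F2 -> bounded_Lipschitz F3 ->
  exists s x v : R -> R, s 0 = s0 /\ x 0 = x0 /\ v 0 = v0 /\
    forall t, 0 <= t ->
      is_derive s t (F1 (s t, x t, v t)) /\
      is_derive x t (F2 (s t, x t, v t)) /\
      is_derive v t (F3 (s t, x t, v t)).
Proof.
  intros [_ [L1 [P1 [_ H1]]]] [_ [L2 [P2 [_ H2]]]] [_ [L3 [P3 [_ H3]]]].
  destruct (@picard_lindelof R3 (fun u => (F1 u, F2 u, F3 u)) (4 * (L1 + L2 + L3) + 1)
    (s0, x0, v0)) as [Y [HY0 HY]].
  - lra.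
  - intros u w. eapply Rle_trans; [apply norm_R3_le|].
    pose (n := @norm R_AbsRing R3 (minus u w)).
    assert (E1 : Rabs (F1 u - F1 w) <= L1 * n) by apply H1.
    assert (E2 : Rabs (F2 u - F2 w) <= L2 * n) by apply H2.
    assert (E3 : Rabs (F3 u - F3 w) <= L3 * n) by apply H3.
    assert (Hn : 0 <= n) by apply norm_ge_0.
    change (2 * (Rabs (F1 u - F1 w) + Rabs (F2 u - F2 w) + Rabs (F3 u - F3 w)) * 2
      <= (4 * (L1 + L2 + L3) + 1) * n).
    clearbody n. lra.
  - exists (fun t => fst (fst (Y t))), (fun t => snd (fst (Y t))), (fun t => snd (Y t)).
    rewrite HY0. do 3 (split; [reflexivity|]). intros t Ht.
    specialize (HY t). rewrite Rmax_right in HY by easy.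
    rewrite <- !surjective_pairing. split; [|split].
    + apply (filterdiff_comp' Y (fun u : R3 => fst (fst u)) t _ (fun u : R3 => fst (fst u)) HY).
      apply filterdiff_linear.
      apply (is_linear_comp (fun u : R3 => fst u) fst); apply is_linear_fst.
    + apply (filterdiff_comp' Y (fun u : R3 => snd (fst u)) t _ (fun u : R3 => snd (fst u)) HY).
      apply filterdiff_linear.
      apply (is_linear_comp (fun u : R3 => fst u) snd); [apply is_linear_fst|apply is_linear_snd].
    + apply (filterdiff_comp' Y (fun u : R3 => snd u) t _ (fun u : R3 => snd u) HY).
      apply filterdiff_linear, is_linear_snd.
Qed.

(** * The shell flow in the regular time *)

Lemma nondecreasing_of_derive (f df : R -> R) (p q : R) : p <= q ->
  (forall t, p <= t <= q -> is_derive f t (df t)) ->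
  (forall t, p <= t <= q -> 0 <= df t) -> f p <= f q.
Proof.
  intros Hpq Hd Hdf. destruct (Req_dec p q) as [->|Hn]; [lra|].
  destruct (MVT_open f df p q) as [c [Hc1 Hc2]]; [lra| | |].
  - intros; apply Hd; lra.
  - intros x Hx. apply is_derive_continuity_pt with (df x). now apply Hd.
  - assert (0 <= df c) by (apply Hdf; lra). nra.
Qed.

Section Flow.

Variables (lambda mu K S M0 a v0 : R).
Hypothesis Hlambda : 0 < lambda.
Hypothesis Hmu : 0 < mu.
Hypothesis HK : 0 < K.
Hypothesis HM0 : 0 < M0.
Hypothesis Ha : 0 < a.
Hypothesis HaS : a < S.
Hypothesis Hv0 : 0 <= v0.

(** This is [(lambda + 2 mu) dv/dt]. The first term collects the elastic forces. In the second,
    [K x^2 v] is the density and the bracket is the total enclosed mass divided by [s^3], with [M0]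
    the mass of the inner bodies. *)
Definition force (s x v : R) : R :=
  (2 * lambda * x * (x - v) + 2 * mu * (x ^ 2 - v ^ 2)) / s ^ 2
  - K * x ^ 2 * v * (M0 / s ^ 3 + 4 * PI / 3 * K * (x ^ 3 - S ^ 3 / s ^ 3)).

Definition pressure (x v : R) : R :=
  lambda * x ^ 2 + (lambda + 2 * mu) / 2 * v ^ 2 - (3 * lambda + 2 * mu) / 2.

Let X0 := S / a.

Hypothesis Hp0 : pressure X0 v0 = 0.
(** Along the flow the pressure has time derivative [v * rate], and the difference of the two sides
    here is [a^3] times the initial value of [rate]. *)
Hypothesis Hslope : K * X0 ^ 2 * v0 * M0 < 2 * mu * (X0 ^ 2 - v0 ^ 2) * a.

Let kap := lambda + 2 * mu.
Let c := 4 * PI / 3 * K.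

Let Hkap : 0 < kap. Proof. unfold kap. lra. Qed.
Let Hc : 0 < c. Proof. unfold c. generalize PI_RGT_0. nra. Qed.
Let HX0 : 1 < X0.
Proof.
  unfold X0. apply Rmult_lt_reg_r with a; [easy|].
  replace (S / a * a) with S by (field; lra). lra.
Qed.

Let Hv0X : v0 < X0.
Proof.
  unfold pressure in Hp0. assert (HX2 : 1 < X0 ^ 2) by nra.
  assert (0 < lambda * (X0 ^ 2 - 1)) by (apply Rmult_lt_0_compat; lra).
  assert (kap * (v0 ^ 2 - 1) < 0) by (unfold kap; lra).
  assert (v0 ^ 2 < 1) by nra. nra.
Qed.

(* These clamps make the field globally Lipschitz; they turn out to be inactive
   as long as [x >= 1]. *)
Let q (s : R) := / Rmax a s.
Let cx (x : R) := Rmax 1 (Rmin X0 x).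
Let cv (v : R) := Rmax 0 (Rmin X0 v).
Let F1 (s x v : R) := cv v * q s.
Let F2 (s x v : R) := cv v * (cv v - cx x) * q s ^ 2.
Let F3 (s x v : R) :=
  ((2 * lambda * cx x * (cx x - cv v) + 2 * mu * (cx x ^ 2 - cv v ^ 2)) * q s ^ 2
   - K * cx x ^ 2 * cv v * (M0 * q s ^ 3 + c * Rmax 0 (cx x ^ 3 - S ^ 3 * q s ^ 3))) * / kap.

Lemma clamped_flow : exists s x v : R -> R, s 0 = a /\ x 0 = X0 /\ v 0 = v0 /\
  forall t, 0 <= t ->
    is_derive s t (F1 (s t) (x t) (v t)) /\
    is_derive x t (F2 (s t) (x t) (v t)) /\
    is_derive v t (F3 (s t) (x t) (v t)).
Proof.
  assert (Hq : bounded_Lipschitz (fun u : R3 => q (fst (fst u)))).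
  { apply (@bounded_Lipschitz_inv_Rmax R3 (fun u => fst (fst u))); [easy|].
    intros u w. apply R3_proj_Lipschitz. }
  assert (Hx : bounded_Lipschitz (fun u : R3 => cx (snd (fst u)))).
  { apply (@bounded_Lipschitz_clamp R3 (fun u => snd (fst u))); [lra|].
    intros u w. apply R3_proj_Lipschitz. }
  assert (Hv : bounded_Lipschitz (fun u : R3 => cv (snd u))).
  { apply (@bounded_Lipschitz_clamp R3 (fun u => snd u)); [lra|].
    intros u w. apply R3_proj_Lipschitz. }
  apply (bounded_Lipschitz_flow
    (fun u => F1 (fst (fst u)) (snd (fst u)) (snd u))
    (fun u => F2 (fst (fst u)) (snd (fst u)) (snd u))
    (fun u => F3 (fst (fst u)) (snd (fst u)) (snd u))); unfold F1, F2, F3;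
  repeat first [ apply Hq | apply Hx | apply Hv
    | apply (@bounded_Lipschitz_minus R3) | apply (@bounded_Lipschitz_plus R3)
    | apply (@bounded_Lipschitz_mult R3) | apply (@bounded_Lipschitz_pow R3)
    | apply (@bounded_Lipschitz_const R3)
    | apply (@bounded_Lipschitz_Rmax0 R3) ].
Qed.

Let q_pos s : 0 < q s <= / a.
Proof.
  unfold q. generalize (Rmax_l a s). intros. split.
  - apply Rinv_0_lt_compat. lra.
  - apply Rinv_le_contravar; lra.
Qed.

Let cx_bounds x : 1 <= cx x <= X0.
Proof. unfold cx, Rmax, Rmin. repeat destruct Rle_dec; lra. Qed.

Let cv_bounds v : 0 <= cv v <= X0.
Proof. unfold cv, Rmax, Rmin. repeat destruct Rle_dec; lra. Qed.

Section Solution.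

Variables s x v : R -> R.
Hypothesis Hs0 : s 0 = a.
Hypothesis Hx0 : x 0 = X0.
Hypothesis Hvv0 : v 0 = v0.
Hypothesis Hs : forall t, 0 <= t -> is_derive s t (F1 (s t) (x t) (v t)).
Hypothesis Hx : forall t, 0 <= t -> is_derive x t (F2 (s t) (x t) (v t)).
Hypothesis Hv : forall t, 0 <= t -> is_derive v t (F3 (s t) (x t) (v t)).

(** Gravity is proportional to [v], so where [v <= 0] the clamped force reduces to the elastic term
    [2 (lambda + mu) x^2 / s^2], which is positive. No information on [x] enters, because [cx] is at
    least 1. *)
Let v_pos t : 0 < t -> 0 < v t.
Proof.
  intros Ht. apply (barrier v (fun t => F3 (s t) (x t) (v t)) t); [| | |lra].
  - intros u Hu. apply Hv. lra.
  - lra.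
  - intros u Hu Hvu. unfold F3.
    assert (E : cv (v u) = 0) by (unfold cv, Rmax, Rmin; repeat destruct Rle_dec; lra).
    rewrite E. generalize (cx_bounds (x u)) (q_pos (s u)). intros Hc1 Hc2.
    assert (0 < q (s u) ^ 2) by (apply pow_lt; lra).
    assert (0 < cx (x u) ^ 2) by (apply pow_lt; lra).
    apply Rmult_lt_0_compat; [|now apply Rinv_0_lt_compat].
    replace (_ - _) with (2 * (lambda + mu) * cx (x u) ^ 2 * q (s u) ^ 2) by ring.
    repeat apply Rmult_lt_0_compat; lra.
Qed.

Let s_ge t : 0 <= t -> a <= s t.
Proof.
  intros Ht. rewrite <- Hs0.
  apply nondecreasing_of_derive with (df := fun t => F1 (s t) (x t) (v t)); [easy| |].
  - intros; apply Hs; lra.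
  - intros u _. unfold F1. generalize (cv_bounds (v u)) (q_pos (s u)). nra.
Qed.

Section UpTo.

Variable T : R.
Hypothesis HT : forall t, 0 <= t <= T -> 1 <= x t.

(** Barrier for [x - v]: if [v] caught up with [x], the elastic forces would be nonpositive and
    gravity strictly attractive as [M0 > 0], so [v] would decrease while [x] would not. The
    assumption [x >= 1] ensures that clamping preserves the order of [x] and [v]. *)
Let v_lt_x t : 0 <= t <= T -> v t < x t.
Proof.
  intros Ht. destruct (Req_dec t 0) as [->|Hn]; [lra|].
  apply Rlt_0_minus.
  apply (barrier (fun t => x t - v t)
    (fun t => F2 (s t) (x t) (v t) - F3 (s t) (x t) (v t)) T); [| | |lra].
  - intros u Hu. apply (@is_derive_minus R_AbsRing R_NormedModule); [apply Hx|apply Hv]; lra.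
  - lra.
  - intros u Hu Hle. specialize (HT u Hu).
    assert (E1 : cx (x u) <= cv (v u)).
    { unfold cx, cv, Rmax, Rmin; repeat destruct Rle_dec; lra. }
    generalize (cx_bounds (x u)) (cv_bounds (v u)) (q_pos (s u)).
    unfold F2, F3. set (X := cx (x u)) in *. set (N := cv (v u)) in *.
    set (Q := q (s u)) in *. intros HX HN HQ.
    assert (0 < Q ^ 2) by (apply pow_lt; lra).
    assert (0 < Q ^ 3) by (apply pow_lt; lra).
    (* The clamp on the local mass avoids a circularity: [ref_radius_ge], which gives its true sign,
       relies on this lemma. *)
    assert (0 <= Rmax 0 (X ^ 3 - S ^ 3 * Q ^ 3)) by apply Rmax_l.
    set (m := Rmax 0 _) in *.
    assert (HF2 : 0 <= N * (N - X) * Q ^ 2).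
    { repeat apply Rmult_le_pos; lra. }
    assert (Hg : 0 < K * X ^ 2 * N * (M0 * Q ^ 3 + c * m)).
    { apply Rmult_lt_0_compat; [|nra].
      repeat apply Rmult_lt_0_compat; lra. }
    assert (Hel : (2 * lambda * X * (X - N) + 2 * mu * (X ^ 2 - N ^ 2)) * Q ^ 2 <= 0).
    { assert (2 * lambda * X * (X - N) <= 0).
      { assert (0 <= lambda * X * (N - X)) by (repeat apply Rmult_le_pos; lra). lra. }
      assert (X ^ 2 - N ^ 2 <= 0).
      { replace (X ^ 2 - N ^ 2) with (- ((N - X) * (N + X))) by ring.
        assert (0 <= (N - X) * (N + X)) by (apply Rmult_le_pos; lra). lra. }
      assert (0 <= mu * - (X ^ 2 - N ^ 2)) by (apply Rmult_le_pos; lra).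
      apply Ropp_le_cancel. rewrite Ropp_0, Ropp_mult_distr_l.
      apply Rmult_le_pos; lra. }
    assert (HF3 : (2 * lambda * X * (X - N) + 2 * mu * (X ^ 2 - N ^ 2)) * Q ^ 2
      - K * X ^ 2 * N * (M0 * Q ^ 3 + c * m) < 0) by lra.
    assert (Hik : 0 < / kap) by now apply Rinv_0_lt_compat.
    set (w := _ - K * X ^ 2 * N * _) in *. nra.
Qed.

Let v_nonneg t : 0 <= t -> 0 <= v t.
Proof.
  intros Ht. destruct (Req_dec t 0) as [->|Hn]; [lra|].
  apply Rlt_le, v_pos. lra.
Qed.

Let x_le_X0 t : 0 <= t <= T -> x t <= X0.
Proof.
  intros Ht. apply Ropp_le_cancel. rewrite <- Hx0.
  apply (nondecreasing_of_derive (fun t => - x t) (fun t => - F2 (s t) (x t) (v t))); [easy| |].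
  - intros u Hu. apply (@is_derive_opp R_AbsRing R_NormedModule), Hx. lra.
  - intros u Hu. specialize (HT u ltac:(lra)). generalize (v_lt_x u ltac:(lra)). intros Hvx.
    generalize (v_nonneg u ltac:(lra)) (q_pos (s u)). intros H1 H2. unfold F2.
    assert (E1 : 0 <= cv (v u) <= cx (x u)).
    { unfold cx, cv, Rmax, Rmin; repeat destruct Rle_dec; lra. }
    assert (0 < q (s u) ^ 2) by (apply pow_lt; lra).
    replace (- (_ * _ * _)) with (cv (v u) * (cx (x u) - cv (v u)) * q (s u) ^ 2) by ring.
    repeat apply Rmult_le_pos; lra.
Qed.

Let unclamp t : 0 <= t <= T -> cx (x t) = x t /\ cv (v t) = v t /\ q (s t) = / s t.
Proof.
  intros Ht. generalize (x_le_X0 t Ht) (v_lt_x t Ht) (v_nonneg t (proj1 Ht)) (HT t Ht)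
    (s_ge t (proj1 Ht)). intros.
  unfold cx, cv, q, Rmax, Rmin. repeat split; repeat destruct Rle_dec; lra.
Qed.

(** The product [y = x s] satisfies [dy/dt = v^2 / s >= 0] and starts at [S]; the local mass is
    therefore nonnegative. *)
Let ref_radius_ge t : 0 <= t <= T -> S <= x t * s t.
Proof.
  intros Ht. replace S with (x 0 * s 0) by (rewrite Hs0, Hx0; unfold X0; field; lra).
  apply (nondecreasing_of_derive (fun t => x t * s t)
    (fun t => F2 (s t) (x t) (v t) * s t + x t * F1 (s t) (x t) (v t))); [easy| |].
  - intros u Hu. apply (@is_derive_mult R_AbsRing); [apply Hx|apply Hs|apply Rmult_comm]; lra.
  - intros u Hu. unfold F1, F2. destruct (unclamp u ltac:(lra)) as [-> [-> ->]].
    generalize (s_ge u ltac:(lra)). intros.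
    replace (_ + _) with (v u ^ 2 * / s u) by (field; lra).
    apply Rmult_le_pos; [apply pow2_ge_0|]. apply Rlt_le, Rinv_0_lt_compat. lra.
Qed.

Lemma unclamped_flow t : 0 <= t <= T ->
  is_derive s t (v t / s t) /\
  is_derive x t (v t * (v t - x t) / s t ^ 2) /\
  is_derive v t (force (s t) (x t) (v t) / kap).
Proof.
  intros Ht.
  assert (H1 := Hs t (proj1 Ht)). assert (H2 := Hx t (proj1 Ht)).
  assert (H3 := Hv t (proj1 Ht)). unfold F1, F2, F3 in *.
  assert (Hst := s_ge t (proj1 Ht)). assert (Hy := ref_radius_ge t Ht).
  destruct (unclamp t Ht) as [E1 [E2 E3]]. rewrite E1, E2, E3 in *.
  split; [easy|]. split.
  - replace (v t * (v t - x t) / s t ^ 2) with (v t * (v t - x t) * (/ s t) ^ 2)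
      by (field; lra). easy.
  - assert (Hm : 0 <= x t ^ 3 - S ^ 3 * (/ s t) ^ 3).
    { replace (x t ^ 3 - S ^ 3 * (/ s t) ^ 3) with (((x t * s t) ^ 3 - S ^ 3) * (/ s t) ^ 3)
        by (field; lra).
      apply Rmult_le_pos; [|apply pow_le, Rlt_le, Rinv_0_lt_compat; lra].
      apply Rge_le, Rge_minus, Rle_ge, pow_incr. lra. }
    rewrite Rmax_right in H3 by easy.
    replace (force (s t) (x t) (v t) / kap) with
      (((2 * lambda * x t * (x t - v t) + 2 * mu * (x t ^ 2 - v t ^ 2)) * (/ s t) ^ 2
       - K * x t ^ 2 * v t * (M0 * (/ s t) ^ 3 + c * (x t ^ 3 - S ^ 3 * (/ s t) ^ 3))) * / kap).
    { easy. }
    unfold force, c. field. lra.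
Qed.

Lemma flow_bounds t : 0 <= t <= T -> a <= s t /\ 0 <= v t < x t /\ x t <= X0 /\ S <= x t * s t.
Proof.
  intros Ht. generalize (s_ge t (proj1 Ht)) (v_lt_x t Ht) (v_nonneg t (proj1 Ht))
    (x_le_X0 t Ht) (ref_radius_ge t Ht). lra.
Qed.

End UpTo.

Let X0_sq : lambda * X0 ^ 2 <= (3 * lambda + 2 * mu) / 2.
Proof.
  unfold pressure in Hp0. assert (0 <= kap / 2 * v0 ^ 2).
  { apply Rmult_le_pos; [lra|apply pow2_ge_0]. }
  unfold kap in *. lra.
Qed.

(* If [x] stayed above 1 and the pressure stayed nonnegative forever, then [v]
   would be bounded below, so [s] would tend to infinity and gravity, of order
   [s] against [1 / s] for the elastic terms, would make [v] negative. *)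
Lemma pressure_negative_of_ge_1 : (forall t, 0 <= t -> 1 <= x t) ->
  exists T, 0 < T /\ pressure (x T) (v T) < 0.
Proof.
  intros H1. apply NNPP. intros Hno.
  assert (HP : forall t, 0 < t -> 0 <= pressure (x t) (v t)).
  { intros t Ht. apply Rnot_lt_le. intros Hl. apply Hno. now exists t. }
  assert (HB : forall t, 0 <= t -> a <= s t /\ 0 <= v t < x t /\ x t <= X0 /\ S <= x t * s t).
  { intros t Ht. apply (flow_bounds t); [intros; apply H1|]; lra. }
  assert (HD : forall t, 0 <= t -> is_derive s t (v t / s t) /\
    is_derive x t (v t * (v t - x t) / s t ^ 2) /\
    is_derive v t (force (s t) (x t) (v t) / kap)).
  { intros t Ht. apply (unclamped_flow t); [intros; apply H1|]; lra. }
  assert (Hx1 : x 1 < X0).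
  { destruct (MVT_open x (fun t => v t * (v t - x t) / s t ^ 2) 0 1) as [r [Hr1 Hr2]]; [lra| | |].
    - intros t Ht. destruct (HD t ltac:(lra)) as [_ [Dx _]]. exact Dx.
    - intros t Ht. destruct (HD t ltac:(lra)) as [_ [Dx _]].
      exact (is_derive_continuity_pt _ _ _ Dx).
    - generalize (v_pos r ltac:(lra)) (HB r ltac:(lra)). intros Hvr HBr.
      assert (0 < v r * (x r - v r) * (/ s r) ^ 2).
      { assert (0 < / s r) by (apply Rinv_0_lt_compat; lra).
        repeat apply Rmult_lt_0_compat; lra. }
      replace (v r * (v r - x r) / s r ^ 2) with (- (v r * (x r - v r) * (/ s r) ^ 2)) in Hr2
        by (field; lra). lra. }
  (* Nonnegative pressure and [x t <= x 1] give [v^2 >= w1] from time 1 on. Time 0 would not do: if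
     [v0 = 0] the corresponding bound is 0, so the strict decrease of [x] on [[0, 1]] is used. *)
  pose (w1 := ((3 * lambda + 2 * mu) / 2 - lambda * x 1 ^ 2) * (2 / kap)).
  assert (Hi2 : 0 < 2 / kap) by (apply Rdiv_lt_0_compat; lra).
  assert (Hw1 : 0 < w1).
  { apply Rmult_lt_0_compat; [|easy]. specialize (H1 1 ltac:(lra)).
    assert (x 1 ^ 2 < X0 ^ 2) by nra.
    assert (lambda * x 1 ^ 2 < lambda * X0 ^ 2) by (apply Rmult_lt_compat_l; lra). lra. }
  pose (v1 := sqrt w1).
  assert (Hv1 : 0 < v1) by now apply sqrt_lt_R0.
  assert (Hv1t : forall t, 1 <= t -> v1 <= v t).
  { intros t Ht.
    assert (Hxt : x t <= x 1).
    { apply Ropp_le_cancel.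
      apply (nondecreasing_of_derive (fun t => - x t)
        (fun t => - (v t * (v t - x t) / s t ^ 2))); [easy| |].
      - intros u Hu. destruct (HD u ltac:(lra)) as [_ [Dx _]].
        exact (@is_derive_opp R_AbsRing R_NormedModule _ _ _ Dx).
      - intros u Hu. generalize (HB u ltac:(lra)). intros HBu.
        replace (- _) with (v u * (x u - v u) * (/ s u) ^ 2) by (field; lra).
        assert (0 < / s u) by (apply Rinv_0_lt_compat; lra).
        repeat apply Rmult_le_pos; lra. }
    generalize (HP t ltac:(lra)) (HB t ltac:(lra)) (H1 t ltac:(lra)). intros HPt HBt H1t.
    unfold v1. rewrite <- (sqrt_pow2 (v t)) by lra. apply sqrt_le_1_alt.
    unfold pressure in HPt. fold kap in HPt. unfold w1.
    apply Rmult_le_reg_r with (kap / 2); [lra|].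
    replace (_ * (2 / kap) * (kap / 2)) with ((3 * lambda + 2 * mu) / 2 - lambda * x 1 ^ 2)
      by (field; lra).
    assert (x t ^ 2 <= x 1 ^ 2) by nra.
    assert (lambda * x t ^ 2 <= lambda * x 1 ^ 2) by (apply Rmult_le_compat_l; lra). lra. }
  assert (Hst : forall t, 1 <= t -> 2 * v1 * (t - 1) <= s t ^ 2).
  { intros t Ht.
    assert (s 1 ^ 2 - 2 * v1 * (1 - 1) <= s t ^ 2 - 2 * v1 * (t - 1)).
    { apply (nondecreasing_of_derive (fun t => s t ^ 2 - 2 * v1 * (t - 1))
        (fun t => 2 * v t - 2 * v1)); [easy| |].
      - intros u Hu. destruct (HD u ltac:(lra)) as [Hd _].
        generalize (HB u ltac:(lra)). intros HBu.
        auto_derive; [now exists (v u / s u)|].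
        replace (Derive (fun x => s x) u) with (v u / s u)
          by (symmetry; now apply is_derive_unique). field. lra.
      - intros u Hu. generalize (Hv1t u ltac:(lra)). lra. }
    generalize (pow2_ge_0 (s 1)). lra. }
  (* [A / s^2] bounds the elastic terms, and [D] bounds gravity from below once [s >= 2 S]. Since
     [(s^2)' = 2 v >= 2 v1], after time [t2] one has [s^2 >= 4 S^2 + 2 A / D]; this gives [s >= 2 S]
     and makes the elastic terms at most [D / 2]. *)
  pose (A := 2 * (lambda + mu) * X0 ^ 2).
  pose (D := K * v1 * c / 2).
  assert (HA : 0 < A) by (unfold A; apply Rmult_lt_0_compat; [lra|apply pow_lt; lra]).
  assert (HDp : 0 < D).
  { assert (0 < K * v1 * c) by (apply Rmult_lt_0_compat; [apply Rmult_lt_0_compat|]; lra).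
    unfold D. lra. }
  pose (t2 := 1 + (4 * S ^ 2 + 2 * A / D) / (2 * v1)).
  assert (HAD : 0 < 2 * A / D) by (apply Rdiv_lt_0_compat; lra).
  assert (Ht2 : 1 < t2).
  { unfold t2. assert (0 < (4 * S ^ 2 + 2 * A / D) / (2 * v1)); [|lra].
    apply Rdiv_lt_0_compat; [|lra]. generalize (pow2_ge_0 S). lra. }
  assert (Hf : forall t, t2 <= t -> force (s t) (x t) (v t) <= - D / 2).
  { intros t Ht. generalize (HB t ltac:(lra)) (H1 t ltac:(lra)) (Hv1t t ltac:(lra)).
    intros HBt H1t Hvt.
    assert (Hs2 : 4 * S ^ 2 + 2 * A / D <= s t ^ 2).
    { eapply Rle_trans; [|apply Hst; lra].
      apply Rle_trans with (2 * v1 * (t2 - 1)).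
      - unfold t2. apply Req_le. field. lra.
      - apply Rmult_le_compat_l; lra. }
    assert (HsS : 2 * S <= s t).
    { apply Rnot_lt_le. intros Hl. nra. }
    assert (His : 0 < / s t) by (apply Rinv_0_lt_compat; lra).
    assert (HSs : S * / s t <= 1 / 2).
    { apply Rmult_le_reg_r with (s t); [lra|]. rewrite Rmult_assoc, Rinv_l; lra. }
    assert (Hcube : (S * / s t) ^ 3 <= 1 / 2).
    { apply Rle_trans with ((1 / 2) ^ 3); [|lra]. apply pow_incr. split; [|easy].
      apply Rmult_le_pos; lra. }
    assert (He : (2 * lambda * x t * (x t - v t) + 2 * mu * (x t ^ 2 - v t ^ 2)) / s t ^ 2 <= D / 2).
    { apply Rle_trans with (A / s t ^ 2).
      - apply Rmult_le_compat_r; [apply Rlt_le, Rinv_0_lt_compat, pow_lt; lra|].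
        unfold A.
        assert (x t * (x t - v t) <= X0 ^ 2) by nra.
        assert (x t ^ 2 - v t ^ 2 <= X0 ^ 2) by nra.
        assert (lambda * (x t * (x t - v t)) <= lambda * X0 ^ 2) by (apply Rmult_le_compat_l; lra).
        assert (mu * (x t ^ 2 - v t ^ 2) <= mu * X0 ^ 2) by (apply Rmult_le_compat_l; lra). lra.
      - apply Rmult_le_reg_r with (s t ^ 2); [apply pow_lt; lra|].
        replace (A / s t ^ 2 * s t ^ 2) with A by (field; lra).
        apply Rle_trans with (D / 2 * (2 * A / D)); [apply Req_le; field; lra|].
        apply Rmult_le_compat_l; [lra|]. generalize (pow2_ge_0 S). lra. }
    assert (Hg : D <= K * x t ^ 2 * v t * (M0 / s t ^ 3 + c * (x t ^ 3 - S ^ 3 / s t ^ 3))).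
    { assert (0 <= M0 / s t ^ 3).
      { apply Rlt_le, Rdiv_lt_0_compat; [easy|apply pow_lt; lra]. }
      assert (Hx3 : 1 <= x t ^ 3) by (apply pow_R1_Rle; lra).
      replace (S ^ 3 / s t ^ 3) with ((S * / s t) ^ 3) by (field; lra).
      assert (Hm : c * (1 / 2) <= M0 / s t ^ 3 + c * (x t ^ 3 - (S * / s t) ^ 3)).
      { assert (c * (1 / 2) <= c * (x t ^ 3 - (S * / s t) ^ 3)) by (apply Rmult_le_compat_l; lra).
        lra. }
      assert (Hx2 : 1 <= x t ^ 2) by (apply pow_R1_Rle; lra).
      assert (Hkv : K * v1 <= K * x t ^ 2 * v t).
      { rewrite Rmult_assoc. apply Rmult_le_compat_l; [lra|]. nra. }
      replace D with (K * v1 * (c * (1 / 2))) by (unfold D; field).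
      apply Rmult_le_compat; [apply Rmult_le_pos; lra|lra|easy|easy]. }
    unfold force. fold c. lra. }
  (* From [t2] on [v] decreases at rate at least [D / (2 kap)], and [v t2 < X0]; this is long enough
     to use up [X0]. *)
  pose (T := t2 + X0 * (2 * kap / D)).
  assert (HTl : 0 < X0 * (2 * kap / D)).
  { apply Rmult_lt_0_compat; [lra|]. apply Rdiv_lt_0_compat; lra. }
  assert (- v t2 - D / (2 * kap) * t2 <= - v T - D / (2 * kap) * T).
  { apply (nondecreasing_of_derive (fun t => - v t - D / (2 * kap) * t)
      (fun t => - (force (s t) (x t) (v t) / kap) - D / (2 * kap))).
    - unfold T. lra.
    - intros u Hu. destruct (HD u ltac:(lra)) as [_ [_ Hd]].
      auto_derive; [now exists (force (s u) (x u) (v u) / kap)|].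
      replace (Derive (fun x => v x) u) with (force (s u) (x u) (v u) / kap)
        by (symmetry; now apply is_derive_unique). ring.
    - intros u Hu. specialize (Hf u (proj1 Hu)).
      replace (- (_ / kap) - D / (2 * kap)) with ((- D / 2 - force (s u) (x u) (v u)) * / kap)
        by (field; lra).
      apply Rmult_le_pos; [lra|]. apply Rlt_le, Rinv_0_lt_compat. lra. }
  assert (ET : D / (2 * kap) * T = D / (2 * kap) * t2 + X0) by (unfold T; field; lra).
  generalize (HB t2 ltac:(lra)) (v_pos T ltac:(unfold T; lra)). lra.
Qed.

(** If [x] drops below 1, the first time with [x = 1] serves: there [v < 1], and
    [pressure 1 v = kap / 2 * (v^2 - 1)]. *)
Lemma pressure_negative : exists T, 0 < T /\ (forall t, 0 <= t <= T -> 1 <= x t) /\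
  pressure (x T) (v T) < 0.
Proof.
  destruct (classic (forall t, 0 <= t -> 1 <= x t)) as [H1|H1].
  - destruct (pressure_negative_of_ge_1 H1) as [T [HT HP]].
    exists T. split; [easy|]. split; [|easy]. intros; apply H1; lra.
  - apply not_all_ex_not in H1. destruct H1 as [T H1]. apply imply_to_and in H1.
    destruct H1 as [HT H1].
    assert (HT0 : 0 < T) by (destruct (Req_dec T 0) as [->|]; lra).
    destruct (first_zero (fun t => x t - 1) 0 T) as [b [Hb1 [Hb2 Hb3]]]; [lra| |lra|lra|].
    { intros t Ht. apply continuity_pt_minus; [|now apply continuity_pt_const].
      eapply is_derive_continuity_pt. apply Hx. lra. }
    assert (Hb : forall t, 0 <= t <= b -> 1 <= x t).
    { intros t Ht. destruct (Req_dec t b) as [->|]; [lra|]. generalize (Hb3 t). lra. }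
    exists b. split; [lra|]. split; [easy|].
    generalize (flow_bounds b Hb b ltac:(lra)). intros HBb.
    unfold pressure. fold kap. replace (x b) with 1 in * by lra.
    assert (v b ^ 2 < 1) by nra.
    assert (kap / 2 * v b ^ 2 < kap / 2 * 1) by (apply Rmult_lt_compat_l; lra).
    unfold kap in *. lra.
Qed.

Lemma flow_first_zero : exists beta, 0 < beta /\
  (forall t, 0 <= t <= beta -> is_derive s t (v t / s t) /\
    is_derive x t (v t * (v t - x t) / s t ^ 2) /\
    is_derive v t (force (s t) (x t) (v t) / (lambda + 2 * mu)) /\
    a <= s t /\ 0 <= v t < x t) /\
  (forall t, 0 < t <= beta -> 0 < v t) /\
  (forall t, 0 < t < beta -> 0 < pressure (x t) (v t)) /\
  pressure (x beta) (v beta) = 0.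
Proof.
  destruct pressure_negative as [T [HT [H1 HP]]].
  assert (HD := unclamped_flow T H1). assert (HB := flow_bounds T H1).
  pose (P := fun t => pressure (x t) (v t)).
  (* In the time derivative of the pressure the [lambda] terms cancel and a factor [v] splits off.
     When [v0 = 0] that derivative vanishes at 0, so positivity for small times comes from
     [rate 0 > 0] and [v > 0] afterwards, through the mean value theorem. *)
  pose (rate := fun t => 2 * mu * (x t ^ 2 - v t ^ 2) / s t ^ 2 -
    K * x t ^ 2 * v t * (M0 / s t ^ 3 + c * (x t ^ 3 - S ^ 3 / s t ^ 3))).
  assert (HPd : forall t, 0 <= t <= T -> is_derive P t (v t * rate t)).
  { intros t Ht. destruct (HD t Ht) as [Ds [Dx Dv]]. generalize (HB t Ht). intros HBt.
    unfold P, pressure.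
    auto_derive; [split; [now eexists; apply Dx|split; [now eexists; apply Dv|easy]]|].
    replace (Derive (fun x0 => x x0) t) with (v t * (v t - x t) / s t ^ 2)
      by (symmetry; now apply is_derive_unique).
    replace (Derive (fun x0 => v x0) t) with (force (s t) (x t) (v t) / kap)
      by (symmetry; now apply is_derive_unique).
    unfold rate, force. fold c. unfold kap. field. unfold kap in *. lra. }
  assert (HR0 : 0 < rate 0).
  { unfold rate. rewrite Hs0, Hx0, Hvv0.
    replace (_ - _) with ((2 * mu * (X0 ^ 2 - v0 ^ 2) * a - K * X0 ^ 2 * v0 * M0) * (/ a) ^ 3).
    - apply Rmult_lt_0_compat; [lra|]. apply pow_lt, Rinv_0_lt_compat. lra.
    - unfold X0. field. lra. }
  assert (HRc : continuity_pt rate 0).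
  { destruct (HD 0 ltac:(lra)) as [Ds [Dx Dv]].
    apply continuity_pt_filterlim, (@ex_derive_continuous R_AbsRing R_NormedModule).
    unfold rate. auto_derive.
    repeat split; try (eexists; eassumption); rewrite Hs0;
    repeat apply Rmult_integral_contrapositive_currified; lra. }
  destruct (continuity_pt_Rabs rate 0 HRc (rate 0) HR0) as [d [Hd HRd]].
  assert (Hpos : forall t, 0 < t <= T -> t < d -> 0 < P t).
  { intros t Ht Htd. destruct (MVT_open P (fun t => v t * rate t) 0 t) as [r [Hr1 Hr2]]; [lra| | |].
    - intros u Hu. apply HPd. lra.
    - intros u Hu. eapply is_derive_continuity_pt. apply HPd. lra.
    - assert (P 0 = 0) by (unfold P; now rewrite Hx0, Hvv0).
      specialize (HRd r ltac:(rewrite Rminus_0_r, Rabs_pos_eq; lra)). apply Rabs_def2 in HRd.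
      generalize (v_pos r ltac:(lra)). intros Hvr.
      assert (0 < v r * rate r * (t - 0)) by (repeat apply Rmult_lt_0_compat; lra). lra. }
  (* The pressure vanishes at time 0 itself, so the first zero is sought after a time [p] at which
     it is already positive. *)
  pose (p := Rmin (d / 2) (T / 2)).
  assert (Hp : 0 < p) by (apply Rmin_glb_lt; lra).
  assert (Hpd := Rmin_l (d / 2) (T / 2)). assert (HpT := Rmin_r (d / 2) (T / 2)).
  fold p in Hpd, HpT.
  destruct (first_zero P p T) as [b [Hb1 [Hb2 Hb3]]]; [lra| |apply Hpos; lra|unfold P; lra|].
  { intros t Ht. eapply is_derive_continuity_pt. apply HPd. lra. }
  exists b. split; [lra|]. split; [|split; [|split; [|easy]]].
  - intros t Ht. destruct (HD t ltac:(lra)) as [Ds [Dx Dv]].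
    generalize (HB t ltac:(lra)). intros HBt. repeat (split; [easy|]). lra.
  - intros t Ht. apply v_pos. lra.
  - intros t Ht. destruct (Rlt_le_dec t p); [apply Hpos; lra|apply Hb3; lra].
Qed.

End Solution.

Theorem shell_flow : exists beta (s x v : R -> R),
  0 < beta /\ s 0 = a /\ x 0 = S / a /\ v 0 = v0 /\
  (forall t, 0 <= t <= beta -> is_derive s t (v t / s t) /\
    is_derive x t (v t * (v t - x t) / s t ^ 2) /\
    is_derive v t (force (s t) (x t) (v t) / (lambda + 2 * mu)) /\
    a <= s t /\ 0 <= v t < x t) /\
  (forall t, 0 < t <= beta -> 0 < v t) /\
  (forall t, 0 < t < beta -> 0 < pressure (x t) (v t)) /\
  pressure (x beta) (v beta) = 0.
Proof.
  destruct clamped_flow as [s [x [v [E1 [E2 [E3 H]]]]]].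
  destruct (flow_first_zero s x v E1 E2 E3) as [b Hb]; try (intros; now apply H).
  now exists b, s, x, v.
Qed.

End Flow.

(** * The shell equation in the radius *)

(** The derivative may vanish at the endpoints, as [ds/dt] does at the start when [v0 = 0]; there
    the inverse is only continuous. It is extended by constants so as to be continuous on the whole
    line. *)
Lemma increasing_inverse (f df : R -> R) (p q : R) : p < q ->
  (forall t, p <= t <= q -> is_derive f t (df t)) ->
  (forall t, p < t < q -> 0 < df t) ->
  exists g : R -> R,
    (forall r, p <= g r <= q) /\ g (f p) = p /\ g (f q) = q /\
    (forall r, f p <= r <= f q -> f (g r) = r) /\
    (forall r, continuous g r) /\
    (forall r, f p < r < f q -> p < g r < q /\ is_derive g r (/ df (g r))).
Proof.
  intros Hpq Hd Hdf.
  assert (Hinc : forall t u, p <= t -> t < u -> u <= q -> f t < f u).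
  { intros t u Ht Htu Hu. destruct (MVT_open f df t u Htu) as [c [Hc1 Hc2]].
    - intros; apply Hd; lra.
    - intros w Hw. apply is_derive_continuity_pt with (df w). apply Hd. lra.
    - assert (0 < df c) by (apply Hdf; lra). nra. }
  assert (Hfpq := Hinc p q (Rle_refl p) Hpq (Rle_refl q)).
  pose (cl := fun r => Rmax (f p) (Rmin (f q) r)).
  assert (Hcl : forall r, f p <= cl r <= f q).
  { intros r. unfold cl, Rmax, Rmin. repeat destruct Rle_dec; lra. }
  assert (Hclid : forall r, f p <= r <= f q -> cl r = r).
  { intros r Hr. unfold cl, Rmax, Rmin. repeat destruct Rle_dec; lra. }
  assert (Hex : forall r, exists t, p <= t <= q /\ f t = cl r).
  { intros r. generalize (Hcl r). intros Hr.
    destruct (Req_dec (cl r) (f p)) as [E|E]; [exists p; split; [lra|easy]|].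
    destruct (first_zero (fun t => cl r - f t) p q Hpq) as [t [Ht1 [Ht2 _]]]; try lra.
    - intros t Ht. apply continuity_pt_minus; [now apply continuity_pt_const|].
      apply is_derive_continuity_pt with (df t). now apply Hd.
    - exists t. lra. }
  pose (g := fun r => proj1_sig (constructive_indefinite_description _ (Hex r))).
  assert (Hg : forall r, p <= g r <= q /\ f (g r) = cl r).
  { intros r. apply (proj2_sig (constructive_indefinite_description _ (Hex r))). }
  assert (Hgf : forall t, p <= t <= q -> g (f t) = t).
  { intros t Ht. destruct (Hg (f t)) as [H1 H2].
    rewrite Hclid in H2.
    - destruct (Rtotal_order (g (f t)) t) as [H|[H|H]]; [|easy|].
      + generalize (Hinc _ _ (proj1 H1) H (proj2 Ht)). lra.
      + generalize (Hinc _ _ (proj1 Ht) H (proj2 H1)). lra.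
    - split; [destruct (Req_dec t p) as [->|]|destruct (Req_dec t q) as [->|]]; try lra;
        apply Rlt_le, Hinc; lra. }
  assert (Hgc : forall r, continuous g r).
  { intros r. apply continuous_of_Rabs. intros eps He.
    destruct (Hg r) as [H1 H2].
    (* By monotonicity [f] changes by at least a fixed [d] once its argument moves by [eps]. The
       value 1 is a default for the case in which such a move leaves [[p, q]]. *)
    assert (Hup : exists d, 0 < d /\
      forall t, p <= t <= q -> g r + eps <= t -> d <= f t - f (g r)).
    { destruct (Rle_dec (g r + eps) q) as [Hq|Hq].
      - exists (f (g r + eps) - f (g r)). split.
        + generalize (Hinc (g r) (g r + eps)). lra.
        + intros t Ht Hrt. destruct (Req_dec t (g r + eps)) as [->|Hn]; [lra|].
          generalize (Hinc (g r + eps) t). lra.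
      - exists 1. split; [lra|]. intros; lra. }
    assert (Hdn : exists d, 0 < d /\
      forall t, p <= t <= q -> t <= g r - eps -> d <= f (g r) - f t).
    { destruct (Rle_dec p (g r - eps)) as [Hq|Hq].
      - exists (f (g r) - f (g r - eps)). split.
        + generalize (Hinc (g r - eps) (g r)). lra.
        + intros t Ht Hrt. destruct (Req_dec t (g r - eps)) as [->|Hn]; [lra|].
          generalize (Hinc t (g r - eps)). lra.
      - exists 1. split; [lra|]. intros; lra. }
    destruct Hup as [d1 [Hd1 Hup]]. destruct Hdn as [d2 [Hd2 Hdn]].
    exists (Rmin d1 d2). split; [now apply Rmin_glb_lt|].
    intros r' Hr'. destruct (Hg r') as [H1' H2'].
    assert (Hrr : Rabs (cl r' - cl r) <= Rabs (r' - r)).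
    { unfold cl, Rmax, Rmin, Rabs. repeat destruct Rle_dec; repeat destruct Rcase_abs; lra. }
    generalize (Rmin_l d1 d2) (Rmin_r d1 d2). intros Hm1 Hm2.
    assert (Hlt : Rabs (cl r' - cl r) < Rmin d1 d2) by lra.
    apply Rabs_def2 in Hlt. rewrite <- H2, <- H2' in Hlt.
    apply Rabs_def1.
    - destruct (Rlt_le_dec (g r' - g r) eps) as [|Hle]; [easy|].
      generalize (Hup (g r') H1'). lra.
    - destruct (Rlt_le_dec (- eps) (g r' - g r)) as [|Hle]; [easy|].
      generalize (Hdn (g r') H1'). lra. }
  exists g. split; [intros r; apply Hg|].
  split; [apply Hgf; lra|]. split; [apply Hgf; lra|].
  split; [intros r Hr; destruct (Hg r) as [_ ->]; now apply Hclid|].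
  split; [easy|].
  intros r Hr. destruct (Hg r) as [H1 H2]. rewrite Hclid in H2 by lra.
  assert (Hgr : p < g r < q).
  { split.
    - destruct (Req_dec (g r) p) as [E|]; [rewrite E in H2; lra|lra].
    - destruct (Req_dec (g r) q) as [E|]; [rewrite E in H2; lra|lra]. }
  split; [easy|].
  assert (Prf : forall t, g (f p) <= t <= g (f q) -> derivable_pt f t).
  { intros t Ht. rewrite !Hgf in Ht by lra.
    exists (df t). apply is_derive_Reals. now apply Hd. }
  assert (Pin : g (f p) <= g r <= g (f q)) by (rewrite !Hgf by lra; lra).
  assert (E : derive_pt f (g r) (Prf (g r) Pin) = df (g r)).
  { apply derive_pt_eq_0, is_derive_Reals, Hd. lra. }
  assert (Hdp := Hdf (g r) Hgr).
  apply is_derive_Reals. replace (/ df (g r)) with (1 / derive_pt f (g r) (Prf (g r) Pin)).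
  - apply (derivable_pt_lim_recip_interv f g (f p) (f q) r Prf); try easy.
    + apply continuity_pt_filterlim, Hgc.
    + intros u Hu. unfold comp, id. destruct (Hg u) as [_ ->]. now apply Hclid.
    + rewrite E. lra.
  - rewrite E. field. lra.
Qed.

(* In the radius [s], with [y^3 = S^3 + 3 m / (4 pi K)] and [v = y'], a shell of
   Seth matter has [prad = pressure (y / s) v] and [rho = K y^2 v / s^2]. *)
Definition shell_ode (lambda mu K S M0 a b : R) (y v : R -> R) : Prop :=
  (forall s, a <= s <= b -> continuous y s /\ continuous v s) /\
  (forall s, a < s < b -> 0 < v s /\ is_derive y s (v s) /\
     is_derive v s (s * force lambda mu K S M0 s (y s / s) (v s) / ((lambda + 2 * mu) * v s))).

Theorem shell_ode_exists (lambda mu K S M0 a v0 : R) :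
  0 < lambda -> 0 < mu -> 0 < K -> 0 < M0 -> 0 < a -> a < S -> 0 <= v0 ->
  pressure lambda mu (S / a) v0 = 0 ->
  K * (S / a) ^ 2 * v0 * M0 < 2 * mu * ((S / a) ^ 2 - v0 ^ 2) * a ->
  exists b (y v : R -> R), a < b /\
    shell_ode lambda mu K S M0 a b y v /\
    (forall s, continuous y s /\ continuous v s) /\
    y a = S /\ v a = v0 /\ 0 < v b /\
    (forall s, a <= s <= b -> 0 <= v s < y s / s) /\
    (forall s, a < s < b -> 0 < pressure lambda mu (y s / s) (v s)) /\
    pressure lambda mu (y b / b) (v b) = 0.
Proof.
  intros Hl Hm HK HM Ha HaS Hv0 Hp0 Hsl.
  destruct (shell_flow lambda mu K S M0 a v0) as
    [beta [s [x [v [Hb [Es [Ex [Ev [HD [Hv [HP HPb]]]]]]]]]]]; try easy.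
  destruct (increasing_inverse s (fun t => v t / s t) 0 beta) as
    [g [Hg [Hg0 [Hgb [Hsg [Hgc Hgd]]]]]]; [easy| | |].
  { intros t Ht. apply HD, Ht. }
  { intros t Ht. destruct (HD t ltac:(lra)) as [_ [_ [_ H]]].
    apply Rdiv_lt_0_compat; [apply Hv|]; lra. }
  rewrite Es in *.
  assert (Hcx : forall r, continuous (fun r => x (g r)) r).
  { intros r. apply (continuous_comp g x); [apply Hgc|].
    destruct (HD (g r) (Hg r)) as [_ [D _]].
    apply (@ex_derive_continuous R_AbsRing R_NormedModule). eexists; exact D. }
  assert (Hcv : forall r, continuous (fun r => v (g r)) r).
  { intros r. apply (continuous_comp g v); [apply Hgc|].
    destruct (HD (g r) (Hg r)) as [_ [_ [D _]]].
    apply (@ex_derive_continuous R_AbsRing R_NormedModule). eexists; exact D. }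
  assert (Hcy : forall r, continuous (fun r => x (g r) * s (g r)) r).
  { intros r. apply (continuous_mult (fun r => x (g r)) (fun r => s (g r))); [apply Hcx|].
    apply (continuous_comp g s); [apply Hgc|].
    destruct (HD (g r) (Hg r)) as [D _].
    apply (@ex_derive_continuous R_AbsRing R_NormedModule). eexists; exact D. }
  assert (Hab : a < s beta).
  { destruct (MVT_open s (fun t => v t / s t) 0 beta Hb) as [c [Hc1 Hc2]].
    - intros t Ht. apply HD. lra.
    - intros t Ht. destruct (HD t Ht) as [D _]. exact (is_derive_continuity_pt _ _ _ D).
    - destruct (HD c ltac:(lra)) as [_ [_ [_ H]]].
      assert (0 < v c / s c * (beta - 0)).
      { apply Rmult_lt_0_compat; [|lra]. apply Rdiv_lt_0_compat; [apply Hv|]; lra. }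
      lra. }
  assert (Hx : forall r, a <= r <= s beta -> x (g r) * s (g r) / r = x (g r)).
  { intros r Hr. rewrite (Hsg r Hr). field. lra. }
  exists (s beta), (fun r => x (g r) * s (g r)), (fun r => v (g r)).
  split; [easy|]. split; [|split; [|split; [|split; [|split; [|split; [|split]]]]]].
  - split; [intros; split; [apply Hcy|apply Hcv]|].
    intros r Hr. destruct (Hgd r Hr) as [Hgr Dg].
    destruct (HD (g r) (Hg r)) as [Ds [Dx [Dv [H1 H2]]]].
    assert (Hvg : 0 < v (g r)) by (apply Hv; lra).
    split; [easy|]. split.
    + replace (v (g r)) with (scal (/ (v (g r) / s (g r)))
        (v (g r) * (v (g r) - x (g r)) / s (g r) ^ 2 * s (g r) + x (g r) * (v (g r) / s (g r)))).
      * apply (is_derive_comp (fun t => x t * s t) g); [|easy].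
        apply (@is_derive_mult R_AbsRing); [easy|easy|apply Rmult_comm].
      * unfold scal; simpl; unfold mult; simpl. field. lra.
    + rewrite Hx by lra.
      replace (r * _ / _) with (scal (/ (v (g r) / s (g r)))
        (force lambda mu K S M0 (s (g r)) (x (g r)) (v (g r)) / (lambda + 2 * mu))).
      * now apply (is_derive_comp v g).
      * unfold scal; simpl; unfold mult; simpl. rewrite (Hsg r) by lra. field. lra.
  - intros r. split; [apply Hcy|apply Hcv].
  - rewrite Hg0, Ex, Es. field. lra.
  - now rewrite Hg0.
  - rewrite Hgb. apply Hv. lra.
  - intros r Hr. rewrite Hx by lra. apply HD, Hg.
  - intros r Hr. rewrite Hx by lra. apply HP, Hgd, Hr.
  - rewrite Hx by lra. now rewrite Hgb.
Qed.

(** * Continuity rules and monotonicity from the derivative *)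

Lemma continuous_Rplus (f g : R -> R) (x : R) :
  continuous f x -> continuous g x -> continuous (fun t => f t + g t) x.
Proof. exact (@continuous_plus R_UniformSpace R_AbsRing R_NormedModule f g x). Qed.

Lemma continuous_Rminus (f g : R -> R) (x : R) :
  continuous f x -> continuous g x -> continuous (fun t => f t - g t) x.
Proof. exact (@continuous_minus R_UniformSpace R_AbsRing R_NormedModule f g x). Qed.

Lemma continuous_Rmult (f g : R -> R) (x : R) :
  continuous f x -> continuous g x -> continuous (fun t => f t * g t) x.
Proof. exact (continuous_mult f g x). Qed.

Lemma continuous_Rpow (f : R -> R) (n : nat) (x : R) :
  continuous f x -> continuous (fun t => f t ^ n) x.
Proof.
  intros Hf. induction n as [|n IH]; simpl.
  - apply continuous_const.
  - now apply continuous_Rmult.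
Qed.

Lemma continuous_Rdiv (f g : R -> R) (x : R) :
  continuous f x -> continuous g x -> g x <> 0 -> continuous (fun t => f t / g t) x.
Proof.
  intros Hf Hg H0. apply continuous_Rmult; [easy|]. now apply continuous_Rinv_comp.
Qed.

Lemma continuous_Rexp (f : R -> R) (x : R) :
  continuous f x -> continuous (fun t => exp (f t)) x.
Proof. intros Hf. apply (continuous_comp f exp); [easy|apply continuous_exp]. Qed.

Ltac cont :=
  lazymatch goal with
  | |- continuous (fun _ => ?c) _ => apply continuous_const
  | |- continuous (fun t => t) _ => apply continuous_id
  | |- continuous (fun t => @?f t + @?g t) _ => apply (continuous_Rplus f g); cont
  | |- continuous (fun t => @?f t - @?g t) _ => apply (continuous_Rminus f g); cont
  | |- continuous (fun t => @?f t * @?g t) _ => apply (continuous_Rmult f g); cont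
  | |- continuous (fun t => @?f t / @?g t) _ => apply (continuous_Rdiv f g); [cont|cont|]
  | |- continuous (fun t => @?f t ^ ?n) _ => apply (continuous_Rpow f n); cont
  | |- continuous (fun t => exp (@?f t)) _ => apply (continuous_Rexp f); cont
  | H : continuous ?f ?x |- continuous (fun t => ?f t) ?x => exact H
  | |- _ => idtac
  end.

Lemma continuous_bounded (f : R -> R) (a b : R) : a <= b ->
  (forall s, a <= s <= b -> continuous f s) ->
  exists M, 0 < M /\ forall s, a <= s <= b -> Rabs (f s) <= M.
Proof.
  intros Hab Hf.
  destruct (continuity_ab_maj (fun s => Rabs (f s)) a b Hab) as [m [Hm _]].
  - intros s Hs. apply (continuity_pt_comp f Rabs); [|apply Rcontinuity_abs].
    now apply continuity_pt_filterlim, Hf.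
  - exists (Rabs (f m) + 1). split; [generalize (Rabs_pos (f m)); lra|].
    intros s Hs. generalize (Hm s Hs). lra.
Qed.

Lemma nonpos_of_derive (f df : R -> R) (a b : R) : f a = 0 ->
  (forall s, a <= s <= b -> continuous f s) ->
  (forall s, a < s < b -> is_derive f s (df s) /\ df s <= 0) ->
  forall s, a <= s <= b -> f s <= 0.
Proof.
  intros Ha Hc Hd s Hs. destruct (Req_dec s a) as [->|Hn]; [lra|].
  destruct (MVT_open f df a s) as [r [Hr1 Hr2]]; [lra| | |].
  - intros u Hu. apply Hd. lra.
  - intros u Hu. apply continuity_pt_filterlim, Hc. lra.
  - assert (df r <= 0) by (apply Hd; lra). nra.
Qed.

(** * Uniqueness for the singular shell equation *)

Section Uniqueness.

Variables (lambda mu K S M0 a b : R) (y1 v1 y2 v2 : R -> R).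
Hypothesis Hlambda : 0 < lambda.
Hypothesis Hmu : 0 < mu.
Hypothesis HK : 0 < K.
Hypothesis HM0 : 0 <= M0.
Hypothesis HS : 0 < S.
Hypothesis Ha : 0 < a.
Hypothesis Hab : a < b.
Hypothesis Hode1 : shell_ode lambda mu K S M0 a b y1 v1.
Hypothesis Hode2 : shell_ode lambda mu K S M0 a b y2 v2.
Hypothesis Hy1 : y1 a = S.
Hypothesis Hy2 : y2 a = S.
Hypothesis Hv12 : v1 a = v2 a.
Hypothesis Hv1a : 0 <= v1 a.

Let kap := lambda + 2 * mu.
Let c := 4 * PI / 3 * K.
Let Hkap : 0 < kap. Proof. unfold kap. lra. Qed.
Let Hc : 0 < c. Proof. unfold c. generalize PI_RGT_0. nra. Qed.

Lemma shell_ode_ge (y v : R -> R) : shell_ode lambda mu K S M0 a b y v -> y a = S ->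
  forall s, a <= s <= b -> S <= y s.
Proof.
  intros [Hcont Hd] Hy s Hs.
  assert (H : S - y s <= 0); [|lra].
  apply (nonpos_of_derive (fun s => S - y s) (fun s => 0 - v s) a b); [lra| | |easy].
  - intros u Hu. destruct (Hcont u Hu). cont.
  - intros u Hu. destruct (Hd u Hu) as [H1 [H2 _]]. split; [|lra].
    apply (@is_derive_minus R_AbsRing R_NormedModule); [|easy].
    apply (@is_derive_const R_AbsRing R_NormedModule).
Qed.

Let mass (y : R) := M0 + c * (y ^ 3 - S ^ 3).
Let drag (s y : R) := 2 * lambda * y / s ^ 2 + K * y ^ 2 * mass y / s ^ 4.

(** The source term is independent of [v] and positive, which controls [1 / v]. The other two terms
    are dampings: in the difference of two solutions, multiplied by [v1^2 - v2^2], they contribute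
    with a nonpositive sign. *)
Let force_split (s y v : R) : s <> 0 ->
  s * force lambda mu K S M0 s (y / s) v =
  2 * (lambda + mu) * y ^ 2 / s ^ 3 - v * drag s y - 2 * mu / s * v ^ 2.
Proof. intros Hs. unfold force, drag, mass, c. field. lra. Qed.

(** Divided difference of [s * force] in [y] at [v = v1 s], written without the quotient so that it
    is continuous, hence bounded, on [[a, b]]. *)
Let slope (s : R) := 2 * (lambda + mu) * (y1 s + y2 s) / s ^ 3
  - v1 s * (2 * lambda / s ^ 2 + K / s ^ 4 *
      ((y1 s + y2 s) * mass (y1 s) + y2 s ^ 2 * c * (y1 s ^ 2 + y1 s * y2 s + y2 s ^ 2))).

Let force_diff (s : R) : s <> 0 ->
  s * force lambda mu K S M0 s (y1 s / s) (v1 s) - s * force lambda mu K S M0 s (y2 s / s) (v2 s)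
  = slope s * (y1 s - y2 s) - drag s (y2 s) * (v1 s - v2 s) - 2 * mu / s * (v1 s ^ 2 - v2 s ^ 2).
Proof. intros Hs. rewrite !force_split by easy. unfold slope, drag, mass. field. lra. Qed.

Let mass_nonneg (y : R) : S <= y -> 0 <= mass y.
Proof.
  intros H. unfold mass. assert (S ^ 3 <= y ^ 3) by (apply pow_incr; lra). nra.
Qed.

Let drag_nonneg (s y : R) : 0 < s -> S <= y -> 0 <= drag s y.
Proof.
  intros Hs Hy. generalize (mass_nonneg y Hy). intros Hm. unfold drag.
  assert (0 < s ^ 2) by (apply pow_lt; lra). assert (0 < s ^ 4) by (apply pow_lt; lra).
  assert (0 <= y ^ 2) by apply pow2_ge_0.
  apply Rplus_le_le_0_compat; apply Rmult_le_pos;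
    try (apply Rlt_le, Rinv_0_lt_compat; lra); repeat apply Rmult_le_pos; lra.
Qed.

Theorem shell_ode_unique (s : R) : a <= s <= b -> y1 s = y2 s /\ v1 s = v2 s.
Proof.
  assert (HcY : forall s, a <= s <= b ->
    continuous y1 s /\ continuous v1 s /\ continuous y2 s /\ continuous v2 s).
  { intros r Hr. generalize (proj1 Hode1 r Hr) (proj1 Hode2 r Hr). easy. }
  destruct (continuous_bounded slope a b) as [L [HL HLb]]; [lra| |].
  { intros r Hr. destruct (HcY r Hr) as [C1 [C2 [C3 C4]]].
    unfold slope, mass. cont; try (apply pow_nonzero; lra). }
  destruct (continuous_bounded (fun s => drag s (y1 s) + 2 * mu / s * v1 s) a b)
    as [beta [Hbeta Hbb]]; [lra| |].
  { intros r Hr. destruct (HcY r Hr) as [C1 [C2 [C3 C4]]].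
    unfold drag, mass. cont; try (apply pow_nonzero; lra). lra. }
  (* Lower bound of the source term of [force_split], from [y >= S] and [s <= b]. *)
  pose (alpha := 2 * (lambda + mu) * S ^ 2 / b ^ 3).
  assert (Halpha : 0 < alpha).
  { unfold alpha. apply Rdiv_lt_0_compat; [|apply pow_lt; lra].
    apply Rmult_lt_0_compat; [lra|apply pow_lt; lra]. }
  pose (Z := fun s => y1 s - y2 s).
  pose (D := fun s => v1 s ^ 2 - v2 s ^ 2).
  pose (E := fun s => Z s ^ 2 + D s ^ 2).
  (* Integrating factor for the growth rate [1 / v1 + 2 L / kap] of [E]. Since [kap v1' = f1 / v1],
     the function [(kap v1 + beta s) / alpha] grows at least as fast as a primitive of [1 / v1] and
     is continuous up to [a]. *)
  pose (w := fun s => exp ((0 - (kap * v1 s + beta * s)) / alpha - 2 * L / kap * s)).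
  pose (f1 := fun s => s * force lambda mu K S M0 s (y1 s / s) (v1 s)).
  pose (f2 := fun s => s * force lambda mu K S M0 s (y2 s / s) (v2 s)).
  assert (HEw : forall s, a <= s <= b -> E s * w s <= 0).
  { apply (nonpos_of_derive (fun s => E s * w s) (fun s => w s *
      (2 * Z s * (v1 s - v2 s) + 4 * D s * (f1 s - f2 s) / kap
       - E s * ((f1 s / v1 s + beta) / alpha + 2 * L / kap)))).
    - unfold E, Z, D. rewrite Hy1, Hy2, Hv12. ring.
    - intros r Hr. destruct (HcY r Hr) as [C1 [C2 [C3 C4]]].
      unfold E, Z, D, w. cont; lra.
    - intros r Hr.
      destruct (proj2 Hode1 r Hr) as [P1 [Dy1 Dv1]].
      destruct (proj2 Hode2 r Hr) as [P2 [Dy2 Dv2]].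
      fold kap in Dv1, Dv2. fold (f1 r) in Dv1. fold (f2 r) in Dv2.
      split.
      + unfold E, Z, D, w. auto_derive.
        { repeat split; try (eexists; eassumption). }
        replace (Derive (fun x => y1 x) r) with (v1 r) by (symmetry; now apply is_derive_unique).
        replace (Derive (fun x => y2 x) r) with (v2 r) by (symmetry; now apply is_derive_unique).
        replace (Derive (fun x => v1 x) r) with (f1 r / (kap * v1 r))
          by (symmetry; now apply is_derive_unique).
        replace (Derive (fun x => v2 x) r) with (f2 r / (kap * v2 r))
          by (symmetry; now apply is_derive_unique).
        set (W := exp _). clearbody W. field. lra.
      + assert (Hw : 0 < w r) by apply exp_pos.
        assert (Hr0 : r <> 0) by lra.
        assert (G1 := shell_ode_ge y1 v1 Hode1 Hy1 r ltac:(lra)).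
        assert (G2 := shell_ode_ge y2 v2 Hode2 Hy2 r ltac:(lra)).
        assert (HE0 : 0 <= E r) by (unfold E; nra).
        assert (HZD : 2 * Rabs (Z r * D r) <= E r).
        { unfold E. assert (0 <= (Z r - D r) ^ 2) by apply pow2_ge_0.
          assert (0 <= (Z r + D r) ^ 2) by apply pow2_ge_0.
          unfold Rabs. destruct Rcase_abs; lra. }
        assert (Hf : D r * (f1 r - f2 r) <= L * Rabs (Z r * D r)).
        { unfold f1, f2. rewrite force_diff by easy. fold (Z r). fold (D r).
          specialize (HLb r ltac:(lra)).
          assert (Hdr := drag_nonneg r (y2 r) ltac:(lra) G2).
          assert (0 <= D r * (v1 r - v2 r)).
          { unfold D. replace (_ * _) with ((v1 r - v2 r) ^ 2 * (v1 r + v2 r)) by ring.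
            apply Rmult_le_pos; [apply pow2_ge_0|lra]. }
          assert (0 <= drag r (y2 r) * (D r * (v1 r - v2 r))) by now apply Rmult_le_pos.
          assert (0 <= 2 * mu / r) by (apply Rlt_le, Rdiv_lt_0_compat; lra).
          assert (0 <= 2 * mu / r * D r ^ 2) by (apply Rmult_le_pos; [easy|apply pow2_ge_0]).
          assert (slope r * (Z r * D r) <= L * Rabs (Z r * D r)).
          { eapply Rle_trans; [apply Rle_abs|]. rewrite Rabs_mult.
            apply Rmult_le_compat_r; [apply Rabs_pos|easy]. }
          lra. }
        (* [1 / (v1 + v2)] is singular at [a] when [v1 a = 0]; [Hinv] absorbs it in the weight [w]. *)
        assert (Hv : Z r * (v1 r - v2 r) <= Rabs (Z r * D r) * / v1 r).
        { replace (Z r * (v1 r - v2 r)) with (Z r * D r * / (v1 r + v2 r))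
            by (unfold D; field; lra).
          assert (0 < / (v1 r + v2 r) <= / v1 r).
          { split; [apply Rinv_0_lt_compat; lra|apply Rinv_le_contravar; lra]. }
          apply Rle_trans with (Rabs (Z r * D r) * / (v1 r + v2 r)).
          - apply Rmult_le_compat_r; [lra|apply Rle_abs].
          - apply Rmult_le_compat_l; [apply Rabs_pos|lra]. }
        assert (Hinv : / v1 r <= (f1 r / v1 r + beta) / alpha).
        { apply Rmult_le_reg_r with (alpha * v1 r); [now apply Rmult_lt_0_compat|].
          replace (/ v1 r * (alpha * v1 r)) with alpha by (field; lra).
          replace (_ / alpha * _) with (f1 r + beta * v1 r) by (field; lra).
          unfold f1. rewrite force_split by easy.
          specialize (Hbb r ltac:(lra)). apply Rabs_le_between in Hbb.
          assert (alpha <= 2 * (lambda + mu) * y1 r ^ 2 / r ^ 3).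
          { unfold alpha. apply Rmult_le_compat.
            - apply Rmult_le_pos; [lra|apply pow2_ge_0].
            - apply Rlt_le, Rinv_0_lt_compat, pow_lt. lra.
            - apply Rmult_le_compat_l; [lra|]. apply pow_incr. lra.
            - apply Rinv_le_contravar; [apply pow_lt; lra|]. apply pow_incr. lra. }
          assert (v1 r * (drag r (y1 r) + 2 * mu / r * v1 r) <= v1 r * beta)
            by (apply Rmult_le_compat_l; lra).
          lra. }
        assert (Hgoal : 2 * Z r * (v1 r - v2 r) + 4 * D r * (f1 r - f2 r) / kap
          - E r * ((f1 r / v1 r + beta) / alpha + 2 * L / kap) <= 0).
        { assert (Hik : 0 < / kap) by now apply Rinv_0_lt_compat.
          assert (0 < / v1 r) by (apply Rinv_0_lt_compat; lra).
          assert (T1 : 2 * (Z r * (v1 r - v2 r)) <= E r * / v1 r).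
          { apply Rle_trans with (2 * Rabs (Z r * D r) * / v1 r); [lra|].
            apply Rmult_le_compat_r; lra. }
          assert (T2 : E r * / v1 r <= E r * ((f1 r / v1 r + beta) / alpha))
            by now apply Rmult_le_compat_l.
          assert (T3 : 4 * (D r * (f1 r - f2 r)) <= 2 * L * E r).
          { assert (L * (2 * Rabs (Z r * D r)) <= L * E r) by (apply Rmult_le_compat_l; lra). lra. }
          assert (T4 : 4 * (D r * (f1 r - f2 r)) * / kap <= 2 * L * E r * / kap)
            by (apply Rmult_le_compat_r; lra).
          unfold Rdiv in *. lra. }
        rewrite <- (Rmult_0_r (w r)). apply Rmult_le_compat_l; lra. }
  intros Hs. specialize (HEw s Hs).
  assert (Hw : 0 < w s) by apply exp_pos.
  assert (HE : E s <= 0) by nra.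
  (* Equality of [v1^2] and [v2^2] yields [v1 = v2] only with signs; at [b] the sign comes from
     continuity. *)
  assert (Hnn : forall v, v a = v1 a -> (forall r, a < r < b -> 0 < v r) -> continuous v b ->
    0 <= v s).
  { intros v Hva Hvp Hvc. destruct (Req_dec s a) as [->|]; [lra|].
    destruct (Req_dec s b) as [->|]; [|apply Rlt_le, Hvp; lra].
    apply Rnot_lt_le. intros Hneg.
    destruct (continuous_Rabs_spec v b Hvc (- v b) ltac:(lra)) as [d [Hd Hvd]].
    pose (r := b - Rmin (d / 2) ((b - a) / 2)).
    assert (Hm : 0 < Rmin (d / 2) ((b - a) / 2)) by (apply Rmin_glb_lt; lra).
    generalize (Rmin_l (d / 2) ((b - a) / 2)) (Rmin_r (d / 2) ((b - a) / 2)). intros.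
    specialize (Hvd r ltac:(unfold r; rewrite Rabs_left; lra)). apply Rabs_def2 in Hvd.
    generalize (Hvp r ltac:(unfold r; lra)). lra. }
  assert (N1 : 0 <= v1 s).
  { apply Hnn; [easy|intros; now apply Hode1|apply HcY; lra]. }
  assert (N2 : 0 <= v2 s).
  { apply Hnn; [easy|intros; now apply Hode2|apply HcY; lra]. }
  assert (HZ : Z s = 0) by (unfold E in HE; nra).
  assert (HD : D s = 0) by (unfold E in HE; nra).
  unfold Z, D in *. split; [lra|]. nra.
Qed.

End Uniqueness.

(** * Multi-body distributions *)

Lemma adherence_interval (D : R -> Prop) (p q s : R) : p < q ->
  (forall u, p < u < q -> D u) -> p <= s <= q -> adherence D s.
Proof.
  intros Hpq HD Hs V [d Hd].
  assert (Hd0 := cond_pos d).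
  assert (Hu : exists u, p < u < q /\ Rabs (u - s) < d).
  { destruct (Rlt_le_dec s q) as [H|H].
    - exists (s + Rmin (d / 2) ((q - s) / 2)).
      assert (0 < Rmin (d / 2) ((q - s) / 2)) by (apply Rmin_glb_lt; lra).
      generalize (Rmin_l (d / 2) ((q - s) / 2)) (Rmin_r (d / 2) ((q - s) / 2)).
      intros. split; [lra|]. rewrite Rabs_pos_eq; lra.
    - exists (s - Rmin (d / 2) ((q - p) / 2)).
      assert (0 < Rmin (d / 2) ((q - p) / 2)) by (apply Rmin_glb_lt; lra).
      generalize (Rmin_l (d / 2) ((q - p) / 2)) (Rmin_r (d / 2) ((q - p) / 2)).
      intros. split; [lra|]. rewrite Rabs_left; lra. }
  destruct Hu as [u [Hu1 Hu2]]. exists u. split; [now apply Hd|now apply HD].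
Qed.

Lemma not_adherence_gap (D : R -> Prop) (p q s : R) : p < s < q ->
  (forall u, p < u < q -> ~ D u) -> ~ adherence D s.
Proof.
  intros Hs HD H.
  assert (Hd : 0 < Rmin (s - p) (q - s)) by (apply Rmin_glb_lt; lra).
  destruct (H (fun u => p < u < q)) as [u [Hu1 Hu2]].
  - exists (mkposreal _ Hd). intros u Hu. unfold disc in Hu. simpl in Hu.
    generalize (Rmin_l (s - p) (q - s)) (Rmin_r (s - p) (q - s)). intros.
    apply Rabs_def2 in Hu. lra.
  - exact (HD u Hu1 Hu2).
Qed.

Lemma interior_elim (D : R -> Prop) (s : R) : interior D s -> D s.
Proof. intros [d Hd]. apply Hd. unfold disc. rewrite Rminus_diag, Rabs_R0. apply cond_pos. Qed.

Definition clamp (a b s : R) : R := Rmax a (Rmin b s).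

Lemma clamp_in (a b s : R) : a <= b -> a <= clamp a b s <= b.
Proof. intros. unfold clamp, Rmax, Rmin. repeat destruct Rle_dec; lra. Qed.

Lemma clamp_id (a b s : R) : a <= s <= b -> clamp a b s = s.
Proof. intros. unfold clamp, Rmax, Rmin. repeat destruct Rle_dec; lra. Qed.

Lemma continuous_clamp (a b s : R) : continuous (clamp a b) s.
Proof.
  apply continuous_of_Rabs. intros eps He. exists eps. split; [easy|].
  intros u Hu. eapply Rle_lt_trans; [|apply Hu].
  unfold clamp, Rmax, Rmin, Rabs. repeat destruct Rle_dec; repeat destruct Rcase_abs; lra.
Qed.

(** The fields may jump at the edge of a body. Composing with [clamp] turns relative continuity on
    the closed body into continuity on the line without changing the values there. *)
Lemma continuous_on_clamp (D : R -> Prop) (f : R -> R) (a b : R) : a <= b ->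
  continuous_on D f -> (forall s, a <= s <= b -> D s) ->
  forall s, continuous (fun u => f (clamp a b u)) s.
Proof.
  intros Hab Hf HD s.
  assert (Hcl : forall u, D (clamp a b u)) by (intros u; now apply HD, clamp_in).
  apply filterlim_comp with (2 := Hf (clamp a b s) (Hcl s)).
  intros P HP. unfold filtermap.
  pose proof (continuous_clamp a b s _ HP) as H. unfold filtermap in H.
  revert H. apply filter_imp. intros u Hu. now apply Hu.
Qed.

Lemma locally_interval (p q s : R) : p < s < q -> locally s (fun u => p < u < q).
Proof.
  intros Hs. apply filter_and; [apply (open_gt p)|apply (open_lt q)]; lra.
Qed.

Lemma eq_at_endpoints (f g : R -> R) (a b : R) : a < b ->
  (forall s, a <= s <= b -> continuous f s /\ continuous g s) ->
  (forall s, a < s < b -> f s = g s) -> forall s, a <= s <= b -> f s = g s.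
Proof.
  intros Hab Hc He s Hs.
  apply Rminus_diag_uniq. apply cond_eq. intros eps Heps. rewrite Rminus_0_r.
  destruct (Hc s Hs) as [Cf Cg].
  destruct (continuous_Rabs_spec _ s (continuous_Rminus f g s Cf Cg) eps Heps) as [d [Hd H]].
  destruct (adherence_interval (fun u => f u = g u) a b s Hab He Hs
    (fun u => Rabs (u - s) < d)) as [u [Hu1 Hu2]].
  - exists (mkposreal d Hd). now intros u Hu.
  - specialize (H u Hu1). rewrite Hu2, Rminus_diag in H.
    replace (0 - (f s - g s)) with (- (f s - g s)) in H by ring. now rewrite Rabs_Ropp in H.
Qed.

Section NBody.

Variables (n : nat) (r : nat -> R) (T : matter).
Hypothesis HT : is_nbody n r T.

Lemma nbody_radii_lt (i j : nat) : (i < j)%nat -> (j <= 2 * n - 1)%nat -> r i < r j.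
Proof.
  intros Hij Hj. induction Hij as [|j Hij IH].
  - generalize (nb_incr n r T HT i). rewrite Nat.add_1_r. intros H. apply H. lia.
  - apply Rlt_trans with (r j); [apply IH; lia|].
    generalize (nb_incr n r T HT j). rewrite Nat.add_1_r. intros H. apply H. lia.
Qed.

Lemma nbody_radii_le (i j : nat) : (i <= j)%nat -> (j <= 2 * n - 1)%nat -> r i <= r j.
Proof.
  intros Hij Hj. destruct (Nat.eq_dec i j) as [->|]; [lra|].
  apply Rlt_le, nbody_radii_lt; lia.
Qed.

Lemma nbody_radii_ge0 (i : nat) : (i <= 2 * n - 1)%nat -> 0 <= r i.
Proof.
  intros Hi. generalize (nb_r0 n r T HT) (nbody_radii_le 0 i ltac:(lia) Hi). lra.
Qed.

Lemma nbody_body (k : nat) (s : R) : (k < n)%nat ->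
  r (2 * k)%nat < s < r (2 * k + 1)%nat -> Omega T s.
Proof.
  intros Hk Hs. apply (nb_Omega n r T HT). exists (k + 1)%nat. split; [lia|].
  replace (2 * (k + 1) - 2)%nat with (2 * k)%nat by lia.
  now replace (2 * (k + 1) - 1)%nat with (2 * k + 1)%nat by lia.
Qed.

Lemma nbody_body_closure (k : nat) (s : R) : (k < n)%nat ->
  r (2 * k)%nat <= s <= r (2 * k + 1)%nat -> adherence (Omega T) s.
Proof.
  intros Hk. apply adherence_interval; [apply nbody_radii_lt; lia|].
  intros u. now apply nbody_body.
Qed.

(** This is the gap between bodies [i] and [i + 1]. The bounds are conditional because [i = 0] is
    the region before the first body and [i = n] the one beyond the last. *)
Lemma nbody_gap (i : nat) (u : R) : (i <= n)%nat ->
  ((1 <= i)%nat -> r (2 * i - 1)%nat < u) -> ((i < n)%nat -> u < r (2 * i)%nat) -> ~ Omega T u.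
Proof.
  intros Hi H1 H2 HO. apply (nb_Omega n r T HT) in HO.
  destruct HO as [j [Hj Hu]].
  destruct (le_lt_dec j i) as [Hji|Hji].
  - generalize (nbody_radii_le (2 * j - 1) (2 * i - 1) ltac:(lia) ltac:(lia)) (H1 ltac:(lia)). lra.
  - generalize (nbody_radii_le (2 * i) (2 * j - 2) ltac:(lia) ltac:(lia)) (H2 ltac:(lia)). lra.
Qed.

Lemma nbody_vacuum_outside (s : R) : r (2 * n - 1)%nat < s ->
  ~ adherence (Omega T) s /\ rho T s = 0 /\ prad T s = 0 /\ ptan T s = 0.
Proof.
  intros Hs. assert (Hn := nb_pos n r T HT).
  assert (Ha : ~ adherence (Omega T) s).
  { apply (not_adherence_gap _ (r (2 * n - 1)%nat) (s + 1)); [lra|].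
    intros u Hu. apply (nbody_gap n); [lia|easy|lia]. }
  split; [easy|]. apply (nb_vacuum n r T HT); [|easy].
  generalize (nbody_radii_ge0 (2 * n - 1) ltac:(lia)). lra.
Qed.

Lemma nbody_rho_pos (s : R) : Omega T s -> 0 < rho T s.
Proof. intros H. now apply interior_elim in H. Qed.

Let f (t : R) := rho T t * t ^ 2.

Lemma nbody_ex_RInt_body (k : nat) (p q : R) : (k < n)%nat ->
  r (2 * k)%nat <= p -> p <= q -> q <= r (2 * k + 1)%nat -> ex_RInt f p q.
Proof.
  intros Hk Hp Hpq Hq.
  apply ex_RInt_ext with (fun t => rho T (clamp (r (2 * k)%nat) (r (2 * k + 1)%nat) t) * t ^ 2).
  - intros t. rewrite Rmin_left, Rmax_right by easy. intros Ht.
    now rewrite clamp_id by lra.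
  - apply (@ex_RInt_continuous R_CompleteNormedModule). intros z _.
    apply continuous_Rmult; [|apply continuous_Rpow, continuous_id].
    apply (continuous_on_clamp (adherence (Omega T))); [lra|apply (nb_C0 n r T HT)|].
    intros s. now apply nbody_body_closure.
Qed.

Lemma nbody_RInt_vacuum (p q : R) : p <= q ->
  (forall s, p < s < q -> rho T s = 0) -> ex_RInt f p q /\ RInt f p q = 0.
Proof.
  intros Hpq H0.
  assert (He : forall t, Rmin p q < t < Rmax p q -> 0 = f t).
  { intros t. rewrite Rmin_left, Rmax_right by easy. intros Ht. unfold f. rewrite H0 by easy. ring. }
  split.
  - apply ex_RInt_ext with (fun _ => 0); [easy|apply ex_RInt_const].
  - rewrite <- (RInt_ext (fun _ => 0)) by easy. rewrite RInt_const. unfold scal; simpl.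
    unfold mult; simpl. ring.
Qed.

Let f_nonneg (p q : R) : 0 <= p -> p <= q -> ex_RInt f p q -> 0 <= RInt f p q.
Proof.
  intros Hp Hpq He. apply RInt_ge_0; [easy|easy|].
  intros t Ht. apply Rmult_le_pos; [apply (nb_rho_ge0 n r T HT); lra|apply pow2_ge_0].
Qed.

(** Splitting the mass integral requires integrability, obtained radius by radius because of the
    jumps of [rho]: an even [i] starts a body, an odd [i] a vacuum gap. *)
Lemma nbody_ex_RInt_step (i : nat) : (i + 1 <= 2 * n - 1)%nat -> ex_RInt f (r i) (r (i + 1)%nat).
Proof.
  intros Hi. assert (Hlt := nbody_radii_lt i (i + 1) ltac:(lia) Hi).
  destruct (Nat.Even_or_Odd i) as [[k Hk]|[k Hk]]; subst i.
  - apply (nbody_ex_RInt_body k); lra || lia.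
  - apply nbody_RInt_vacuum; [lra|]. intros s Hs.
    apply (nb_vacuum n r T HT).
    + generalize (nbody_radii_ge0 (2 * k + 1) ltac:(lia)). lra.
    + apply (not_adherence_gap _ (r (2 * k + 1)%nat) (r (2 * k + 1 + 1)%nat)); [easy|].
      intros u Hu. apply (nbody_gap (k + 1)); [lia| |]; intros _.
      * replace (2 * (k + 1) - 1)%nat with (2 * k + 1)%nat by lia. apply Hu.
      * replace (2 * (k + 1))%nat with (2 * k + 1 + 1)%nat by lia. apply Hu.
Qed.

Lemma nbody_ex_RInt_r0 : ex_RInt f 0 (r 0%nat).
Proof.
  assert (Hn := nb_pos n r T HT).
  apply nbody_RInt_vacuum; [apply (nb_r0 n r T HT)|]. intros s Hs.
  apply (nb_vacuum n r T HT); [lra|].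
  apply (not_adherence_gap _ 0 (r 0%nat)); [easy|].
  intros u Hu. apply (nbody_gap 0); [lia|lia|intros _; apply Hu].
Qed.

Lemma nbody_ex_RInt (i : nat) : (i <= 2 * n - 1)%nat -> ex_RInt f 0 (r i).
Proof.
  induction i as [|i IH]; intros Hi; [apply nbody_ex_RInt_r0|].
  apply ex_RInt_Chasles with (r i); [apply IH; lia|].
  rewrite <- Nat.add_1_r. apply nbody_ex_RInt_step. lia.
Qed.

(** The first body alone contributes a positive amount, and the later pieces are nonnegative. *)
Lemma nbody_RInt_pos (i : nat) : (1 <= i <= 2 * n - 1)%nat -> 0 < RInt f 0 (r i).
Proof.
  intros [Hi1 Hi2]. induction Hi1 as [|i Hi1 IH].
  - rewrite <- (RInt_Chasles f 0 (r 0%nat)); [|apply nbody_ex_RInt_r0|apply (nbody_ex_RInt_step 0); lia].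
    apply Rplus_le_lt_0_compat.
    + apply f_nonneg; [lra|apply (nb_r0 n r T HT)|apply nbody_ex_RInt_r0].
    + assert (Hlt := nbody_radii_lt 0 1 ltac:(lia) Hi2).
      assert (H0 := nb_r0 n r T HT).
      rewrite (RInt_ext _ (fun t => rho T (clamp (r 0%nat) (r 1%nat) t) * t ^ 2)).
      * apply RInt_gt_0; [easy| |].
        -- intros t Ht. rewrite clamp_id by lra.
           apply Rmult_lt_0_compat; [|apply pow_lt; lra].
           apply nbody_rho_pos, (nbody_body 0); [lia|easy].
        -- intros t _. apply continuous_Rmult; [|apply continuous_Rpow, continuous_id].
           apply (continuous_on_clamp (adherence (Omega T))); [lra|apply (nb_C0 n r T HT)|].
           intros s. apply (nbody_body_closure 0). lia.
      * intros t. rewrite Rmin_left, Rmax_right by lra. intros Ht.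
        now rewrite clamp_id by lra.
  - assert (Hs := nbody_ex_RInt_step i ltac:(lia)). rewrite Nat.add_1_r in Hs.
    rewrite <- (RInt_Chasles f 0 (r i)); [|apply nbody_ex_RInt; lia|easy].
    apply Rplus_lt_le_0_compat; [apply IH; lia|].
    apply f_nonneg; [apply nbody_radii_ge0; lia|apply nbody_radii_le; lia|easy].
Qed.

Lemma nbody_mass_pos (i : nat) : (1 <= i <= 2 * n - 1)%nat -> 0 < shell_mass 0 T (r i).
Proof.
  intros Hi. apply Rmult_lt_0_compat; [generalize PI_RGT_0; lra|].
  now apply nbody_RInt_pos.
Qed.

Lemma nbody_mass_outside (s : R) : r (2 * n - 1)%nat < s ->
  ex_RInt f 0 s /\ shell_mass 0 T s = shell_mass 0 T (r (2 * n - 1)%nat).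
Proof.
  intros Hs. assert (Hn := nb_pos n r T HT).
  destruct (nbody_RInt_vacuum (r (2 * n - 1)%nat) s) as [He H0]; [lra| |].
  { intros u Hu. now apply nbody_vacuum_outside. }
  assert (He' := nbody_ex_RInt (2 * n - 1) ltac:(lia)).
  split; [now apply ex_RInt_Chasles with (r (2 * n - 1)%nat)|].
  unfold shell_mass. change (fun t => rho T t * t ^ 2) with f.
  rewrite <- (RInt_Chasles f 0 (r (2 * n - 1)%nat) s) by easy.
  rewrite H0. apply f_equal, Rplus_0_r.
Qed.

End NBody.

(** * From a Seth shell to its equation, and back *)

Lemma Rpower_cube (x : R) : 0 < x ->
  Rpower (x ^ 3) (1 / 3) = x /\ Rpower (x ^ 3) (2 / 3) = x ^ 2 /\
  Rpower (x ^ 3) (- (4 / 3)) = / x ^ 4.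
Proof.
  intros Hx. rewrite <- (Rpower_pow 3 x Hx), !Rpower_mult. split; [|split].
  - replace (INR 3 * (1 / 3)) with 1 by (simpl; field). now apply Rpower_1.
  - replace (INR 3 * (2 / 3)) with (INR 2) by (simpl; field). now apply Rpower_pow.
  - replace (INR 3 * - (4 / 3)) with (- INR 4) by (simpl; field).
    now rewrite Rpower_Ropp, Rpower_pow.
Qed.

Definition tan_pressure (lambda mu x v : R) : R :=
  (lambda + mu) * x ^ 2 + lambda / 2 * v ^ 2 - (3 * lambda + 2 * mu) / 2.

(* [delta = y^2 v / s^2] and [eta = (y / s)^3] *)
Lemma seth_pressures (lambda mu s y v : R) : 0 < s -> 0 < y ->
  seth_prad lambda mu (y ^ 2 * v / s ^ 2) ((y / s) ^ 3) = pressure lambda mu (y / s) v /\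
  seth_ptan lambda mu (y ^ 2 * v / s ^ 2) ((y / s) ^ 3) = tan_pressure lambda mu (y / s) v.
Proof.
  intros Hs Hy.
  destruct (Rpower_cube (y / s)) as [_ [E1 E2]]; [now apply Rdiv_lt_0_compat|].
  unfold seth_prad, seth_ptan, pressure, tan_pressure, seth_p0. rewrite E1, E2.
  split; field; lra.
Qed.

Lemma tan_pressure_eq (lambda mu x v : R) : 0 < lambda -> 0 < mu ->
  tan_pressure lambda mu x v = lambda / (lambda + 2 * mu) * pressure lambda mu x v
    + mu * (3 * lambda + 2 * mu) / (lambda + 2 * mu) * (x ^ 2 - 1).
Proof. intros. unfold tan_pressure, pressure. field. lra. Qed.

Lemma Rpower_cube_root (x : R) : 0 < x -> Rpower x (1 / 3) ^ 3 = x.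
Proof.
  intros Hx. rewrite <- Rpower_pow by apply exp_pos. rewrite Rpower_mult.
  replace (1 / 3 * INR 3) with 1 by (simpl; field). now apply Rpower_1.
Qed.

(* The enclosed mass is [M0 + (4 PI K / 3) (y^3 - S^3)]; solved for [v'], the
   equilibrium equation is then the second equation of [shell_ode]. *)
Lemma shell_ode_equilibrium (lambda mu K S M0 s : R) (y v : R -> R) (l : R) :
  0 < lambda -> 0 < mu -> 0 < K -> 0 < s -> 0 < v s ->
  is_derive y s (v s) -> is_derive v s l ->
  is_derive (fun u => pressure lambda mu (y u / u) (v u)) s
    (2 * lambda * (y s / s) * ((v s - y s / s) / s) + (lambda + 2 * mu) * v s * l) /\
  (2 * lambda * (y s / s) * ((v s - y s / s) / s) + (lambda + 2 * mu) * v s * l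
   + 2 / s * (pressure lambda mu (y s / s) (v s) - tan_pressure lambda mu (y s / s) (v s))
   + K * (y s ^ 2 * v s / s ^ 2)
     * ((M0 + 4 * PI * ((y s ^ 3 - S ^ 3) * K / 3)) / s ^ 2) = 0 <->
   l = s * force lambda mu K S M0 s (y s / s) (v s) / ((lambda + 2 * mu) * v s)).
Proof.
  intros Hl Hm HK Hs Hv Dy Dv. split.
  - unfold pressure. auto_derive.
    + repeat split; try (eexists; eassumption); lra.
    + replace (Derive (fun x => y x) s) with (v s) by (symmetry; now apply is_derive_unique).
      replace (Derive (fun x => v x) s) with l by (symmetry; now apply is_derive_unique).
      field. lra.
  - assert (E : forall l, 2 * lambda * (y s / s) * ((v s - y s / s) / s)
      + (lambda + 2 * mu) * v s * l
      + 2 / s * (pressure lambda mu (y s / s) (v s) - tan_pressure lambda mu (y s / s) (v s))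
      + K * (y s ^ 2 * v s / s ^ 2)
        * ((M0 + 4 * PI * ((y s ^ 3 - S ^ 3) * K / 3)) / s ^ 2)
      = (lambda + 2 * mu) * v s *
        (l - s * force lambda mu K S M0 s (y s / s) (v s) / ((lambda + 2 * mu) * v s))).
    { intros k. unfold pressure, tan_pressure, force. field. lra. }
    rewrite E. split.
    + intros H. apply Rminus_diag_uniq.
      apply Rmult_integral in H. destruct H as [H|H]; [|easy].
      assert (0 < (lambda + 2 * mu) * v s) by (apply Rmult_lt_0_compat; lra). lra.
    + intros ->. rewrite Rminus_diag. ring.
Qed.

Section SethShell.

Variables (n : nat) (r : nat -> R) (U : matter) (lambda mu K S : R).
Hypothesis HU : is_nbody n r U.
Hypothesis Hlambda : 0 < lambda.
Hypothesis Hmu : 0 < mu.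
Hypothesis HK : 0 < K.
Hypothesis HS : 0 < S.

Let a := r (2 * n - 2)%nat.
Let b := r (2 * n - 1)%nat.

Hypothesis Hseth : is_seth_shell lambda mu K S a b U.

Let Hn : (1 <= n)%nat. Proof. exact (nb_pos n r U HU). Qed.

Let Hab : a < b.
Proof. apply (nbody_radii_lt n r U HU); lia. Qed.

Let Ha : 0 < a. Proof. apply Hseth. Qed.

Let Omega_ab (s : R) : a < s < b -> Omega U s.
Proof.
  intros Hs. apply (nbody_body n r U HU (n - 1)); [lia|].
  replace (2 * (n - 1))%nat with (2 * n - 2)%nat by lia.
  now replace (2 * n - 2 + 1)%nat with (2 * n - 1)%nat by lia.
Qed.

Lemma outer_field_continuous (g : R -> R) (s : R) :
  continuous_on (adherence (Omega U)) g -> continuous (fun u => g (clamp a b u)) s.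
Proof.
  intros Hg. apply (continuous_on_clamp (adherence (Omega U))); [lra|easy|].
  intros u. now apply adherence_interval.
Qed.

(** The density of the shell continued by constants, so that the integral [I] is differentiable at
    [a] and [b] as well, whatever the jumps of [rho U]. *)
Let rc (s : R) := rho U (clamp a b s).

Let rc_continuous (s : R) : continuous rc s.
Proof. apply outer_field_continuous, (nb_C0 n r U HU). Qed.

Let rc_nonneg (s : R) : 0 <= rc s.
Proof.
  apply (nb_rho_ge0 n r U HU). generalize (clamp_in a b s ltac:(lra)). lra.
Qed.

Let I (s : R) : R := RInt (fun t => rc t * t ^ 2) a s.

Let rc_integrand_continuous (s : R) : continuous (fun t => rc t * t ^ 2) s.
Proof. apply continuous_Rmult; [apply rc_continuous|apply continuous_Rpow, continuous_id]. Qed.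

Let ex_RInt_rc (p q : R) : ex_RInt (fun t => rc t * t ^ 2) p q.
Proof.
  apply (@ex_RInt_continuous R_CompleteNormedModule). intros; apply rc_integrand_continuous.
Qed.

Let I_derive (s : R) : is_derive I s (rc s * s ^ 2).
Proof.
  apply (@is_derive_RInt R_NormedModule (fun t => rc t * t ^ 2) I a).
  - apply filter_forall. intros u. apply (@RInt_correct R_CompleteNormedModule), ex_RInt_rc.
  - apply rc_integrand_continuous.
Qed.

Let I_nonneg (s : R) : a <= s -> 0 <= I s.
Proof.
  intros Hs. apply RInt_ge_0; [easy|apply ex_RInt_rc|].
  intros t _. apply Rmult_le_pos; [apply rc_nonneg|apply pow2_ge_0].
Qed.

Let local_mass (s : R) : a <= s <= b -> shell_mass a U s = 4 * PI * I s.
Proof.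
  intros Hs. unfold shell_mass, I. f_equal. apply RInt_ext.
  intros t. rewrite Rmin_left, Rmax_right by lra. intros Ht. unfold rc.
  now rewrite clamp_id by lra.
Qed.

Let total_mass (s : R) : a <= s <= b -> shell_mass 0 U s = shell_mass 0 U a + 4 * PI * I s.
Proof.
  intros Hs. rewrite <- local_mass by easy. unfold shell_mass.
  rewrite <- Rmult_plus_distr_l. f_equal. symmetry.
  apply (RInt_Chasles (fun t => rho U t * t ^ 2)).
  - apply (nbody_ex_RInt n r U HU (2 * n - 2)). lia.
  - apply ex_RInt_ext with (fun t => rc t * t ^ 2); [|apply ex_RInt_rc].
    intros t. rewrite Rmin_left, Rmax_right by lra. intros Ht. unfold rc.
    now rewrite clamp_id by lra.
Qed.

(** Differentiating [y^3] gives [K y^2 y' = rc s^2]; the next definition is this relation solved for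
    [y']. *)
Let y (s : R) := Rpower (S ^ 3 + 3 / K * I s) (1 / 3).
Let v (s : R) := rc s * s ^ 2 / (K * y s ^ 2).

Let HS3 : 0 < S ^ 3. Proof. now apply pow_lt. Qed.

Let base_pos (s : R) : a <= s -> 0 < S ^ 3 + 3 / K * I s.
Proof.
  intros Hs. assert (0 <= 3 / K * I s).
  { apply Rmult_le_pos; [apply Rlt_le, Rdiv_lt_0_compat; lra|now apply I_nonneg]. }
  lra.
Qed.

Let y_pos (s : R) : 0 < y s. Proof. apply exp_pos. Qed.

Let y_cube (s : R) : a <= s -> y s ^ 3 = S ^ 3 + 3 / K * I s.
Proof. intros Hs. now apply Rpower_cube_root, base_pos. Qed.

Let y_derive (s : R) : a <= s -> is_derive y s (v s).
Proof.
  intros Hs. assert (Hb := base_pos s Hs). assert (Hy3 := y_cube s Hs).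
  unfold y, Rpower. auto_derive.
  - split; [eexists; apply I_derive|easy].
  - replace (Derive (fun x => I x) s) with (rc s * s ^ 2)
      by (symmetry; now apply is_derive_unique).
    unfold v. change (S * (S * (S * 1)) + 3 / K * I s) with (S ^ 3 + 3 / K * I s).
    change (exp (1 / 3 * ln (S ^ 3 + 3 / K * I s))) with (y s).
    rewrite <- Hy3.
    generalize (y_pos s). intros. field. lra.
Qed.

Let v_nonneg (s : R) : a <= s -> 0 <= v s.
Proof.
  intros Hs. generalize (y_pos s) (rc_nonneg s). intros Hy Hr. unfold v.
  apply Rmult_le_pos; [apply Rmult_le_pos; [easy|apply pow2_ge_0]|].
  apply Rlt_le, Rinv_0_lt_compat, Rmult_lt_0_compat; [easy|now apply pow_lt].
Qed.

Let rho_eq (s : R) : a <= s <= b -> rho U s = K * (y s ^ 2 * v s / s ^ 2).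
Proof.
  intros Hs. generalize (y_pos s). intros Hy. unfold v, rc. rewrite clamp_id by easy.
  field. lra.
Qed.

Let y_continuous (s : R) : a <= s -> continuous y s.
Proof.
  intros Hs. apply (@ex_derive_continuous R_AbsRing R_NormedModule).
  exists (v s). now apply y_derive.
Qed.

Let v_continuous (s : R) : a <= s -> continuous v s.
Proof.
  intros Hs. generalize (y_pos s) (y_continuous s Hs) (rc_continuous s). intros Hy Cy Cr.
  unfold v. cont. apply Rgt_not_eq, Rmult_lt_0_compat; [easy|now apply pow_lt].
Qed.

Let pressures_interior (s : R) : a < s < b ->
  prad U s = pressure lambda mu (y s / s) (v s) /\
  ptan U s = tan_pressure lambda mu (y s / s) (v s).
Proof.
  intros Hs. destruct (proj2 Hseth s Hs) as [H1 H2].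
  replace (rho U s / K) with (y s ^ 2 * v s / s ^ 2) in H1, H2
    by (rewrite rho_eq by lra; field; lra).
  replace (_ + _) with ((y s / s) ^ 3) in H1, H2.
  - rewrite H1, H2. apply seth_pressures; [lra|apply y_pos].
  - rewrite local_mass by lra.
    replace ((y s / s) ^ 3) with (y s ^ 3 / s ^ 3) by (field; lra).
    rewrite y_cube by lra. generalize PI_RGT_0. intros. field. lra.
Qed.

(** Seth's law is imposed only inside the shell, whereas the boundary conditions are at its
    endpoints; both sides extend continuously. *)
Let pressures_closed (s : R) : a <= s <= b ->
  prad U s = pressure lambda mu (y s / s) (v s) /\
  ptan U s = tan_pressure lambda mu (y s / s) (v s).
Proof.
  intros Hs. destruct (nb_C0 n r U HU) as [_ [C1 C2]].
  assert (Hc : forall u, a <= u <= b -> continuous y u /\ continuous v u).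
  { intros u Hu. split; [apply y_continuous|apply v_continuous]; lra. }
  split.
  - transitivity (prad U (clamp a b s)); [now rewrite clamp_id|].
    apply (eq_at_endpoints (fun u => prad U (clamp a b u))
      (fun u => pressure lambda mu (y u / u) (v u)) a b Hab); [| |easy].
    + intros u Hu. split; [now apply outer_field_continuous|].
      destruct (Hc u Hu). unfold pressure. cont. lra.
    + intros u Hu. rewrite clamp_id by lra. now apply pressures_interior.
  - transitivity (ptan U (clamp a b s)); [now rewrite clamp_id|].
    apply (eq_at_endpoints (fun u => ptan U (clamp a b u))
      (fun u => tan_pressure lambda mu (y u / u) (v u)) a b Hab); [| |easy].
    + intros u Hu. split; [now apply outer_field_continuous|].
      destruct (Hc u Hu). unfold tan_pressure. cont. lra.
    + intros u Hu. rewrite clamp_id by lra. now apply pressures_interior.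
Qed.

Let v_ex_derive (s : R) : a < s < b -> ex_derive v s.
Proof.
  intros Hs. destruct (proj1 (nb_C1 n r U HU) s (Omega_ab s Hs)) as [Dr _].
  apply ex_derive_ext_loc with (fun u => rho U u * u ^ 2 / (K * y u ^ 2)).
  - generalize (locally_interval a b s Hs). apply filter_imp. intros u Hu.
    unfold v, rc. now rewrite clamp_id by lra.
  - assert (Dy := y_derive s ltac:(lra)). generalize (y_pos s). intros Hy.
    auto_derive. repeat split; try easy; [now exists (v s)|].
    apply Rgt_not_eq. repeat apply Rmult_lt_0_compat; lra.
Qed.

Theorem seth_shell_ode : exists y v : R -> R,
  shell_ode lambda mu K S (shell_mass 0 U a) a b y v /\ y a = S /\
  forall s, a <= s <= b -> 0 <= v s /\
    rho U s = K * (y s ^ 2 * v s / s ^ 2) /\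
    prad U s = pressure lambda mu (y s / s) (v s) /\
    ptan U s = tan_pressure lambda mu (y s / s) (v s).
Proof.
  exists y, v. split; [split|split].
  - intros s Hs. split; [apply y_continuous|apply v_continuous]; lra.
  - intros s Hs. generalize (y_pos s). intros Hy.
    assert (Hv : 0 < v s).
    { unfold v. apply Rdiv_lt_0_compat.
      - apply Rmult_lt_0_compat; [|apply pow_lt; lra].
        unfold rc. rewrite clamp_id by lra. now apply (nbody_rho_pos U), Omega_ab.
      - apply Rmult_lt_0_compat; [easy|now apply pow_lt]. }
    assert (Dy := y_derive s ltac:(lra)).
    split; [easy|]. split; [easy|].
    destruct (v_ex_derive s Hs) as [l Dv].
    destruct (shell_ode_equilibrium lambda mu K S (shell_mass 0 U a) s y v l)
      as [DP HP]; try easy; [lra|].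
    rewrite <- (proj1 HP); [easy|].
    assert (Heq := nb_equilibrium n r U HU s (Omega_ab s Hs)).
    rewrite total_mass in Heq by lra.
    destruct (pressures_closed s ltac:(lra)) as [E1 E2].
    rewrite E1, E2, rho_eq in Heq by lra.
    replace (Derive (prad U) s) with
      (2 * lambda * (y s / s) * ((v s - y s / s) / s) + (lambda + 2 * mu) * v s * l) in Heq.
    + replace ((y s ^ 3 - S ^ 3) * K / 3) with (I s); [easy|].
      rewrite y_cube by lra. field. lra.
    + symmetry. apply is_derive_unique.
      apply is_derive_ext_loc with (2 := DP).
      generalize (locally_interval a b s Hs). apply filter_imp. intros u Hu.
      symmetry. apply pressures_closed. lra.
  - unfold y, I. rewrite RInt_point. unfold zero; simpl. rewrite Rmult_0_r, Rplus_0_r.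
    now apply Rpower_cube.
  - intros s Hs. split; [apply v_nonneg; lra|]. split; [now apply rho_eq|].
    now apply pressures_closed.
Qed.

End SethShell.

(** * Gluing a shell solution to an inner distribution *)

Lemma interior_locally (D : R -> Prop) (s : R) : interior D s <-> locally s D.
Proof. split; intros [d Hd]; exists d; intros u Hu; now apply Hd. Qed.

Lemma C1_on_ext (D : R -> Prop) (f g : R -> R) :
  (forall s, D s -> locally s (fun u => f u = g u)) -> C1_on D g -> C1_on D f.
Proof.
  intros Hfg Hg s Hs. destruct (Hg s Hs) as [H1 H2]. specialize (Hfg s Hs). split.
  - apply ex_derive_ext_loc with (2 := H1). revert Hfg. apply filter_imp. now intros.
  - apply continuous_ext_loc with (2 := H2).
    generalize (locally_locally s _ Hfg). apply filter_imp.
    intros u Hu. symmetry. now apply Derive_ext_loc.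
Qed.

Lemma C1_on_interval (a b : R) (f df : R -> R) :
  (forall s, a < s < b -> is_derive f s (df s) /\ continuous df s) ->
  C1_on (fun s => a < s < b) f.
Proof.
  intros H s Hs. split; [exists (df s); now apply H|].
  apply continuous_ext_loc with df; [|now apply H].
  generalize (locally_interval a b s Hs). apply filter_imp.
  intros u Hu. symmetry. now apply is_derive_unique, H.
Qed.

Lemma C1_on_or (D E : R -> Prop) (f : R -> R) :
  C1_on D f -> C1_on E f -> C1_on (fun s => D s \/ E s) f.
Proof. intros H1 H2 s [Hs|Hs]; [now apply H1|now apply H2]. Qed.

(** Both endpoints keep the value of [f], as continuity on the closure of the body demands; the
    density may jump to 0 just outside. *)
Definition truncate (a b : R) (f : R -> R) (s : R) : R :=
  if Rle_dec a s then if Rle_dec s b then f s else 0 else 0.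

Lemma truncate_in (a b : R) (f : R -> R) (s : R) : a <= s <= b -> truncate a b f s = f s.
Proof. intros. unfold truncate. repeat destruct Rle_dec; lra. Qed.

Lemma truncate_out (a b : R) (f : R -> R) (s : R) : ~ (a <= s <= b) -> truncate a b f s = 0.
Proof. intros. unfold truncate. repeat destruct Rle_dec; lra. Qed.

(** Replacing [v] by the larger [x] shows that the pressure is below
    [(3 lambda + 2 mu) / 2 * (x^2 - 1)]. *)
Lemma pressure_nonneg_gt_1 (lambda mu x v : R) : 0 < lambda -> 0 < mu -> 0 <= v < x ->
  0 <= pressure lambda mu x v -> 1 < x.
Proof.
  intros Hl Hm Hv HP. unfold pressure in HP.
  assert (v ^ 2 < x ^ 2) by nra.
  assert ((lambda + 2 * mu) * v ^ 2 < (lambda + 2 * mu) * x ^ 2) by (apply Rmult_lt_compat_l; lra).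
  assert (0 < (3 * lambda + 2 * mu) * (x ^ 2 - 1)) by lra.
  assert (1 < x ^ 2) by nra. nra.
Qed.

Definition shell_matter (lambda mu K a b : R) (y v : R -> R) : matter :=
  Matter (truncate a b (fun s => K * (y s ^ 2 * v s / s ^ 2)))
         (truncate a b (fun s => pressure lambda mu (y s / s) (v s)))
         (truncate a b (fun s => tan_pressure lambda mu (y s / s) (v s))).

Lemma dens_integrand_continuous (K : R) (y v : R -> R) :
  (forall s, continuous y s /\ continuous v s) ->
  forall s, continuous (fun t => K * (y t ^ 2 * v t)) s.
Proof. intros Hcont s. destruct (Hcont s). cont. Qed.

(** The integrand [K y^2 v] is the derivative of [K y^3 / 3]. As [y' = v] is known only in the open
    interval, the two primitives are compared through the sign of their difference, once in each
    direction. *)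
Lemma shell_matter_mass (lambda mu K S M0 a b : R) (y v : R -> R) (s : R) :
  0 < a -> shell_ode lambda mu K S M0 a b y v ->
  (forall s, continuous y s /\ continuous v s) -> y a = S -> a <= s <= b ->
  shell_mass a (shell_matter lambda mu K a b y v) s = 4 * PI * ((y s ^ 3 - S ^ 3) * K / 3).
Proof.
  intros Ha Hode Hcont Hya Hs. unfold shell_mass. f_equal.
  assert (dens_integrand_continuous := dens_integrand_continuous K y v Hcont).
  pose (F := fun s => RInt (fun t => K * (y t ^ 2 * v t)) a s : R).
  transitivity (F s).
  { apply RInt_ext. intros t. rewrite Rmin_left, Rmax_right by lra. intros Ht.
    simpl. rewrite truncate_in by lra. field. lra. }
  assert (DF : forall u, is_derive F u (K * (y u ^ 2 * v u))).
  { intros u. apply (@is_derive_RInt R_NormedModule (fun t => K * (y t ^ 2 * v t)) F a).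
    - apply filter_forall. intros w. apply (@RInt_correct R_CompleteNormedModule).
      apply (@ex_RInt_continuous R_CompleteNormedModule). intros; apply dens_integrand_continuous.
    - apply dens_integrand_continuous. }
  assert (CF : forall u, continuous F u).
  { intros u. apply (@ex_derive_continuous R_AbsRing R_NormedModule). eexists. apply DF. }
  assert (Fa : F a = 0) by (unfold F; now rewrite RInt_point).
  assert (DG : forall u, a < u < b ->
    is_derive (fun u => (y u ^ 3 - S ^ 3) * K / 3) u (K * (y u ^ 2 * v u))).
  { intros u Hu. destruct (proj2 Hode u Hu) as [_ [Dy _]].
    auto_derive; [now exists (v u)|].
    replace (Derive (fun x => y x) u) with (v u) by (symmetry; now apply is_derive_unique).
    field. }
  apply Rle_antisym; apply Rminus_le.
  - apply (nonpos_of_derive (fun u => F u - (y u ^ 3 - S ^ 3) * K / 3)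
      (fun u => K * (y u ^ 2 * v u) - K * (y u ^ 2 * v u)) a b); [| | |easy].
    + rewrite Fa, Hya. field.
    + intros u Hu. assert (CFu := CF u). destruct (Hcont u). cont. lra.
    + intros u Hu. split; [|lra].
      apply (@is_derive_minus R_AbsRing R_NormedModule); [apply DF|now apply DG].
  - apply (nonpos_of_derive (fun u => (y u ^ 3 - S ^ 3) * K / 3 - F u)
      (fun u => K * (y u ^ 2 * v u) - K * (y u ^ 2 * v u)) a b); [| | |easy].
    + rewrite Fa, Hya. field.
    + intros u Hu. assert (CFu := CF u). destruct (Hcont u). cont. lra.
    + intros u Hu. split; [|lra].
      apply (@is_derive_minus R_AbsRing R_NormedModule); [now apply DG|apply DF].
Qed.

Section Construction.

Variables (n : nat) (r : nat -> R) (T : matter) (lambda mu K S M0 a b : R) (y v : R -> R).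
Hypothesis Hn : (1 < n)%nat.
Hypothesis HT : is_nbody (n - 1) r T.
Hypothesis Hlambda : 0 < lambda.
Hypothesis Hmu : 0 < mu.
Hypothesis HK : 0 < K.
Hypothesis Hra : r (2 * n - 3)%nat < a.
Hypothesis HM : M0 = shell_mass 0 T a.
Hypothesis Hab : a < b.
Hypothesis Hode : shell_ode lambda mu K S M0 a b y v.
Hypothesis Hcont : forall s, continuous y s /\ continuous v s.
Hypothesis Hya : y a = S.
Hypothesis Hv : forall s, a <= s <= b -> 0 <= v s < y s / s.
Hypothesis HPa : pressure lambda mu (S / a) (v a) = 0.
Hypothesis HP : forall s, a < s < b -> 0 < pressure lambda mu (y s / s) (v s).
Hypothesis HPb : pressure lambda mu (y b / b) (v b) = 0.

Let p := r (2 * n - 3)%nat.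

Let p_eq : p = r (2 * (n - 1) - 1)%nat.
Proof. unfold p. f_equal. lia. Qed.

Let p_ge0 : 0 <= p.
Proof. rewrite p_eq. apply (nbody_radii_ge0 (n - 1) r T HT). lia. Qed.

Let Ha : 0 < a. Proof. fold p in Hra. lra. Qed.

Let dens (s : R) := K * (y s ^ 2 * v s / s ^ 2).
Let radial (s : R) := pressure lambda mu (y s / s) (v s).
Let tangential (s : R) := tan_pressure lambda mu (y s / s) (v s).

Let B := shell_matter lambda mu K a b y v.
Let U := matter_add T B.
Let r' := append_radii n r a b.

Let T_zero (s : R) : p < s -> rho T s = 0 /\ prad T s = 0 /\ ptan T s = 0.
Proof. intros Hs. rewrite p_eq in Hs. now apply (nbody_vacuum_outside (n - 1) r T HT). Qed.

Let U_below (s : R) : s < a -> rho U s = rho T s /\ prad U s = prad T s /\ ptan U s = ptan T s.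
Proof. intros Hs. unfold U. simpl. rewrite !truncate_out by lra. lra. Qed.

Let U_shell (s : R) : a <= s <= b ->
  rho U s = dens s /\ prad U s = radial s /\ ptan U s = tangential s.
Proof.
  intros Hs. unfold U. simpl. rewrite !truncate_in by easy.
  fold p in Hra. destruct (T_zero s) as [-> [-> ->]]; [lra|]. rewrite !Rplus_0_l. easy.
Qed.

Let U_vacuum (s : R) : p < s -> ~ (a <= s <= b) ->
  rho U s = 0 /\ prad U s = 0 /\ ptan U s = 0.
Proof.
  intros Hs Hs'. unfold U. simpl. rewrite !truncate_out by easy.
  destruct (T_zero s Hs) as [-> [-> ->]]. lra.
Qed.

Let y_gt (s : R) : a <= s <= b -> 1 < y s / s /\ 0 < y s.
Proof.
  intros Hs. assert (H : 1 < y s / s).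
  { apply (pressure_nonneg_gt_1 lambda mu _ (v s)); try easy; [now apply Hv|].
    destruct (Req_dec s a) as [->|]; [rewrite Hya; lra|].
    destruct (Req_dec s b) as [->|]; [lra|]. apply Rlt_le, HP. lra. }
  split; [easy|]. apply Rmult_lt_reg_r with (/ s); [apply Rinv_0_lt_compat; lra|].
  rewrite Rmult_0_l. unfold Rdiv in H. lra.
Qed.

Let v_pos (s : R) : a < s < b -> 0 < v s. Proof. intros Hs. now apply Hode. Qed.

Let dens_pos (s : R) : a < s < b -> 0 < dens s.
Proof.
  intros Hs. destruct (y_gt s ltac:(lra)) as [_ Hy].
  apply Rmult_lt_0_compat; [easy|]. apply Rdiv_lt_0_compat; [|apply pow_lt; lra].
  apply Rmult_lt_0_compat; [now apply pow_lt|now apply v_pos].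
Qed.

Let Omega_T_lt (s : R) : Omega T s -> 0 < s < p.
Proof.
  intros H. split; [now apply interior_elim in H|].
  apply (nb_Omega (n - 1) r T HT) in H. destruct H as [j [Hj Hs]].
  generalize (nbody_radii_le (n - 1) r T HT (2 * j - 1) (2 * (n - 1) - 1) ltac:(lia) ltac:(lia)).
  rewrite <- p_eq. lra.
Qed.

(** The density may be positive at [a] and [b] too; passing to the interior removes these points,
    and the vacuum between [p] and [a] keeps the shell apart from the other bodies. *)
Let Omega_U (s : R) : Omega U s <-> Omega T s \/ a < s < b.
Proof.
  fold p in Hra. unfold Omega at 1 2. rewrite !interior_locally. split.
  - intros H. destruct (Rlt_le_dec s a) as [Hs|Hs].
    + left. generalize (filter_and _ _ H (open_lt a s Hs)). apply filter_imp.
      intros u [[Hu1 Hu2] Hu3]. destruct (U_below u Hu3) as [E _]. now rewrite E in Hu2.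
    + right.
      assert (Hin : locally s (fun u => a <= u <= b)).
      { generalize (filter_and _ _ H (open_gt p s ltac:(lra))). apply filter_imp.
        intros u [[Hu1 Hu2] Hu3].
        destruct (Rle_dec a u) as [H1|H1]; [destruct (Rle_dec u b) as [H2|H2]; [easy|]|];
          destruct (U_vacuum u Hu3) as [E _]; lra. }
      destruct Hin as [d Hd]. assert (Hd0 := cond_pos d).
      assert (H1 : a <= s - d / 2 <= b).
      { apply Hd. change (Rabs (s - d / 2 - s) < d). rewrite Rabs_left; lra. }
      assert (H2 : a <= s + d / 2 <= b).
      { apply Hd. change (Rabs (s + d / 2 - s) < d). rewrite Rabs_pos_eq; lra. }
      lra.
  - intros [H|H].
    + assert (Hs := Omega_T_lt s). unfold Omega in Hs. rewrite interior_locally in Hs.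
      specialize (Hs H).
      generalize (filter_and _ _ H (open_lt a s ltac:(lra))). apply filter_imp.
      intros u [Hu1 Hu2]. destruct (U_below u Hu2) as [-> _]. easy.
    + generalize (locally_interval a b s H). apply filter_imp. intros u Hu.
      split; [lra|]. destruct (U_shell u ltac:(lra)) as [-> _]. now apply dens_pos.
Qed.

Let adherence_shell (s : R) : a <= s <= b -> adherence (Omega U) s.
Proof.
  intros Hs. apply (adherence_interval _ a b); [easy| |easy].
  intros u Hu. apply Omega_U. now right.
Qed.

Let adherence_above (s : R) : adherence (Omega U) s -> p < s -> a <= s <= b.
Proof.
  intros H Hs. split; apply Rnot_lt_le; intros Hlt; revert H.
  - apply (not_adherence_gap _ p a); [lra|]. intros u Hu HO.
    apply Omega_U in HO. destruct HO as [HO|HO]; [apply Omega_T_lt in HO|]; lra.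
  - apply (not_adherence_gap _ b (s + 1)); [lra|]. intros u Hu HO.
    fold p in Hra. apply Omega_U in HO. destruct HO as [HO|HO]; [apply Omega_T_lt in HO|]; lra.
Qed.

Let adherence_below (s : R) : s < a -> adherence (Omega U) s -> adherence (Omega T) s.
Proof.
  intros Hs H V [d Hd].
  assert (Hm : 0 < Rmin d (a - s)) by (apply Rmin_glb_lt; [apply cond_pos|lra]).
  destruct (H (fun u => Rabs (u - s) < Rmin d (a - s))) as [u [Hu1 Hu2]].
  - exists (mkposreal _ Hm). now intros u Hu.
  - generalize (Rmin_l d (a - s)) (Rmin_r d (a - s)). intros.
    exists u. split; [apply Hd; unfold disc; lra|].
    apply Rabs_def2 in Hu1. apply Omega_U in Hu2. destruct Hu2 as [Hu2|Hu2]; [easy|lra].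
Qed.

Let adherence_T (s : R) : adherence (Omega T) s -> adherence (Omega U) s.
Proof.
  intros H V HV. destruct (H V HV) as [u [Hu1 Hu2]]. exists u. split; [easy|].
  apply Omega_U. now left.
Qed.

Let C1_glue (f g h dh : R -> R) :
  (forall s, s < a -> f s = g s) -> (forall s, a <= s <= b -> f s = h s) ->
  C1_on (Omega T) g ->
  (forall s, a < s < b -> is_derive h s (dh s) /\ continuous dh s) ->
  C1_on (Omega U) f.
Proof.
  intros Hfg Hfh Hg Hh s Hs. apply Omega_U in Hs. revert s Hs. apply C1_on_or.
  - apply C1_on_ext with (2 := Hg). intros s Hs. apply Omega_T_lt in Hs.
    fold p in Hra. generalize (open_lt a s ltac:(lra)). apply filter_imp. apply Hfg.
  - apply C1_on_ext with h; [|now apply C1_on_interval with dh].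
    intros s Hs. generalize (locally_interval a b s Hs). apply filter_imp.
    intros u Hu. apply Hfh. lra.
Qed.

(** Near a point of the closure only one of the two pieces is visible, since the gap between [p] and
    [a] contains no point of the closure; a jump of [f] at [a] is therefore harmless. *)
Let C0_glue (f g h : R -> R) :
  (forall s, s < a -> f s = g s) -> (forall s, a <= s <= b -> f s = h s) ->
  continuous_on (adherence (Omega T)) g ->
  (forall s, a <= s <= b -> continuous h s) ->
  continuous_on (adherence (Omega U)) f.
Proof.
  fold p in Hra. intros Hfg Hfh Hg Hh s Hs P HPP. unfold filtermap, within.
  destruct (Rlt_le_dec s a) as [Hsa|Hsa].
  - rewrite Hfg in HPP by easy.
    pose proof (Hg s (adherence_below s Hsa Hs) P HPP) as H. unfold filtermap, within in H.
    generalize (filter_and _ _ H (open_lt a s Hsa)).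
    apply filter_imp. intros u [Hu1 Hu2] Hu3. rewrite Hfg by easy.
    apply Hu1. now apply adherence_below.
  - assert (Hs' := adherence_above s Hs ltac:(lra)).
    rewrite Hfh in HPP by easy.
    pose proof (Hh s Hs' P HPP) as H. unfold filtermap in H.
    generalize (filter_and _ _ H (open_gt p s ltac:(lra))).
    apply filter_imp. intros u [Hu1 Hu2] Hu3. rewrite Hfh; [easy|].
    now apply adherence_above.
Qed.

Let acc (s : R) := s * force lambda mu K S M0 s (y s / s) (v s) / ((lambda + 2 * mu) * v s).

Let acc_continuous (s : R) : a < s < b -> continuous acc s.
Proof.
  intros Hs. destruct (Hcont s) as [Cy Cv]. assert (Hvs := v_pos s Hs).
  unfold acc, force. cont; try (apply pow_nonzero); try lra.
  apply Rgt_not_eq, Rmult_lt_0_compat; lra.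
Qed.

Let mass_below (s : R) : 0 <= s <= a -> shell_mass 0 U s = shell_mass 0 T s.
Proof.
  intros Hs. unfold shell_mass. f_equal. apply RInt_ext. intros t.
  rewrite Rmin_left, Rmax_right by lra. intros Ht.
  now destruct (U_below t ltac:(lra)) as [-> _].
Qed.

Let mass_shell (s : R) : a <= s <= b ->
  shell_mass 0 U s = M0 + 4 * PI * ((y s ^ 3 - S ^ 3) * K / 3).
Proof.
  intros Hs. rewrite <- (shell_matter_mass lambda mu K S M0 a b y v s) by easy. fold B.
  rewrite HM, <- mass_below by lra.
  replace (shell_mass a B s) with (shell_mass a U s).
  - unfold shell_mass. rewrite <- Rmult_plus_distr_l. f_equal. symmetry.
    apply (RInt_Chasles (fun t => rho U t * t ^ 2)).
    + apply ex_RInt_ext with (fun t => rho T t * t ^ 2).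
      * intros t. rewrite Rmin_left, Rmax_right by lra. intros Ht.
        now destruct (U_below t ltac:(lra)) as [-> _].
      * apply (nbody_mass_outside (n - 1) r T HT). now rewrite <- p_eq.
    + apply ex_RInt_ext with (fun t => K * (y t ^ 2 * v t)).
      * intros t. rewrite Rmin_left, Rmax_right by lra. intros Ht.
        destruct (U_shell t ltac:(lra)) as [-> _].
        change (K * (y t ^ 2 * v t) = dens t * t ^ 2). unfold dens. field. lra.
      * apply (@ex_RInt_continuous R_CompleteNormedModule).
        intros; now apply dens_integrand_continuous.
  - unfold shell_mass. f_equal. apply RInt_ext. intros t.
    rewrite Rmin_left, Rmax_right by lra. intros Ht.
    destruct (U_shell t ltac:(lra)) as [-> _]. simpl. now rewrite truncate_in by lra.
Qed.

Let radii_old (i : nat) : (i <= 2 * n - 3)%nat -> r' i = r i.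
Proof.
  intros Hi. unfold r', append_radii.
  destruct (Nat.eqb_spec i (2 * n - 2)); [lia|].
  destruct (Nat.eqb_spec i (2 * n - 1)); [lia|easy].
Qed.

Let radii_a : r' (2 * n - 2)%nat = a.
Proof. unfold r', append_radii. now rewrite Nat.eqb_refl. Qed.

Let radii_b : r' (2 * n - 1)%nat = b.
Proof.
  unfold r', append_radii. destruct (Nat.eqb_spec (2 * n - 1) (2 * n - 2)); [lia|].
  now rewrite Nat.eqb_refl.
Qed.

Let r_le_p (i : nat) : (i <= 2 * n - 3)%nat -> r i <= p.
Proof. intros Hi. rewrite p_eq. apply (nbody_radii_le (n - 1) r T HT); lia. Qed.

Let dens_derive (s : R) : a < s < b ->
  is_derive dens s (K * ((2 * y s * v s * v s + y s ^ 2 * acc s) / s ^ 2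
                         - 2 * y s ^ 2 * v s / s ^ 3)).
Proof.
  intros Hs. destruct (proj2 Hode s Hs) as [Hvs [Dy Dv]]. fold (acc s) in Dv.
  unfold dens. auto_derive.
  - repeat split; try (eexists; eassumption).
    apply Rmult_integral_contrapositive_currified; [|rewrite Rmult_1_r]; lra.
  - replace (Derive (fun x => y x) s) with (v s) by (symmetry; now apply is_derive_unique).
    replace (Derive (fun x => v x) s) with (acc s) by (symmetry; now apply is_derive_unique).
    field. lra.
Qed.

Let radial_derive (s : R) : a < s < b ->
  is_derive radial s (2 * lambda * (y s / s) * ((v s - y s / s) / s)
    + (lambda + 2 * mu) * v s * acc s).
Proof.
  intros Hs. destruct (proj2 Hode s Hs) as [Hvs [Dy Dv]].
  apply (shell_ode_equilibrium lambda mu K S M0 s y v (acc s)); try easy. lra.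
Qed.

Let tangential_derive (s : R) : a < s < b ->
  is_derive tangential s (2 * (lambda + mu) * (y s / s) * ((v s - y s / s) / s)
    + lambda * v s * acc s).
Proof.
  intros Hs. destruct (proj2 Hode s Hs) as [Hvs [Dy Dv]]. fold (acc s) in Dv.
  unfold tangential, tan_pressure. auto_derive.
  - repeat split; try (eexists; eassumption); lra.
  - replace (Derive (fun x => y x) s) with (v s) by (symmetry; now apply is_derive_unique).
    replace (Derive (fun x => v x) s) with (acc s) by (symmetry; now apply is_derive_unique).
    field. lra.
Qed.

Lemma shell_nbody : is_nbody n r' U.
Proof.
  fold p in Hra.
  split.
  - lia.
  - rewrite radii_old by lia. apply (nb_r0 (n - 1) r T HT).
  - intros i Hi. destruct (le_lt_dec (i + 1) (2 * n - 3)) as [H1|H1].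
    + rewrite !radii_old by lia. apply (nb_incr (n - 1) r T HT). lia.
    + destruct (Nat.eq_dec i (2 * n - 2)) as [->|H2].
      * replace (2 * n - 2 + 1)%nat with (2 * n - 1)%nat by lia. now rewrite radii_a, radii_b.
      * replace (i + 1)%nat with (2 * n - 2)%nat by lia. rewrite radii_a, radii_old by lia.
        generalize (r_le_p i ltac:(lia)). lra.
  - intros s Hs. destruct (Rlt_le_dec s a) as [Hsa|Hsa].
    + destruct (U_below s Hsa) as [-> _]. now apply (nb_rho_ge0 (n - 1) r T HT).
    + destruct (Rle_dec s b) as [Hsb|Hsb].
      * destruct (U_shell s ltac:(lra)) as [-> _].
        destruct (y_gt s ltac:(lra)). destruct (Hv s ltac:(lra)). unfold dens.
        apply Rmult_le_pos; [lra|]. apply Rmult_le_pos.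
        -- apply Rmult_le_pos; [apply pow2_ge_0|easy].
        -- apply Rlt_le, Rinv_0_lt_compat, pow_lt. lra.
      * destruct (U_vacuum s ltac:(lra)) as [-> _]; lra.
  - intros s. rewrite Omega_U, (nb_Omega (n - 1) r T HT). split.
    + intros [[j [Hj Hs]]|Hs].
      * exists j. split; [lia|]. now rewrite !radii_old by lia.
      * exists n. split; [lia|]. now rewrite radii_a, radii_b.
    + intros [j [Hj Hs]]. destruct (Nat.eq_dec j n) as [->|Hjn].
      * right. now rewrite radii_a, radii_b in Hs.
      * left. exists j. split; [lia|]. now rewrite !radii_old in Hs by lia.
  - destruct (nb_C1 (n - 1) r T HT) as [C1 [C2 C3]].
    split; [|split].
    + refine (C1_glue _ (rho T) dens _ _ _ C1 (fun s Hs => conj (dens_derive s Hs) _)).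
      * apply U_below.
      * apply U_shell.
      * destruct (Hcont s). assert (Ca := acc_continuous s Hs).
        cont; try apply pow_nonzero; lra.
    + refine (C1_glue _ (prad T) radial _ _ _ C2 (fun s Hs => conj (radial_derive s Hs) _)).
      * apply U_below.
      * apply U_shell.
      * destruct (Hcont s). assert (Ca := acc_continuous s Hs). cont; lra.
    + refine (C1_glue _ (ptan T) tangential _ _ _ C3 (fun s Hs => conj (tangential_derive s Hs) _)).
      * apply U_below.
      * apply U_shell.
      * destruct (Hcont s). assert (Ca := acc_continuous s Hs). cont; lra.
  - destruct (nb_C0 (n - 1) r T HT) as [C1 [C2 C3]].
    split; [|split].
    + refine (C0_glue _ (rho T) dens _ _ C1 _); [apply U_below|apply U_shell|].
      intros s Hs. destruct (Hcont s). unfold dens. cont. apply pow_nonzero. lra.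
    + refine (C0_glue _ (prad T) radial _ _ C2 _); [apply U_below|apply U_shell|].
      intros s Hs. destruct (Hcont s). unfold radial, pressure. cont. lra.
    + refine (C0_glue _ (ptan T) tangential _ _ C3 _); [apply U_below|apply U_shell|].
      intros s Hs. destruct (Hcont s). unfold tangential, tan_pressure. cont. lra.
  - intros s Hs. apply Omega_U in Hs. destruct Hs as [Hs|Hs].
    + assert (Hsp := Omega_T_lt s Hs).
      rewrite mass_below by lra. destruct (U_below s ltac:(lra)) as [-> [-> ->]].
      rewrite (Derive_ext_loc (prad U) (prad T)).
      * now apply (nb_equilibrium (n - 1) r T HT).
      * generalize (open_lt a s ltac:(lra)). apply filter_imp. apply U_below.
    + rewrite mass_shell by lra. destruct (U_shell s ltac:(lra)) as [-> [-> ->]].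
      rewrite (Derive_ext_loc (prad U) radial).
      * rewrite (is_derive_unique _ _ _ (radial_derive s Hs)).
        destruct (proj2 Hode s Hs) as [Hvs [Dy Dv]].
        destruct (shell_ode_equilibrium lambda mu K S M0 s y v (acc s))
          as [_ Heq]; try easy; [lra|]. now apply Heq.
      * generalize (locally_interval a b s Hs). apply filter_imp. intros u Hu.
        apply U_shell. lra.
  - intros s Hs. apply Omega_U in Hs. destruct Hs as [Hs|Hs].
    + assert (Hsp := Omega_T_lt s Hs). destruct (U_below s ltac:(lra)) as [_ [-> ->]].
      now apply (nb_p_gt0 (n - 1) r T HT).
    + destruct (U_shell s ltac:(lra)) as [_ [-> ->]]. split; [now apply HP|].
      unfold tangential. rewrite tan_pressure_eq by easy.
      destruct (y_gt s ltac:(lra)) as [Hx _]. specialize (HP s Hs).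
      assert (0 < lambda / (lambda + 2 * mu)) by (apply Rdiv_lt_0_compat; lra).
      assert (0 < mu * (3 * lambda + 2 * mu) / (lambda + 2 * mu)).
      { apply Rdiv_lt_0_compat; [apply Rmult_lt_0_compat|]; lra. }
      apply Rplus_lt_0_compat; apply Rmult_lt_0_compat; try easy. nra.
  - intros i Hi. destruct (le_lt_dec i (2 * n - 3)) as [H1|H1].
    + rewrite radii_old by easy. generalize (r_le_p i H1). intros Hri.
      destruct (U_below (r i) ltac:(lra)) as [_ [-> _]].
      apply (nb_boundary (n - 1) r T HT). lia.
    + destruct (Nat.eq_dec i (2 * n - 2)) as [->|H2].
      * rewrite radii_a. destruct (U_shell a ltac:(lra)) as [_ [-> _]].
        unfold radial. now rewrite Hya.
      * replace i with (2 * n - 1)%nat by lia. rewrite radii_b.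
        destruct (U_shell b ltac:(lra)) as [_ [-> _]]. easy.
  - destruct (U_below 0 ltac:(lra)) as [_ [-> ->]]. apply (nb_center (n - 1) r T HT).
  - intros s Hs HA. destruct (Rlt_le_dec s a) as [Hsa|Hsa].
    + destruct (U_below s Hsa) as [-> [-> ->]]. apply (nb_vacuum (n - 1) r T HT); [easy|].
      intros H. now apply HA, adherence_T.
    + apply U_vacuum; [lra|]. intros H. now apply HA, adherence_shell.
  - rewrite radii_old by lia. generalize (r_le_p 0 ltac:(lia)). intros H0.
    destruct (U_below (r 0%nat) ltac:(lra)) as [_ [-> _]]. apply (nb_core (n - 1) r T HT).
Qed.

Theorem shell_matter_outer : is_outer_seth_shell n lambda mu K S r T a b B.
Proof.
  split; [easy|]. split; [|split; [split|apply shell_nbody]].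
  - intros s _ Hs. simpl. now rewrite !truncate_out.
  - easy.
  - intros s Hs. cbv zeta. unfold B.
    rewrite (shell_matter_mass lambda mu K S M0 a b y v s) by (easy || lra).
    unfold shell_matter. cbn [rho prad ptan]. rewrite !truncate_in by lra. cbv beta.
    destruct (y_gt s ltac:(lra)) as [_ Hy].
    replace (K * (y s ^ 2 * v s / s ^ 2) / K) with (y s ^ 2 * v s / s ^ 2) by (field; lra).
    replace ((S / s) ^ 3 + _) with ((y s / s) ^ 3)
      by (generalize PI_RGT_0; intros; field; lra).
    destruct (seth_pressures lambda mu s (y s) (v s)) as [-> ->]; [lra|easy|easy].
Qed.

End Construction.

(** * Inner radius, uniqueness and the theorem *)

Lemma continuous_pos_near (f : R -> R) (a : R) : continuous f a -> 0 < f a ->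
  exists d, 0 < d /\ forall s, Rabs (s - a) < d -> 0 < f s.
Proof.
  intros Hf Hfa. destruct (continuous_Rabs_spec f a Hf (f a) Hfa) as [d [Hd H]].
  exists d. split; [easy|]. intros s Hs. specialize (H s Hs). apply Rabs_def2 in H. lra.
Qed.

Lemma nonneg_at_left_end (f : R -> R) (a b : R) : a < b -> continuous f a ->
  (forall s, a < s < b -> 0 < f s) -> 0 <= f a.
Proof.
  intros Hab Hf Hp. apply Rnot_lt_le. intros Hneg.
  destruct (continuous_pos_near (fun s => 0 - f s) a) as [d [Hd H]].
  { cont. } { lra. }
  destruct (adherence_interval (fun s => 0 < f s) a b a Hab Hp ltac:(lra)
    (fun u => Rabs (u - a) < d)) as [u [Hu1 Hu2]].
  - exists (mkposreal d Hd). now intros u Hu.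
  - specialize (H u Hu1). lra.
Qed.

(* With zero radial pressure at the inner boundary, [ptan >= 0] there forces
   [S >= a]; in the limit case [S = a] the elastic forces vanish and the mass
   [M0] enclosed by the shell makes the pressure decrease. *)
Lemma shell_inner_radius_bounds (lambda mu K S M0 a b : R) (y v : R -> R) :
  0 < lambda -> 0 < mu -> 0 < K -> 0 < S -> 0 < M0 -> 0 < a -> a < b ->
  shell_ode lambda mu K S M0 a b y v -> y a = S -> 0 <= v a ->
  pressure lambda mu (y a / a) (v a) = 0 ->
  (forall s, a < s < b -> 0 < pressure lambda mu (y s / s) (v s)) ->
  (forall s, a < s < b -> 0 < tan_pressure lambda mu (y s / s) (v s)) ->
  lambda * (S / a) ^ 2 <= (3 * lambda + 2 * mu) / 2 /\ a < S.
Proof.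
  intros Hl Hm HK HS HM Ha Hab Hode Hya Hva HPa HP HQ.
  destruct (proj1 Hode a ltac:(lra)) as [Cy Cv].
  assert (Hpa : pressure lambda mu (S / a) (v a) = 0) by now rewrite Hya in HPa.
  assert (Hx0 : 0 < S / a) by now apply Rdiv_lt_0_compat.
  assert (HSa : S / a * a = S) by (field; lra).
  split.
  { unfold pressure in Hpa. assert (0 <= (lambda + 2 * mu) / 2 * v a ^ 2).
    { apply Rmult_le_pos; [lra|apply pow2_ge_0]. } lra. }
  assert (HQa : 0 <= tan_pressure lambda mu (y a / a) (v a)).
  { apply (nonneg_at_left_end (fun s => tan_pressure lambda mu (y s / s) (v s)) a b Hab); [|easy].
    unfold tan_pressure. cont. lra. }
  rewrite Hya, tan_pressure_eq, Hpa in HQa by easy.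
  assert (0 < mu * (3 * lambda + 2 * mu) / (lambda + 2 * mu)).
  { apply Rdiv_lt_0_compat; [apply Rmult_lt_0_compat|]; lra. }
  assert (Hx1 : 1 <= S / a).
  { apply Rnot_lt_le. intros Hlt. assert ((S / a) ^ 2 - 1 < 0) by nra. nra. }
  assert (HaS : a <= S) by nra.
  destruct (Req_dec a S) as [HE|]; [exfalso|lra].
  assert (HX : S / a = 1) by (rewrite <- HE; field; lra).
  assert (Hv1 : v a = 1).
  { rewrite HX in Hpa. unfold pressure in Hpa.
    assert ((lambda + 2 * mu) * (v a ^ 2 - 1) = 0) by lra.
    apply Rmult_integral in H0. nra. }
  pose (dP := fun s => 2 * lambda * (y s / s) * ((v s - y s / s) / s)
    + s * force lambda mu K S M0 s (y s / s) (v s)).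
  assert (HdPa : dP a < 0).
  { unfold dP, force. rewrite Hya, HX, Hv1. rewrite <- HE.
    replace (_ + _) with (- (K * M0 * / a ^ 2)) by (field; lra).
    assert (0 < K * M0 * / a ^ 2); [|lra].
    apply Rmult_lt_0_compat; [now apply Rmult_lt_0_compat|].
    apply Rinv_0_lt_compat, pow_lt. lra. }
  destruct (continuous_pos_near (fun s => 0 - dP s) a) as [d [Hd HdP]]; [|lra|].
  { unfold dP, force. cont; try apply pow_nonzero; lra. }
  pose (c := a + Rmin (d / 2) ((b - a) / 2)).
  assert (Hc : 0 < Rmin (d / 2) ((b - a) / 2)) by (apply Rmin_glb_lt; lra).
  generalize (Rmin_l (d / 2) ((b - a) / 2)) (Rmin_r (d / 2) ((b - a) / 2)). intros Hc1 Hc2.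
  apply (Rlt_not_le (pressure lambda mu (y c / c) (v c)) 0); [apply HP; unfold c; lra|].
  apply (nonpos_of_derive (fun s => pressure lambda mu (y s / s) (v s)) dP a c);
    [easy| | |unfold c; lra].
  - intros s Hs. destruct (proj1 Hode s ltac:(unfold c in *; lra)).
    unfold pressure. cont. lra.
  - intros s Hs. unfold c in Hs. destruct (proj2 Hode s ltac:(lra)) as [Hvs [Dy Dv]].
    split.
    + replace (dP s) with (2 * lambda * (y s / s) * ((v s - y s / s) / s) + (lambda + 2 * mu) * v s
        * (s * force lambda mu K S M0 s (y s / s) (v s) / ((lambda + 2 * mu) * v s)))
        by (unfold dP; field; lra).
      apply (shell_ode_equilibrium lambda mu K S M0 s y v _); try easy. lra.
    + specialize (HdP s). rewrite Rabs_pos_eq in HdP by lra. specialize (HdP ltac:(lra)). lra.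
Qed.

Lemma r_min_sqr (lambda mu S : R) : 0 < lambda -> 0 < mu ->
  r_min lambda mu S ^ 2 = 2 * lambda / (3 * lambda + 2 * mu) * S ^ 2.
Proof.
  intros Hl Hm. unfold r_min. rewrite Rpow_mult_distr, <- Rsqr_pow2, Rsqr_sqrt; [easy|].
  apply Rlt_le, Rdiv_lt_0_compat; lra.
Qed.

Lemma r_min_bounds (lambda mu S : R) : 0 < lambda -> 0 < mu -> 0 < S ->
  0 < r_min lambda mu S < S.
Proof.
  intros Hl Hm HS. split.
  - apply Rmult_lt_0_compat; [|easy]. apply sqrt_lt_R0, Rdiv_lt_0_compat; lra.
  - unfold r_min. rewrite <- (Rmult_1_l S) at 2. apply Rmult_lt_compat_r; [easy|].
    rewrite <- sqrt_1. apply sqrt_lt_1_alt. split.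
    + apply Rlt_le, Rdiv_lt_0_compat; lra.
    + apply Rmult_lt_reg_r with (3 * lambda + 2 * mu); [lra|].
      replace (_ / _ * _) with (2 * lambda) by (field; lra). lra.
Qed.

(** By the choice of [r_min], [lambda (S / a)^2] equals [(3 lambda + 2 mu) / 2] times
    [(r_min / a)^2]. *)
Lemma r_min_le_iff (lambda mu S a : R) : 0 < lambda -> 0 < mu -> 0 < S -> 0 < a ->
  (r_min lambda mu S <= a <-> lambda * (S / a) ^ 2 <= (3 * lambda + 2 * mu) / 2) /\
  (a = r_min lambda mu S <-> lambda * (S / a) ^ 2 = (3 * lambda + 2 * mu) / 2).
Proof.
  intros Hl Hm HS Ha.
  assert (Hr := proj1 (r_min_bounds lambda mu S Hl Hm HS)).
  assert (E : lambda * (S / a) ^ 2 =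
    (3 * lambda + 2 * mu) / 2 * (r_min lambda mu S / a) ^ 2).
  { replace ((r_min lambda mu S / a) ^ 2) with (r_min lambda mu S ^ 2 / a ^ 2) by (field; lra).
    rewrite r_min_sqr by easy. field. lra. }
  rewrite E. set (q := r_min lambda mu S / a).
  assert (Hq : 0 < q) by now apply Rdiv_lt_0_compat.
  assert (Eq : q * a = r_min lambda mu S) by (unfold q; field; lra).
  assert (Hc : 0 < (3 * lambda + 2 * mu) / 2) by lra.
  set (c := (3 * lambda + 2 * mu) / 2) in *. clearbody c q. clear E.
  rewrite <- Eq. split; split; intros H.
  - assert (q <= 1) by (apply Rmult_le_reg_r with a; lra).
    assert (q ^ 2 <= 1) by nra. nra.
  - assert (q ^ 2 <= 1) by (apply Rmult_le_reg_l with c; lra).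
    assert (q <= 1) by nra. nra.
  - assert (q = 1) by (apply Rmult_eq_reg_r with a; lra). subst q. ring.
  - assert (q ^ 2 = 1) by (apply Rmult_eq_reg_l with c; lra).
    assert (q = 1) by nra. subst q. ring.
Qed.

(** Zero pressure at [a] determines [v0^2 = h a], which is nonnegative from [r_min] on and vanishes
    at [r_min]. The slope condition [F > 0] holds there because its gravity part contains the factor
    [v0 = 0], and it extends to nearby [a] by continuity; the minimum with half the distance to [S]
    keeps [rmax < S]. *)
Lemma r_max_exists (lambda mu K S M : R) : 0 < lambda -> 0 < mu -> 0 < S ->
  exists rmax, r_min lambda mu S < rmax < S /\
    forall a, r_min lambda mu S <= a < rmax -> exists v0,
      0 <= v0 /\ pressure lambda mu (S / a) v0 = 0 /\
      (v0 = 0 <-> a = r_min lambda mu S) /\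
      K * (S / a) ^ 2 * v0 * M < 2 * mu * ((S / a) ^ 2 - v0 ^ 2) * a.
Proof.
  intros Hl Hm HS. assert (Hr := r_min_bounds lambda mu S Hl Hm HS).
  set (r0 := r_min lambda mu S) in *.
  pose (h := fun a => 2 / (lambda + 2 * mu) * ((3 * lambda + 2 * mu) / 2 - lambda * (S / a) ^ 2)).
  pose (w := fun a => sqrt (h a)).
  assert (Hi2 : 0 < 2 / (lambda + 2 * mu)) by (apply Rdiv_lt_0_compat; lra).
  assert (Hh0 : h r0 = 0).
  { unfold h. rewrite (proj1 (proj2 (r_min_le_iff lambda mu S r0 Hl Hm HS ltac:(lra))) eq_refl).
    ring. }
  pose (F := fun a => 2 * mu * ((S / a) ^ 2 - w a ^ 2) * a - K * (S / a) ^ 2 * w a * M).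
  destruct (continuous_pos_near F r0) as [d [Hd HF]].
  { assert (Cw : continuous w r0).
    { unfold w. apply (continuous_sqrt_comp h). unfold h. cont. lra. }
    unfold F. cont; lra. }
  { unfold F, w. rewrite Hh0, sqrt_0.
    replace (_ - _) with (2 * mu * (S / r0) ^ 2 * r0) by ring.
    apply Rmult_lt_0_compat; [|lra]. apply Rmult_lt_0_compat; [lra|].
    apply pow_lt, Rdiv_lt_0_compat; lra. }
  exists (r0 + Rmin (d / 2) ((S - r0) / 2)).
  assert (Hp : 0 < Rmin (d / 2) ((S - r0) / 2)) by (apply Rmin_glb_lt; lra).
  generalize (Rmin_l (d / 2) ((S - r0) / 2)) (Rmin_r (d / 2) ((S - r0) / 2)). intros H1 H2.
  split; [lra|]. intros a Ha.
  destruct (r_min_le_iff lambda mu S a Hl Hm HS ltac:(lra)) as [G1 G2]. fold r0 in G1, G2.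
  assert (Hha : 0 <= h a).
  { unfold h. apply Rmult_le_pos; [lra|]. generalize (proj1 G1 (proj1 Ha)). lra. }
  assert (Hw2 : w a ^ 2 = h a) by (unfold w; now rewrite <- Rsqr_pow2, Rsqr_sqrt).
  exists (w a). split; [apply sqrt_pos|]. split; [|split].
  - unfold pressure. rewrite Hw2. unfold h. field. lra.
  - rewrite G2. split; intros H.
    + rewrite H in Hw2. unfold h in Hw2. rewrite pow_i in Hw2 by lia.
      symmetry in Hw2. apply Rmult_integral in Hw2. lra.
    + unfold w. replace (h a) with 0; [apply sqrt_0|]. unfold h. rewrite H. ring.
  - specialize (HF a ltac:(rewrite Rabs_pos_eq; lra)). unfold F in HF. lra.
Qed.

Lemma shell_ode_shrink (lambda mu K S M0 a b c : R) (y v : R -> R) : c <= b ->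
  shell_ode lambda mu K S M0 a b y v -> shell_ode lambda mu K S M0 a c y v.
Proof. intros Hcb [H1 H2]. split; intros s Hs; [apply H1|apply H2]; lra. Qed.

(** From [a] on the inner distribution vanishes and below [a] the shell does, so the sum can be
    replaced by [B] in the fields and by [T] in the mass enclosed by the shell. *)
Lemma outer_shell_ode (n : nat) (lambda mu K S a b : R) (r : nat -> R) (T B : matter) :
  (1 < n)%nat -> 0 < lambda -> 0 < mu -> 0 < K -> 0 < S ->
  is_nbody (n - 1) r T -> r (2 * n - 3)%nat < a ->
  is_outer_seth_shell n lambda mu K S r T a b B ->
  exists y v : R -> R,
    shell_ode lambda mu K S (shell_mass 0 T a) a b y v /\ y a = S /\
    (forall s, a <= s <= b -> 0 <= v s /\
      rho B s = K * (y s ^ 2 * v s / s ^ 2) /\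
      prad B s = pressure lambda mu (y s / s) (v s) /\
      ptan B s = tan_pressure lambda mu (y s / s) (v s)) /\
    prad B a = 0 /\ prad B b = 0 /\ (forall s, a < s < b -> 0 < prad B s).
Proof.
  intros Hn Hl Hm HK HS HT Hra [Hab [Hsup [[Ha Hseth] HU]]].
  assert (T0 : forall s, a <= s -> rho T s = 0 /\ prad T s = 0 /\ ptan T s = 0).
  { intros s Hs. apply (nbody_vacuum_outside (n - 1) r T HT).
    replace (2 * (n - 1) - 1)%nat with (2 * n - 3)%nat by lia. lra. }
  set (U := matter_add T B) in *.
  assert (UB : forall s, a <= s ->
    rho U s = rho B s /\ prad U s = prad B s /\ ptan U s = ptan B s).
  { intros s Hs. unfold U. simpl. destruct (T0 s Hs) as [-> [-> ->]]. lra. }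
  set (r' := append_radii n r a b) in *.
  assert (Ea : r' (2 * n - 2)%nat = a) by (unfold r', append_radii; now rewrite Nat.eqb_refl).
  assert (Eb : r' (2 * n - 1)%nat = b).
  { unfold r', append_radii. destruct (Nat.eqb_spec (2 * n - 1) (2 * n - 2)); [lia|].
    now rewrite Nat.eqb_refl. }
  assert (EM : shell_mass 0 U a = shell_mass 0 T a).
  { unfold shell_mass. f_equal. apply RInt_ext. intros t.
    rewrite Rmin_left, Rmax_right by lra. intros Ht. unfold U. simpl.
    destruct (Hsup t ltac:(lra) ltac:(lra)) as [-> _]. now rewrite Rplus_0_r. }
  destruct (seth_shell_ode n r' U lambda mu K S HU Hl Hm HK HS) as [y [v [H1 [H2 H3]]]].
  { rewrite Ea, Eb. split; [easy|]. intros s Hs. cbv zeta.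
    destruct (UB s ltac:(lra)) as [-> [-> ->]].
    replace (shell_mass a U s) with (shell_mass a B s); [now apply Hseth|].
    unfold shell_mass. f_equal. apply RInt_ext. intros t.
    rewrite Rmin_left, Rmax_right by lra. intros Ht.
    now destruct (UB t ltac:(lra)) as [-> _]. }
  rewrite Ea, Eb, EM in *.
  exists y, v. split; [easy|]. split; [easy|]. split; [|split; [|split]].
  - intros s Hs. destruct (H3 s Hs) as [K1 K2]. split; [easy|].
    destruct (UB s ltac:(lra)) as [E1 [E2 E3]]. now rewrite <- E1, <- E2, <- E3.
  - destruct (UB a ltac:(lra)) as [_ [<- _]]. rewrite <- Ea at 1.
    apply (nb_boundary n r' U HU). lia.
  - destruct (UB b ltac:(lra)) as [_ [<- _]]. rewrite <- Eb at 1.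
    apply (nb_boundary n r' U HU). lia.
  - intros s Hs. destruct (UB s ltac:(lra)) as [_ [<- _]].
    apply (nb_p_gt0 n r' U HU).
    apply (nbody_body n r' U HU (n - 1)); [lia|].
    replace (2 * (n - 1))%nat with (2 * n - 2)%nat by lia.
    replace (2 * n - 2 + 1)%nat with (2 * n - 1)%nat by lia. now rewrite Ea, Eb.
Qed.

Theorem outer_seth_shell_unique (n : nat) (lambda mu K S a b b' : R) (r : nat -> R)
  (T B B' : matter) :
  (1 < n)%nat -> 0 < lambda -> 0 < mu -> 0 < K -> 0 < S ->
  is_nbody (n - 1) r T -> r (2 * n - 3)%nat < a ->
  is_outer_seth_shell n lambda mu K S r T a b B ->
  is_outer_seth_shell n lambda mu K S r T a b' B' -> b' = b /\ matter_eq B' B.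
Proof.
  intros Hn Hl Hm HK HS HT Hra HB HB'.
  destruct (outer_shell_ode n lambda mu K S a b r T B) as
    [y [v [Hode [Hy [Hf [Hpa [Hpb Hp]]]]]]]; try easy.
  destruct (outer_shell_ode n lambda mu K S a b' r T B') as
    [y' [v' [Hode' [Hy' [Hf' [Hpa' [Hpb' Hp']]]]]]]; try easy.
  destruct HB as [Hab [Hsup [[Ha _] _]]]. destruct HB' as [Hab' [Hsup' _]].
  assert (HM : 0 <= shell_mass 0 T a).
  { assert (Hpos := nbody_mass_pos (n - 1) r T HT (2 * (n - 1) - 1) ltac:(lia)).
    destruct (nbody_mass_outside (n - 1) r T HT a) as [_ ->]; [|lra].
    now replace (2 * (n - 1) - 1)%nat with (2 * n - 3)%nat by lia. }
  destruct (Hf a ltac:(lra)) as [Hva [_ [Ep _]]].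
  destruct (Hf' a ltac:(lra)) as [Hva' [_ [Ep' _]]].
  (* The condition [prad = 0] at [a], with [y a = S] in both cases, fixes [v^2], and [v >= 0] fixes
     the sign. *)
  assert (Hv : v a = v' a).
  { rewrite Hpa, Hy in Ep. rewrite Hpa', Hy' in Ep'. unfold pressure in Ep, Ep'.
    assert ((lambda + 2 * mu) * (v a ^ 2 - v' a ^ 2) = 0) by lra.
    apply Rmult_integral in H. nra. }
  assert (Huniq : forall s, a <= s <= Rmin b b' -> y s = y' s /\ v s = v' s).
  { apply (shell_ode_unique lambda mu K S (shell_mass 0 T a) a (Rmin b b')); try easy.
    - now apply Rmin_glb_lt.
    - apply shell_ode_shrink with (2 := Hode). apply Rmin_l.
    - apply shell_ode_shrink with (2 := Hode'). apply Rmin_r. }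
  (* Up to the smaller outer radius the shells agree; there the shorter one has zero pressure, while
     for the longer one the point is interior and the pressure positive. *)
  assert (Hb : b' = b).
  { destruct (Rtotal_order b' b) as [Hlt|[He|Hgt]]; [exfalso|easy|exfalso].
    - destruct (Huniq b') as [E1 E2]; [rewrite Rmin_right; lra|].
      destruct (Hf b' ltac:(lra)) as [_ [_ [F1 _]]].
      destruct (Hf' b' ltac:(lra)) as [_ [_ [F1' _]]].
      specialize (Hp b' ltac:(lra)). rewrite F1, E1, E2, <- F1' in Hp. lra.
    - destruct (Huniq b) as [E1 E2]; [rewrite Rmin_left; lra|].
      destruct (Hf b ltac:(lra)) as [_ [_ [F1 _]]].
      destruct (Hf' b ltac:(lra)) as [_ [_ [F1' _]]].
      specialize (Hp' b ltac:(lra)). rewrite F1', <- E1, <- E2, <- F1 in Hp'. lra. }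
  split; [easy|]. subst b'. rewrite Rmin_left in Huniq by lra.
  intros s Hs. destruct (Rle_dec a s) as [H1|H1]; [destruct (Rle_dec s b) as [H2|H2]|].
  - destruct (Huniq s ltac:(lra)) as [E1 E2].
    destruct (Hf s ltac:(lra)) as [_ [-> [-> ->]]].
    destruct (Hf' s ltac:(lra)) as [_ [-> [-> ->]]]. now rewrite E1, E2.
  - destruct (Hsup s Hs ltac:(lra)) as [-> [-> ->]]. apply Hsup'; lra.
  - destruct (Hsup s Hs ltac:(lra)) as [-> [-> ->]]. apply Hsup'; lra.
Qed.

Theorem theorem4 (n : nat) (lambda mu Kref Sref : R)
  (hn : (1 < n)%nat) (hlambda : 0 < lambda) (hmu : 0 < mu)
  (hK : 0 < Kref) (hS : 0 < Sref) :
  (forall (r : nat -> R) (T : matter),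
     is_nbody n r T ->
     is_seth_shell lambda mu Kref Sref
       (r (2 * n - 2)%nat) (r (2 * n - 1)%nat) T ->
     r_min lambda mu Sref <= r (2 * n - 2)%nat < Sref /\
     r (2 * n - 3)%nat < Sref)
  /\
  (forall (r : nat -> R) (T : matter),
     is_nbody (n - 1) r T ->
     r (2 * n - 3)%nat < r_min lambda mu Sref ->
     exists rmax : R,
       r_min lambda mu Sref < rmax < Sref /\
       forall a : R, r_min lambda mu Sref <= a < rmax ->
       exists (b : R) (B : matter),
         is_outer_seth_shell n lambda mu Kref Sref r T a b B /\
         (forall (b' : R) (B' : matter),
            is_outer_seth_shell n lambda mu Kref Sref r T a b' B' ->
            b' = b /\ matter_eq B' B) /\
         (rho B a = 0 <-> a = r_min lambda mu Sref) /\
         0 < rho B b /\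
         (let L := Rpower (Sref ^ 3
                     + 3 * shell_mass a B b / (4 * PI * Kref)) (1 / 3) in
          sqrt (2 * lambda / (3 * lambda + 2 * mu)) * L < b < L)).
Proof.
  split.
  - intros r T HT Hseth.
    destruct (seth_shell_ode n r T lambda mu Kref Sref HT hlambda hmu hK hS Hseth)
      as [y [v [Hode [Hy Hf]]]].
    assert (Hab := nbody_radii_lt n r T HT (2 * n - 2) (2 * n - 1) ltac:(lia) ltac:(lia)).
    assert (Hra := nbody_radii_lt n r T HT (2 * n - 3) (2 * n - 2) ltac:(lia) ltac:(lia)).
    assert (Ha := proj1 Hseth).
    set (a := r (2 * n - 2)%nat) in *. set (b := r (2 * n - 1)%nat) in *.
    assert (HO : forall s, a < s < b -> 0 < prad T s /\ 0 < ptan T s).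
    { intros s Hs. apply (nb_p_gt0 n r T HT), (nbody_body n r T HT (n - 1)); [lia|].
      replace (2 * (n - 1))%nat with (2 * n - 2)%nat by lia.
      now replace (2 * n - 2 + 1)%nat with (2 * n - 1)%nat by lia. }
    destruct (Hf a ltac:(lra)) as [Hva [_ [Ea _]]].
    destruct (shell_inner_radius_bounds lambda mu Kref Sref (shell_mass 0 T a) a b y v)
      as [B1 B2]; try easy.
    + apply (nbody_mass_pos n r T HT). lia.
    + rewrite <- Ea. apply (nb_boundary n r T HT). lia.
    + intros s Hs. destruct (Hf s ltac:(lra)) as [_ [_ [<- _]]]. now apply HO.
    + intros s Hs. destruct (Hf s ltac:(lra)) as [_ [_ [_ <-]]]. now apply HO.
    + apply (r_min_le_iff lambda mu Sref a) in B1; try easy. lra.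
  - intros r T HT Hr.
    assert (Hrm := r_min_bounds lambda mu Sref hlambda hmu hS).
    (* The inner mass is taken at the outer radius of the last inner body. It is the same at every
       larger [a], so [rmax] can be chosen before [a]. *)
    destruct (r_max_exists lambda mu Kref Sref (shell_mass 0 T (r (2 * (n - 1) - 1)%nat)))
      as [rmax [Hrmax Hv0]]; try easy.
    exists rmax. split; [easy|]. intros a Har.
    destruct (Hv0 a Har) as [v0 [Hv0p [Hp0 [Hv00 Hslope]]]].
    assert (HM := nbody_mass_pos (n - 1) r T HT (2 * (n - 1) - 1) ltac:(lia)).
    destruct (nbody_mass_outside (n - 1) r T HT a) as [_ EM].
    { replace (2 * (n - 1) - 1)%nat with (2 * n - 3)%nat by lia. lra. }
    destruct (shell_ode_exists lambda mu Kref Sref (shell_mass 0 T a) a v0) as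
      [b [y [v [Hab [Hode [Hc [Hy [Hva [Hvb [Hv [HP HPb]]]]]]]]]]]; try easy;
      rewrite ?EM; try easy; try lra.
    subst v0.
    assert (Hout : is_outer_seth_shell n lambda mu Kref Sref r T a b
      (shell_matter lambda mu Kref a b y v)).
    { apply (shell_matter_outer n r T lambda mu Kref Sref (shell_mass 0 T a)); try easy; lra. }
    assert (Hxb : 1 < y b / b).
    { apply (pressure_nonneg_gt_1 lambda mu _ (v b)); try easy; [apply Hv|]; lra. }
    assert (Hyb : y b = y b / b * b) by (field; lra).
    exists b, (shell_matter lambda mu Kref a b y v).
    split; [easy|]. split; [|split; [|split]].
    + intros b' B' HB'.
      apply (outer_seth_shell_unique n lambda mu Kref Sref a b b' r T); try easy. lra.
    + rewrite <- Hv00. unfold shell_matter. cbn [rho]. rewrite truncate_in, Hy by lra.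
      assert (Hq : 0 < Kref * (Sref ^ 2 / a ^ 2)).
      { apply Rmult_lt_0_compat; [easy|]. apply Rdiv_lt_0_compat; apply pow_lt; lra. }
      replace (Kref * (Sref ^ 2 * v a / a ^ 2)) with (Kref * (Sref ^ 2 / a ^ 2) * v a)
        by (field; lra).
      split; intros H; [apply Rmult_integral in H; lra|rewrite H; ring].
    + unfold shell_matter. cbn [rho]. rewrite truncate_in by lra.
      apply Rmult_lt_0_compat; [easy|]. apply Rdiv_lt_0_compat; [|apply pow_lt; lra].
      apply Rmult_lt_0_compat; [apply pow_lt; nra|easy].
    + rewrite (shell_matter_mass lambda mu Kref Sref (shell_mass 0 T a) a b y v)
        by (try easy; lra).
      replace (Sref ^ 3 + _) with (y b ^ 3) by (generalize PI_RGT_0; intros; field; lra).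
      destruct (Rpower_cube (y b)) as [-> _]; [nra|]. cbv zeta. split; [|nra].
      (* With [L = y b] and [x = y b / b] the two bounds on [b] say [k x < 1 < x], where [k] is the
         square root. The first follows from [prad = 0] at [b]: since [v b > 0], [lambda x^2] lies
         strictly below [(3 lambda + 2 mu) / 2]. *)
      assert (HR : sqrt (2 * lambda / (3 * lambda + 2 * mu)) * (y b / b) < 1).
      { assert (Hk : 0 <= sqrt (2 * lambda / (3 * lambda + 2 * mu))) by apply sqrt_pos.
        assert (Hk2 : sqrt (2 * lambda / (3 * lambda + 2 * mu)) ^ 2
          = 2 * lambda / (3 * lambda + 2 * mu)).
        { rewrite <- Rsqr_pow2. apply Rsqr_sqrt, Rlt_le, Rdiv_lt_0_compat; lra. }
        set (k := sqrt _) in *. set (x := y b / b) in *.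
        assert (Hx2 : lambda * x ^ 2 < (3 * lambda + 2 * mu) / 2).
        { unfold pressure in HPb.
          assert (0 < (lambda + 2 * mu) / 2 * v b ^ 2).
          { apply Rmult_lt_0_compat; [lra|now apply pow_lt]. } lra. }
        assert ((k * x) ^ 2 < 1).
        { rewrite Rpow_mult_distr, Hk2.
          apply Rmult_lt_reg_r with ((3 * lambda + 2 * mu) / 2); [lra|].
          replace (_ * _ * _) with (lambda * x ^ 2) by (field; lra). lra. }
        nra. }
      rewrite Hyb, <- Rmult_assoc. nra.
Qed.
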